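(* There are constants $d_0$ and $C$ such that for every integer $d \geq d_0$, \[ \lambda(d) \leq C d^{-1/3} (\log d)^2 . \]
   Context: $\mathbb{Z}^d$ also denotes the nearest-neighbor graph on the vertex set $\mathbb{Z}^d$: two vertices are adjacent iff their $L^1$-distance is $1$. $\log$ is the natural logarithm. For a graph with vertex set $V$ (countable, locally finite), a configuration $\omega \in \{0,1\}^V$ (or in $\{0,1\}^{W}$ for $W\subseteq V$) is feasible if no two adjacent vertices $v_1,v_2$ satisfy $\omega(v_1)=\omega(v_2)=1$. Let $\lambda > 0$. A hard-core measure with activity $\lambda$ on an infinite graph is a probability measure $\mu$ on $\{0,1\}^V$ such that for each finite $W \subseteq V$, every $\omega_1 \in \{0,1\}^W$, and $\mu$-a.e. $\omega_2 \in \{0,1\}^{V\setminus W}$, \[ \mu\bigl(\omega|_W = \omega_1 \,\big|\, \omega|_{V\setminus W} = \omega_2\bigr) = \begin{cases} Z_W^{-1}\prod_{v\in W}\lambda^{\omega_1(v)} & \text{if } \omega_1\sqcup\omega_2 \text{ is feasible},\\ 0 & \text{otherwise},\end{cases} \] where $\omega_1 \sqcup \omega_2$ is the configuration on $V$ agreeing with $\omega_1$ on $W$ and with $\omega_2$ on $V\setminus W$, and $Z_W$ (depending on $W$ and $\omega_2$) is the normalizing constant. $\lambda(d)$ is defined as the supremum of those $\lambda>0$ for which there is a unique hard-core measure with activity $\lambda$ on the graph $\mathbb{Z}^d$. *)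

(* Defs.v *)
From HB Require Import structures.
From mathcomp Require Import all_boot all_order all_algebra finmap.
From mathcomp Require Import all_classical all_reals all_analysis.

Set Implicit Arguments.
Unset Strict Implicit.
Unset Printing Implicit Defensive.
Import Order.TTheory GRing.Theory Num.Theory.
Local Open Scope classical_set_scope.
Local Open Scope ring_scope.

Definition cylinders (T : Type) : set (set (T -> bool)) :=
  [set A | exists (v : T) (b : bool), A = [set w | w v = b]].

(* {0,1}^T with its product sigma-algebra *)
Definition config (T : Type) := g_sigma_algebraType (@cylinders T).

Definition outside (V : countType) (W : {fset V}) : Type := {v : V | v \notin W}.

Definition restr (V : countType) (W : {fset V}) (w : config V) :
    config (outside W) :=
  fun v => w (val v).
Arguments restr {V} W w.

Section HardCore.
Variables (R : realType) (V : countType) (e : rel V).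

Definition feasible (w : V -> bool) : Prop :=
  forall v1 v2 : V, e v1 v2 -> ~~ (w v1 && w v2).

Definition agree (W : {fset V}) (w1 : {ffun W -> bool}) : set (config V) :=
  [set w | forall v : W, w (val v) = w1 v].

(* Exactly one of the two partial injections succeeds, so the final [false] is
   never reached. *)
Definition glue_config (W : {fset V}) (w1 : {ffun W -> bool})
    (w2 : config (outside W)) : V -> bool :=
  fun v => if insub v is Some x then w1 x
           else if insub v is Some y then w2 y else false.

Definition weight (lambda : R) (W : {fset V}) (w1 : {ffun W -> bool}) : R :=
  \prod_(v : W) lambda ^+ (w1 v).

Definition partition_function (lambda : R) (W : {fset V})
    (w2 : config (outside W)) : R :=
  \sum_(w1 : {ffun W -> bool} | `[< feasible (glue_config w1 w2) >]) weight lambda w1.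

Definition specification (lambda : R) (W : {fset V}) (w1 : {ffun W -> bool})
    (w2 : config (outside W)) : R :=
  if `[< feasible (glue_config w1 w2) >]
  then (partition_function lambda w2)^-1 * weight lambda w1 else 0.

(* [f w2] is a version of mu(E | w outside W = w2). *)
Definition is_cond_prob (mu : probability (config V) R) (W : {fset V})
    (E : set (config V)) (f : config (outside W) -> R) : Prop :=
  measurable_fun setT f /\
  forall A : set (config (outside W)), measurable A ->
    (mu (E `&` restr W @^-1` A)
     = \int[mu]_(w in restr W @^-1` A) (f (restr W w))%:E)%E.

Definition hard_core (lambda : R) (mu : probability (config V) R) : Prop :=
  forall (W : {fset V}) (w1 : {ffun W -> bool}),
    exists2 f : config (outside W) -> R, is_cond_prob mu (agree w1) f &
      {ae mu, forall w, f (restr W w) = specification lambda w1 (restr W w)}.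

(* A [probability] is a function on all sets whose values on non-measurable
   sets are junk, hence the comparison on measurable sets only. *)
Definition unique_hard_core (lambda : R) : Prop :=
  exists mu : probability (config V) R, hard_core lambda mu /\
    forall nu : probability (config V) R, hard_core lambda nu ->
      forall A : set (config V), measurable A -> nu A = mu A.

End HardCore.

Definition lattice_adj (d : nat) : rel 'rV[int]_d :=
  fun x y => \sum_(i < d) `|x 0 i - y 0 i| == 1.

(* The supremum is taken in the extended reals, as [sup] on [R] would return 0
   for an unbounded set. *)
Definition lambda_c (R : realType) (d : nat) : \bar R :=
  ereal_sup [set lambda%:E | lambda in
    [set lambda : R | 0 < lambda /\ unique_hard_core (@lattice_adj d) lambda]].

(* Main.v *)
(** Above the threshold two hard-core measures are obtained from a Peierls argument
    on tori of side [2 ^ k.+2]. A cell is a unit cube of the torus, hence a copy of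
    the hypercube; the trace of an independent set on it is bad if both parity
    classes are well occupied, or if in some facet neither of them is. A good cell
    thus has a phase, even or odd, and adjacent good cells have the same phase.

    Containers for the neighbourhoods in the hypercube show that the bad traces
    carry at most a fraction [expR (- G)] of the weight, with [G] of order
    [lambda ^ 3 * 2 ^ d / (ln d * sqrt d)]; reflection positivity (the chessboard
    estimate) turns this into a bound on the number of bad cells in any set of
    cells. Group the cells in blocks, namely the [2 ^ d] translates of a cell by the
    vectors of [{0,1}^d]. By isoperimetry in the hypercube a block has a dominating
    phase unless a fraction of order [1 / sqrt d] of its cells is bad, and [m]
    disjoint blocks are all of the latter kind with probability at most
    [100 ^ (- m)]: this is where [lambda ^ 3 * d >= ln d ^ 6] is needed.

    By counting contours in a plane, the phases at the origin and at distance half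
    the side agree with probability at least 39/40, whereas each phase has
    probability close to 1/2, since a unit translation exchanges them. The measures
    conditioned on the phase of the far block have limits along an ultrafilter; as
    the far block leaves every finite window, these limits are hard-core measures,
    and they disagree on the phase of the origin. *)

Require Import Defs.
From HB Require Import structures.
From mathcomp Require Import all_boot all_order all_algebra finmap.
From mathcomp Require Import all_classical all_reals all_analysis.
From mathcomp Require Import ring lra zify.
From mathcomp Require Import fintype finset.

Set Implicit Arguments.
Unset Strict Implicit.
Unset Printing Implicit Defensive.
Import Order.TTheory GRing.Theory Num.Theory.
Local Open Scope ring_scope.

(** * The hypercube *)

(** Uniqueness is not assumed monotone in the activity, so coexistence is proved at every activity
    above the threshold; [act], the minimum of [lam] and 1, treats them all at once through ln (1 +
    lam) >= act / 2. The obstacle behind the blocks: Hoelder's inequality, which reduces a torus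
    with all cells marked to one hypercube, takes 2^d-th roots. A single bad cell thus gains only
    expR (G / 2^d), a factor close to 1, and about 2^d / sqrt d bad cells must act together. A bad
    block gains G / (100 sqrt d), of order lambda^3 2^d / (d ln d), and pays once the entropy [eta]
    of the containers, of order (ln d)^2 2^d / d^2. Their comparison gives the exponent 1/3; spare
    logarithms absorb the numerical constants. Of the three factors lambda in G, one is the
    threshold [K0] under which a parity class counts as sparse. The other two form the rate [kappa0]
    gained per unit of excess of a neighbourhood over its hull: one is ln (1 + lambda), the other
    the tolerance, of order lambda / ln d, by which a container may exceed its kernel. *)

Definition cube n := {ffun 'I_n -> bool}.

Definition flip n (i : 'I_n) (x : cube n) : cube n :=
  [ffun j => if j == i then ~~ x j else x j].

Lemma flipE n (i j : 'I_n) (x : cube n) :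
  flip i x j = if j == i then ~~ x j else x j.
Proof. by rewrite ffunE. Qed.

Lemma flipK n (i : 'I_n) : involutive (flip i).
Proof. by move=> x; apply/ffunP => j; rewrite !ffunE; case: eqP => // _; rewrite negbK. Qed.

Lemma flip_inj n (i : 'I_n) : injective (flip i).
Proof. exact: inv_inj (@flipK n i). Qed.

Lemma card_cube n : #|{: cube n}| = (2 ^ n)%N.
Proof. by rewrite card_ffun card_bool card_ord. Qed.

Definition cons_cube n (b : bool) (x : cube n) : cube n.+1 :=
  [ffun i => if unlift ord0 i is Some j then x j else b].

Lemma cons_cube0 n b (x : cube n) : cons_cube b x ord0 = b.
Proof. by rewrite ffunE unlift_none. Qed.

Lemma cons_cubeS n b (x : cube n) j : cons_cube b x (lift ord0 j) = x j.
Proof. by rewrite ffunE liftK. Qed.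

Lemma flip_cons0 n b (x : cube n) : flip ord0 (cons_cube b x) = cons_cube (~~ b) x.
Proof.
apply/ffunP => i; rewrite flipE.
case: (unliftP ord0 i) => [j|] ->; first by rewrite !cons_cubeS.
by rewrite eqxx !cons_cube0.
Qed.

Lemma flip_consS n b (x : cube n) j :
  flip (lift ord0 j) (cons_cube b x) = cons_cube b (flip j x).
Proof.
apply/ffunP => i; rewrite flipE.
case: (unliftP ord0 i) => [k|] ->; last by rewrite !cons_cube0.
by rewrite !cons_cubeS (inj_eq (@lift_inj _ _)) flipE.
Qed.

Lemma sum_cubeS (R : nmodType) n (F : cube n.+1 -> R) :
  \sum_x F x = \sum_(x : cube n) F (cons_cube true x) + \sum_(x : cube n) F (cons_cube false x).
Proof.
pose h (p : bool * cube n) := cons_cube p.1 p.2.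
pose g (z : cube n.+1) : bool * cube n := (z ord0, [ffun j => z (lift ord0 j)]).
rewrite (reindex h) /=; last first.
  apply: onW_bij; exists g.
    by move=> [b x]; rewrite /g /h /= cons_cube0; congr pair; apply/ffunP => j; rewrite ffunE cons_cubeS.
  move=> z; apply/ffunP => i; rewrite /g /h /=.
  case: (unliftP ord0 i) => [j|] ->; first by rewrite cons_cubeS ffunE.
  by rewrite cons_cube0.
rewrite -(pair_bigA _ (fun b x => F (cons_cube b x))) /=.
by rewrite big_bool.
Qed.

(** * Vertex isoperimetry by a square-root functional *)

Section Isoperimetry.
Variable R : realType.
Implicit Types n : nat.

Definition exits n (A : pred (cube n)) (x : cube n) : nat :=
  \sum_(i < n) ~~ A (flip i x).

Lemma exits_cons n (A : pred (cube n.+1)) b (x : cube n) :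
  exits A (cons_cube b x) =
    (~~ A (cons_cube (~~ b) x) + exits (fun y => A (cons_cube b y)) x)%N.
Proof.
rewrite /exits big_ord_recl flip_cons0; congr addn.
by apply: eq_bigr => j _; rewrite flip_consS.
Qed.

(** The functional E sqrt(h_A) of Talagrand and Bobkov, unnormalised. It admits an induction on the
    dimension; [isoperimetry] then passes to the size of the boundary at the price of a factor sqrt
    n. *)
Definition exit_energy n (A : pred (cube n)) : R :=
  \sum_(x | A x) Num.sqrt (exits A x)%:R.

(** For [v] true this is Cauchy-Schwarz for (1 - D^2, D) and (sqrt h, 1), the first vector having
    squared length 1 - D^2 (1 - D^2). The two nonnegative terms in the proof are the Lagrange
    identity and this deficit. *)
Lemma sqrt_addb (D : R) (h : nat) (v : bool) : 0 <= D <= 1 ->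
  (1 - D ^+ 2) * Num.sqrt h%:R + D * v%:R <= Num.sqrt (v + h)%:R.
Proof.
move=> /andP[D0 D1].
have s0 : 0 <= (Num.sqrt h%:R : R) by exact: sqrtr_ge0.
have sE : (Num.sqrt h%:R : R) ^+ 2 = h%:R by rewrite sqr_sqrtr.
have D20 : 0 <= 1 - D ^+ 2 by rewrite subr_ge0 expr_le1.
rewrite -[leLHS]ger0_norm -?sqrtr_sqr; last first.
  by rewrite addr_ge0 // mulr_ge0 //; case: v.
rewrite ler_sqrt ?ler0n // natrD -[X in _ <= _ + X]sE.
have : 0 <= (Num.sqrt h%:R : R) by []; move: (Num.sqrt _ : R) => s {}s0 {sE}.
case: v => /=; rewrite ?mulr1n; last first.
  rewrite mulr0n mulr0 addr0 add0r exprMn ler_piMl ?sqr_ge0 // expr_le1 //; have := sqr_ge0 D; lra.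
have : 0 <= (s * D - (1 - D ^+ 2)) ^+ 2 by rewrite sqr_ge0.
have : 0 <= (D ^+ 2 * (1 - D ^+2)) * (1 + s ^+ 2) by rewrite mulr_ge0 ?addr_ge0 ?sqr_ge0 // mulr_ge0 ?sqr_ge0.
nra.
Qed.

Definition vol n (A : pred (cube n)) : R := \sum_x (A x)%:R.

Lemma exit_energy_sum n (A : pred (cube n)) :
  exit_energy A = \sum_x (A x)%:R * Num.sqrt (exits A x)%:R.
Proof.
by rewrite /exit_energy big_mkcond /=; apply: eq_bigr => x _; case: (A x); rewrite ?mul1r ?mul0r.
Qed.

Lemma vol_le n (A : pred (cube n)) : 0 <= vol A <= 2 ^+ n.
Proof.
rewrite sumr_ge0 //=; apply: le_trans (_ : \sum_(x : cube n) 1 <= _).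
  by apply: ler_sum => x _; case: (A x).
by rewrite sumr_const card_cube natrX.
Qed.

(** Here [b] and [c] are the volumes of the two halves of a cube. The left side exceeds 2 b (N - b)
    + 2 c (N - c) by (b - c)^2; the term D (b - c) supplies 2 (b - c)^2, of which the factor 1 - D^2
    loses at most half. *)
Lemma energy_arith (b c sb sc N X Y : R) :
  0 <= b -> b <= N -> 0 <= c -> c <= N -> c <= b ->
  b * (N - b) <= N * sb -> c * (N - c) <= N * sc ->
  (1 - ((b - c) / N) ^+ 2) * sb + (b - c) / N * (b - c) <= X -> sc <= Y ->
  0 < N -> (b + c) * (2 * N - (b + c)) <= 2 * N * (X + Y).
Proof.
move=> b0 bN c0 cN cb hb hc hX hY N0.
have hY' : N * sc <= N * Y by rewrite ler_pM2l.
set D := (b - c) / N in hX *.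
have DN : D * N = b - c by rewrite /D divfK // gt_eqF.
have D0 : 0 <= D by rewrite /D divr_ge0 ?subr_ge0 // ltW.
have D1 : 0 <= 1 - D ^+ 2.
  by rewrite subr_ge0 expr_le1 // /D ler_pdivrMr // mul1r; lra.
have hX' : N * ((1 - D ^+ 2) * sb + D * (b - c)) <= N * X by rewrite ler_pM2l.
have h1 : (1 - D ^+ 2) * (b * (N - b)) <= (1 - D ^+ 2) * (N * sb) by rewrite ler_wpM2l.
have h2 : D ^+ 2 * (b * (N - b)) <= D ^+ 2 * (N ^+ 2 / 2).
  apply: ler_wpM2l; first exact: sqr_ge0.
  have : 0 <= (2 * b - N) ^+ 2 by exact: sqr_ge0.
  have : 0 <= N ^+ 2 by exact: sqr_ge0.
  nra.
have h3 : D ^+ 2 * N ^+ 2 = (b - c) ^+ 2 by rewrite -exprMn DN.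
have h4 : N * (D * (b - c)) = (b - c) ^+ 2 by rewrite -DN; ring.
lra.
Qed.

Lemma isoperimetry_energy n (A : pred (cube n)) :
  vol A * (2 ^+ n - vol A) <= 2 ^+ n * exit_energy A.
Proof.
elim: n A => [|n IHn] A.
  rewrite expr0 mul1r; apply: le_trans (_ : 0 <= _); last first.
    by apply: sumr_ge0 => x _; exact: sqrtr_ge0.
  rewrite /vol (big_pred1 [ffun=> false]) /=; last first.
    by move=> x /=; apply/esym/eqP/ffunP; case.
  by case: (A _); rewrite ?subrr ?mulr0 ?mul0r.
pose A1 x := A (cons_cube true x); pose A0 x := A (cons_cube false x).
have vE : vol A = vol A1 + vol A0 by rewrite /vol sum_cubeS.
have eE : exit_energy A = \sum_x (A1 x)%:R * Num.sqrt (~~ A0 x + exits A1 x)%:R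
   + \sum_x (A0 x)%:R * Num.sqrt (~~ A1 x + exits A0 x)%:R.
  rewrite exit_energy_sum sum_cubeS; congr +%R; apply: eq_bigr => x _;
  by rewrite exits_cons.
(* At least vol B - vol C points of the larger half [B] face a point outside [C], and each gains an
   exit in the new direction. [D] is the difference of the densities. *)
have key (B C : pred (cube n)) D : vol C <= vol B ->
   D = (vol B - vol C) / 2 ^+ n ->
   (1 - D ^+ 2) * exit_energy B + D * (vol B - vol C) <=
   \sum_x (B x)%:R * Num.sqrt (~~ C x + exits B x)%:R.
  move=> CB DE.
  have N0 : 0 < 2 ^+ n :> R by rewrite exprn_gt0.
  have D01 : 0 <= D <= 1.
    rewrite DE divr_ge0 ?subr_ge0 ?exprn_ge0 //=.
    rewrite ler_pdivrMr // mul1r.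
    have := vol_le B; have := vol_le C; lra.
  have : vol B - vol C <= \sum_x (B x)%:R * (~~ C x)%:R.
    rewrite /vol -sumrB; apply: ler_sum => x _; case: (B x); case: (C x) => /=; lra.
  case/andP: (D01) => D0 _ /(ler_wpM2l D0) => le.
  apply: le_trans (lerD (lexx _) le) _.
  rewrite exit_energy_sum !mulr_sumr -big_split /=; apply: ler_sum => x _.
  have := sqrt_addb (exits B x) (~~ C x) D01.
  by case: (B x); rewrite ?mul1r ?mul0r ?mulr0 ?addr0.
have key0 (B C : pred (cube n)) : exit_energy B <=
   \sum_x (B x)%:R * Num.sqrt (~~ C x + exits B x)%:R.
  rewrite exit_energy_sum; apply: ler_sum => x _.
  by rewrite ler_wpM2l // ler_sqrt ?ler0n // ler_nat leq_addl.
have fin (B C : pred (cube n)) : vol C <= vol B ->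
   (vol B + vol C) * (2 ^+ n.+1 - (vol B + vol C)) <=
   2 ^+ n.+1 * (\sum_x (B x)%:R * Num.sqrt (~~ C x + exits B x)%:R
   + \sum_x (C x)%:R * Num.sqrt (~~ B x + exits C x)%:R).
  move=> CB; have := key B C _ CB erefl; have := key0 C B.
  move=> hY hX; rewrite exprS.
  have /andP[c0 cN] := vol_le C; have /andP[b0 bN] := vol_le B.
  by apply: (energy_arith b0 bN c0 cN CB (IHn B) (IHn C) hX hY); rewrite exprn_gt0.
rewrite vE eE; case: (leP (vol A0) (vol A1)) => h; first exact: fin.
by have := fin _ _ (ltW h); rewrite [vol A0 + _]addrC [X in _ <= _ * X]addrC.
Qed.

Definition inner_boundary n (A : {set cube n}) : {set cube n} :=
  [set x in A | [exists i, flip i x \notin A]].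

Lemma isoperimetry n (A : {set cube n}) :
  #|A|%:R * (2 ^+ n - #|A|%:R) <= 2 ^+ n * (Num.sqrt n%:R * #|inner_boundary A|%:R) :> R.
Proof.
have cE : #|A|%:R = vol (mem A) by rewrite /vol -natr_sum -sum1_card big_mkcond /=.
rewrite !cE; apply: (le_trans (isoperimetry_energy _)).
rewrite ler_wpM2l ?exprn_ge0 //.
rewrite -sum1_card natr_sum mulr_sumr /exit_energy.
rewrite [leRHS]big_mkcond [leLHS]big_mkcond /=; apply: ler_sum => x _.
rewrite !inE; case: (x \in A) => //=.
case: existsP => [_|nx].
  rewrite mulr1 ler_sqrt ?ler0n // ler_nat /exits -[leqRHS]card_ord -sum1_card.
  by apply: leq_sum => i _; exact: leq_b1.
suff -> : exits (mem A) x = 0%N by rewrite sqrtr0.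
apply: big1 => i _; apply/eqP; rewrite eqb0 negbK; apply/negPn/negP => h.
by apply: nx; exists i.
Qed.

End Isoperimetry.

(** * Containers for neighbourhoods in a regular graph *)

Section Neighbourhoods.
Variables (V : finType) (N : V -> {set V}) (D : nat).
Hypothesis Nsym : forall u v, (u \in N v) = (v \in N u).
Hypothesis Nreg : forall v, #|N v| = D.
Hypothesis Ncodeg : forall u v, u != v -> (#|N u :&: N v| <= 2)%N.
Hypothesis D_gt0 : (0 < D)%N.
Implicit Types (A B J P T : {set V}) (u v w : V).

Definition nbhs_of A : {set V} := \bigcup_(v in A) N v.

Lemma nbhs_ofP A u : reflect (exists2 v, v \in A & u \in N v) (u \in nbhs_of A).
Proof. exact: bigcupP. Qed.

Lemma nbhs_ofS A B : A \subset B -> nbhs_of A \subset nbhs_of B.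
Proof.
by move=> /subsetP AB; apply/subsetP => u /nbhs_ofP[v vA uv]; apply/nbhs_ofP; exists v; rewrite ?AB.
Qed.

Lemma sub_nbhs_of A v : v \in A -> N v \subset nbhs_of A.
Proof. by move=> vA; apply/subsetP => u uv; apply/nbhs_ofP; exists v. Qed.

Lemma edge_count_sym A B :
  (\sum_(u in A) #|N u :&: B| = \sum_(v in B) #|N v :&: A|)%N.
Proof.
have cE (u : V) (C : {set V}) : (#|N u :&: C| = \sum_(v in C) (v \in N u))%N.
  rewrite -sum1_card big_mkcond [RHS]big_mkcond; apply: eq_bigr => v _.
  by rewrite inE; case: (v \in N u); case: (v \in C).
under eq_bigr do rewrite cE.
rewrite exchange_big; apply: eq_bigr => v _; rewrite cE.
by apply: eq_bigr => u _; rewrite Nsym.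
Qed.

Lemma card_nbhsID v B : (#|N v :&: B| + #|N v :\: B| = D)%N.
Proof. by rewrite cardsID Nreg. Qed.

(** The largest set with the same neighbourhood as [A]; unlike [A], it can be recovered from that
    neighbourhood. *)
Definition hull A : {set V} := [set w | N w \subset nbhs_of A].

Lemma sub_hull J : J \subset hull J.
Proof. by apply/subsetP => v vJ; rewrite inE sub_nbhs_of. Qed.

Lemma nbhs_of_hull J : nbhs_of (hull J) = nbhs_of J.
Proof.
apply/eqP; rewrite eqEsubset [X in _ && X]nbhs_ofS ?sub_hull // andbT.
by apply/subsetP => u /nbhs_ofP[w]; rewrite inE => /subsetP; apply.
Qed.

(** All [D] edges at a vertex of the hull end in [nbhs_of J]; what remains of the edges at
    [nbhs_of J] leaves the hull. *)
Lemma hull_boundary J :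
  (\sum_(u in nbhs_of J) #|N u :\: hull J| = D * (#|nbhs_of J| - #|hull J|))%N.
Proof.
set Y := nbhs_of J; set X := hull J.
have h1 : (\sum_(u in Y) #|N u :&: X| = D * #|X|)%N.
  rewrite edge_count_sym (eq_bigr (fun=> D)) ?sum_nat_const 1?mulnC // => w.
  by rewrite inE => /setIidPl ->; rewrite Nreg.
have h2 : (\sum_(u in Y) (#|N u :&: X| + #|N u :\: X|) = D * #|Y|)%N.
  by rewrite (eq_bigr (fun=> D)) ?sum_nat_const 1?mulnC // => u _; rewrite card_nbhsID.
by move: h2; rewrite big_split /= h1 mulnBr => <-; rewrite addKn.
Qed.

Lemma card_hull J : (#|hull J| <= #|nbhs_of J|)%N.
Proof.
rewrite -(leq_pmul2l D_gt0).
have -> : (D * #|hull J| = \sum_(w in hull J) #|N w :&: nbhs_of J|)%N.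
  rewrite (eq_bigr (fun=> D)) ?sum_nat_const 1?mulnC // => w.
  by rewrite inE => /setIidPl ->; rewrite Nreg.
rewrite edge_count_sym mulnC -sum_nat_const; apply: leq_sum => u _.
by rewrite -(Nreg u) subset_leq_card // subsetIl.
Qed.

(** A vertex other than [u] has at most two neighbours in common with it, so the D - 1 remaining
    edges at each vertex of [B] meet every vertex of [nbhs_of B] at most twice. *)
Lemma card_nbhs_of_star u B : B \subset N u ->
  (#|B| * (D - 1) <= 2 * #|nbhs_of B|)%N.
Proof.
move=> /subsetP BN.
have : (\sum_(x in B) #|N x :&: (nbhs_of B :\ u)| <= 2 * #|nbhs_of B|)%N.
  rewrite edge_count_sym mulnC.
  apply: (@leq_trans (#|nbhs_of B :\ u| * 2)).
    rewrite -sum_nat_const; apply: leq_sum => v; rewrite !inE => /andP[vu _].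
    apply: leq_trans (Ncodeg vu); apply: subset_leq_card.
    by apply/subsetP => x; rewrite !inE => /andP[-> /BN].
  by rewrite leq_mul2r subset_leq_card ?orbT // subsetDl.
apply: leq_trans; rewrite -sum_nat_const; apply: leq_sum => x xB.
rewrite -(Nreg x) (cardsD1 u (N x)) Nsym BN // add1n subn1 /= subset_leq_card //.
apply/subsetP => v; rewrite !inE => /andP[-> vx]; rewrite vx /=.
by apply/nbhs_ofP; exists x.
Qed.

(** Maximising |N(P) cap G| - psi |P| replaces a greedy selection: comparison with the empty set
    gives the first bound, comparison with [w |: P] the second. The summand psi (|V| - |P|) in [f]
    avoids a truncated subtraction. *)
Lemma greedy_cover (C G : {set V}) (psi : nat) :
  exists P, [/\ P \subset C, (psi * #|P| <= #|nbhs_of P :&: G|)%N &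
    forall w, w \in C -> (#|(N w :&: G) :\: nbhs_of P| <= psi)%N].
Proof.
pose f P := (#|nbhs_of P :&: G| + psi * (#|V| - #|P|))%N.
have h0 : (set0 : {set V}) \subset C by rewrite sub0set.
case: (@arg_maxnP _ set0 (fun P => P \subset C) f h0) => P PC Pmax.
exists P; split => //.
  have := Pmax _ h0; rewrite /f cards0 subn0 => h.
  have hP : (#|P| <= #|V|)%N by exact: max_card.
  have : (psi * #|V| <= #|nbhs_of P :&: G| + psi * (#|V| - #|P|))%N.
    by apply: leq_trans h; rewrite leq_addl.
  by rewrite mulnBr => hV; have hp := leq_mul (leqnn psi) hP; lia.
move=> w wC; case: (boolP (w \in P)) => wP.
  rewrite (_ : _ :\: _ = set0) ?cards0 //; apply/setP => x; rewrite !inE.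
  by case: (boolP (x \in N w)) => [xw|_]; rewrite ?(subsetP (sub_nbhs_of wP) _ xw) ?andbF.
have /Pmax : w |: P \subset C by rewrite subUset sub1set wC.
rewrite /f cardsU1 wP.
have hP : (#|P| < #|V|)%N by rewrite -cardsT proper_card // properE subsetT /=; apply/subsetPn; exists w.
have -> : (#|nbhs_of (w |: P) :&: G| = #|nbhs_of P :&: G| + #|(N w :&: G) :\: nbhs_of P|)%N.
  rewrite -(cardsID (nbhs_of P) (nbhs_of (w |: P) :&: G)); congr addn; apply: eq_card.
    move=> x; rewrite /nbhs_of bigcup_setU big_set1 !inE.
    by case: (x \in \bigcup_(_ in _) _) => /=; rewrite ?orbT ?andbT ?andbF.
  move=> x; rewrite /nbhs_of bigcup_setU big_set1 !inE.
  by case: (x \in \bigcup_(_ in _) _) => /=; rewrite ?orbT ?orbF ?andbT ?andbF.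
have -> : (#|V| - #|P| = (#|V| - (1 + #|P|)).+1)%N by lia.
rewrite mulnS; lia.
Qed.

Section Container.
Variable psi : nat.

(** The data from which a container of [J] is rebuilt, in the manner of Sapozhenko: a sample of
    N(J), the neighbours of the sample outside the hull, the vertices well connected to the hull
    that the sample fails to reach, and two greedy corrections, from inside the hull and from
    outside N(J). *)
Record fingerprint := Fingerprint {
  fp_T : {set V}; fp_O : {set V}; fp_U : {set V}; fp_P1 : {set V}; fp_P2 : {set V} }.

Definition core (c : fingerprint) : {set V} :=
  nbhs_of (nbhs_of (fp_T c) :\: fp_O c) :|: fp_U c :|: nbhs_of (fp_P1 c).

Definition container (c : fingerprint) : {set V} :=
  [set w | (#|N w :\: core c| <= psi)%N] :\: nbhs_of (fp_P2 c).

Definition kernel (c : fingerprint) : {set V} :=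
  core c :|: [set u | (psi < #|N u :&: container c|)%N].

Definition missed J T : {set V} :=
  [set u in nbhs_of J | (D <= 2 * #|N u :&: hull J|)%N
     & u \notin nbhs_of (nbhs_of T :&: hull J)].

(** The kernel approximates N(J) from inside, the container approximates the hull from outside.
    Errors are charged to the D tau edges between N(J) and the complement of the hull: a wrong
    vertex is an end of at least D / 2 of them, so each error set has at most 2 tau vertices. *)
Lemma container_of_sample J T : (2 * psi <= D)%N -> T \subset nbhs_of J ->
  let tau := (#|nbhs_of J| - #|hull J|)%N in
  exists P1 P2, let c := Fingerprint T (nbhs_of T :\: hull J) (missed J T) P1 P2 in
  [/\ kernel c \subset nbhs_of J, hull J \subset container c,
      (D * #|container c| <= D * #|kernel c| + 4 * psi * tau)%N,
      (psi * #|P1| <= 2 * tau)%N & (psi * #|P2| <= 2 * tau)%N].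
Proof.
move=> psiD TY tau.
set Y := nbhs_of J in TY tau *; set X := hull J in tau *.
set U := missed J T.
have XY : nbhs_of X = Y by exact: nbhs_of_hull.
have TX : nbhs_of T :\: (nbhs_of T :\: X) = nbhs_of T :&: X by rewrite setDDr setDv set0U.
pose F1 := nbhs_of (nbhs_of T :&: X) :|: U.
have F1Y : F1 \subset Y.
  rewrite subUset -{1}XY nbhs_ofS ?subsetIr //=.
  by apply/subsetP => u; rewrite inE => /andP[].
have big_in u : u \in Y -> (D <= 2 * #|N u :&: X|)%N -> u \in F1.
  by move=> uY h; rewrite inE; case: (boolP (u \in nbhs_of _)) => //= nu; rewrite inE uY h.
have YF1 : (#|Y :\: F1| <= 2 * tau)%N.
  rewrite -(leq_pmul2l D_gt0) (_ : D * (2 * tau) = 2 * (D * tau))%N; last by lia.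
  rewrite -(hull_boundary J) -/Y -/X big_distrr /= mulnC -sum_nat_const.
  rewrite [leqRHS](bigID (mem F1)) /= -[leqLHS]add0n leq_add //.
  rewrite [leqRHS](eq_bigl (mem (Y :\: F1))); last by move=> u; rewrite !inE andbC.
  apply: leq_sum => u; rewrite inE => /andP[uF uY].
  have := card_nbhsID u X; case: (leqP D (2 * #|N u :&: X|)) => [/(big_in _ uY)|]; last by lia.
  by rewrite (negPf uF).
have [P1 [P1X P1c P1m]] := greedy_cover X (~: F1) psi.
pose F2 := F1 :|: nbhs_of P1.
have F2Y : F2 \subset Y by rewrite subUset F1Y -XY nbhs_ofS.
pose S2 := [set w | (#|N w :\: F2| <= psi)%N].
have XS2 : X \subset S2.
  apply/subsetP => w wX; rewrite inE; apply: leq_trans (P1m w wX).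
  by apply: subset_leq_card; apply/subsetP => x; rewrite !inE negb_or => /andP[/andP[-> ->] ->].
have XD : (\sum_(w in ~: X) #|N w :&: Y| = D * tau)%N.
  by rewrite -edge_count_sym -(hull_boundary J); apply: eq_bigr => u _; rewrite setDE.
have S2X : (#|S2 :\: X| <= 2 * tau)%N.
  rewrite -(leq_pmul2l D_gt0) (_ : D * (2 * tau) = 2 * (D * tau))%N; last by lia.
  rewrite -XD big_distrr /= mulnC -sum_nat_const.
  rewrite [leqRHS](bigID (mem S2)) /= -[leqLHS]addn0 leq_add //.
  rewrite [leqRHS](eq_bigl (mem (S2 :\: X))); last by move=> u; rewrite !inE.
  apply: leq_sum => w; rewrite !inE => /andP[_ h].
  have := card_nbhsID w Y.
  have : (#|N w :\: Y| <= #|N w :\: F2|)%N by rewrite subset_leq_card // setDS.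
  by lia.
(* [P2] lies outside N(J), so removing its neighbours spares the hull. Afterwards a vertex outside
   N(J) has at most [psi] neighbours in the container, which keeps the kernel inside N(J). *)
have [P2 [P2Y P2c P2m]] := greedy_cover (~: Y) S2 psi.
have P2X : nbhs_of P2 :&: X = set0.
  apply/setP => x; rewrite !inE; apply/negP => /andP[/nbhs_ofP[v vP2 xv] /subsetP xX].
  by have := subsetP P2Y _ vP2; rewrite inE -/Y xX // Nsym.
exists P1, P2 => c.
have coreE : core c = F2 by rewrite /core /= TX.
have contE : container c = S2 :\: nbhs_of P2 by rewrite /container coreE.
have XS : X \subset container c.
  rewrite contE; apply/subsetP => x xX; rewrite inE (subsetP XS2) // andbT.
  by apply/negP => xP; have /setP/(_ x) := P2X; rewrite !inE xP; move: xX; rewrite inE => ->.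
have outY u : u \notin Y -> (#|N u :&: container c| <= psi)%N.
  move=> uY; have := P2m u; rewrite inE uY => /(_ isT); rewrite contE.
  by apply: leq_trans; apply: subset_leq_card; rewrite setIDA.
have kerY : kernel c \subset Y.
  rewrite subUset coreE F2Y /=; apply/subsetP => u; rewrite inE; apply: contraTT => uY.
  by rewrite -leqNgt outY.
have SX : (#|container c :\: X| <= 2 * tau)%N.
  by apply: leq_trans S2X; apply: subset_leq_card; rewrite setSD // contE subsetDl.
split => //.
(* The edges at the container are sorted by their other end: in the kernel, in the rest of N(J), or
   outside N(J). The last two kinds number at most 2 tau psi each. *)
- have e1 : (D * #|container c| = \sum_(w in container c) (#|N w :&: Y| + #|N w :\: Y|))%N.
    by rewrite mulnC -sum_nat_const; apply: eq_bigr => w _; rewrite card_nbhsID.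
  rewrite e1 big_split /= edge_count_sym (bigID (mem (kernel c))) /= -addnA leq_add //.
    rewrite (eq_bigl (mem (kernel c))); last first.
      by move=> u /=; case: (boolP (u \in kernel c)) => uk; rewrite ?andbF // (subsetP kerY).
    rewrite mulnC -sum_nat_const; apply: leq_sum => u _.
    by rewrite -(Nreg u) subset_leq_card // subsetIl.
  have -> : (4 * psi * tau = (2 * tau) * psi + (2 * tau) * psi)%N by lia.
  apply: leq_add.
    apply: (@leq_trans (#|Y :\: kernel c| * psi)); last first.
      rewrite leq_mul2r; apply/orP; right; apply: leq_trans YF1.
      rewrite subset_leq_card // setDS //; apply: subset_trans (subsetUl _ _).
      by rewrite coreE subsetUl.
    rewrite -sum_nat_const [leqRHS](eq_bigl (fun u => (u \in Y) && (u \notin kernel c))); last first.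
      by move=> u; rewrite in_setD andbC.
    apply: leq_sum => u /andP[_]; rewrite /kernel in_setU negb_or => /andP[_].
    by rewrite inE -leqNgt.
  apply: (@leq_trans (#|container c :\: X| * psi)); last by rewrite leq_mul2r SX orbT.
  rewrite -sum_nat_const (bigID (mem X)) /= big1 ?add0n; last first.
    by move=> w /andP[_]; rewrite inE -setD_eq0 => /eqP ->; rewrite cards0.
  rewrite [leqRHS](eq_bigl (fun w => (w \in container c) && (w \notin X))); last first.
    by move=> w; rewrite in_setD andbC.
  apply: leq_sum => w; rewrite contE => /andP[]; rewrite in_setD inE => /andP[_ h] _.
  by apply: leq_trans h; rewrite subset_leq_card // setDS.
- apply: leq_trans P1c _; apply: leq_trans YF1; apply: subset_leq_card.
  by rewrite -setDE setSD // -XY nbhs_ofS.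
- apply: leq_trans P2c _; apply: leq_trans S2X; apply: subset_leq_card.
  apply/subsetP => x; rewrite !inE => /andP[xP ->]; rewrite andbT.
  by apply/negP => xX; have /setP/(_ x) := P2X; rewrite !inE xP /= xX.
Qed.

End Container.
End Neighbourhoods.

(** * Random subsets and the container sum *)

Lemma card_bigcup_le (I V : finType) (P : pred I) (F : I -> {set V}) :
  (#|\bigcup_(i | P i) F i| <= \sum_(i | P i) #|F i|)%N.
Proof.
elim/big_rec2: _ => [|i n B _ h]; first by rewrite cards0.
by apply: leq_trans (leq_card_setU _ _) _; rewrite leq_add2l.
Qed.

Section SubsetSums.
Variables (R : realType) (V : finType).
Implicit Types (A B T : {set V}) (x p : R).

Lemma sum_set_prod (f g : V -> R) :
  \sum_(A : {set V}) \prod_v (if v \in A then f v else g v) = \prod_v (f v + g v).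
Proof. by rewrite bigA_distr. Qed.

Lemma prod_sub_set (A B : {set V}) x :
  \prod_v (if v \in A then (v \in B)%:R * x else 1) = (A \subset B)%:R * x ^+ #|A|.
Proof.
rewrite -big_mkcond /= big_split /= prodr_const; congr (_ * _).
case: (boolP (A \subset B)) => [/subsetP AB|/subsetPn[v vA vB]].
  by rewrite big1 // => v /AB ->.
by rewrite (bigD1 v) //= (negPf vB) mul0r.
Qed.

Lemma sum_sub_expn B x : \sum_(A : {set V} | A \subset B) x ^+ #|A| = (1 + x) ^+ #|B|.
Proof.
rewrite big_mkcond /= -prodr_const [RHS]big_mkcond /=.
transitivity (\prod_v ((v \in B)%:R * x + 1)).
  rewrite -sum_set_prod; apply: eq_bigr => A _; rewrite prod_sub_set.
  by case: ifP; rewrite ?mul1r ?mul0r.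
by apply: eq_bigr => v _; case: (v \in B); rewrite ?mul1r ?mul0r ?add0r // addrC.
Qed.

Lemma sum_set_expn x : \sum_(A : {set V}) x ^+ #|A| = (1 + x) ^+ #|V|.
Proof.
rewrite -cardsT -sum_sub_expn; apply: eq_bigl => A.
by rewrite subsetT.
Qed.

Definition bernoulli_weight p T : R := \prod_v (if v \in T then p else 1 - p).

Lemma bernoulli_weight_ge0 p T : 0 <= p <= 1 -> 0 <= bernoulli_weight p T.
Proof.
by move=> /andP[p0 p1]; apply: prodr_ge0 => v _; case: ifP => // _; rewrite subr_ge0.
Qed.

Lemma sum_bernoulli p : \sum_T bernoulli_weight p T = 1.
Proof. by rewrite sum_set_prod big1 // => v _; rewrite addrC subrK. Qed.

Lemma bernoulli_avoid p B :
  \sum_(T : {set V} | [disjoint T & B]) bernoulli_weight p T = (1 - p) ^+ #|B|.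
Proof.
transitivity (\prod_v ((v \notin B)%:R * p + (1 - p))).
  rewrite -sum_set_prod big_mkcond /=; apply: eq_bigr => T _.
  case: ifPn => [dTB|/pred0Pn[v /= /andP[vT vB]]].
    apply: eq_bigr => v _; case: ifP => // vT.
    by rewrite (disjointFr dTB vT) mul1r.
  by rewrite (bigD1 v) //= vT vB mul0r mul0r.
rewrite -prodr_const [RHS]big_mkcond /=; apply: eq_bigr => v _.
by case: (v \in B); rewrite /= ?mul0r ?add0r // mul1r addrC subrK.
Qed.

Lemma bernoulli_mem p v : \sum_(T : {set V} | v \in T) bernoulli_weight p T = p.
Proof.
have h1 : \sum_(T : {set V} | v \notin T) bernoulli_weight p T = 1 - p.
  rewrite -[in RHS](expr1 (1 - p)) -(cards1 v) -bernoulli_avoid.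
  by apply: eq_bigl => T; rewrite disjoint_sym disjoints1.
have := sum_bernoulli p; rewrite (bigID (fun T : {set V} => v \in T)) /= h1 => h.
by apply: (addIr (1 - p)); rewrite h addrC subrK.
Qed.

Lemma bernoulli_average p (c : {set V} -> R) : 0 <= p <= 1 ->
  exists T, c T <= \sum_S bernoulli_weight p S * c S.
Proof.
move=> p01; apply: contrapT => h.
set a := \sum_S _ in h.
have hc T : a < c T by rewrite ltNge; apply/negP => hT; apply: h; exists T.
have : a < a; last by rewrite ltxx.
rewrite -[ltLHS]mul1r -(sum_bernoulli p) mulr_suml.
have [T T0] : exists T, 0 < bernoulli_weight p T.
  apply: contrapT => n; have := sum_bernoulli p; rewrite big1.
    by move/eqP; rewrite eq_sym oner_eq0.
  move=> T _; apply/eqP; rewrite eq_le bernoulli_weight_ge0 // andbT leNgt.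
  by apply/negP => hT; apply: n; exists T.
rewrite (bigD1 T) //= [ltRHS](bigD1 T) //=; apply: ltr_leD.
  by rewrite ltr_pM2l.
by apply: ler_sum => S _; rewrite ler_wpM2l ?bernoulli_weight_ge0 // ltW.
Qed.

End SubsetSums.

Section ContainerSum.
Variables (R : realType) (V : finType) (N : V -> {set V}) (D : nat).
Hypothesis Nsym : forall u v, (u \in N v) = (v \in N u).
Hypothesis Nreg : forall v, #|N v| = D.
Hypothesis Ncodeg : forall u v, u != v -> (#|N u :&: N v| <= 2)%N.
Hypothesis D_gt0 : (0 < D)%N.
Implicit Types (J T : {set V}).

Local Notation nb := (nbhs_of N).
Local Notation hull := (hull N).

Definition excess J : nat := #|nb J| - #|hull J|.

(** First moment over a Bernoulli set intersected with N(J). A vertex with half of its edges in the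
    hull is missed only if the set avoids all second neighbours through the hull, at least D (D - 1)
    / 4 in number by [card_nbhs_of_star]. *)
Lemma sample_exists (p : R) J : 0 <= p <= 1 ->
  exists2 T : {set V}, T \subset nb J &
    (#|T| + #|nb T :\: hull J| + #|missed N D J T|)%:R <=
    p * #|nb J|%:R + p * (D * excess J)%:R
      + #|nb J|%:R * expR (- (p * (D * (D - 1))%:R / 4)).
Proof.
move=> p01; have /andP[p0 p1] := p01.
pose c T : R := (#|T :&: nb J| + #|nb (T :&: nb J) :\: hull J| + #|missed N D J (T :&: nb J)|)%:R.
have [T hT] := bernoulli_average c p01.
exists (T :&: nb J); first exact: subsetIr.
apply: le_trans hT _.
pose W (S : {set V}) : R := bernoulli_weight p S.
have W0 S : 0 <= W S by exact: bernoulli_weight_ge0.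
have cardE (B S : {set V}) : (#|S :&: B|%:R : R) = \sum_(v in B) (v \in S)%:R.
  rewrite -natr_sum -sum1_card big_mkcond [in RHS]big_mkcond /=; congr (_%:R).
  by apply: eq_bigr => v _; rewrite inE; case: (v \in S); case: (v \in B).
have sumW (a : V -> R) (B : {set V}) :
    \sum_(S : {set V}) W S * (\sum_(v in B) (v \in S)%:R * a v) = p * \sum_(v in B) a v.
  under eq_bigr do rewrite mulr_sumr.
  rewrite exchange_big /= mulr_sumr; apply: eq_bigr => v _.
  rewrite -[p in RHS](bernoulli_mem p v) mulr_suml [RHS]big_mkcond /=.
  by apply: eq_bigr => S _; case: (v \in S); rewrite ?mul1r // mul0r mulr0.
rewrite /c; under eq_bigr do rewrite !natrD !mulrDr.
rewrite !big_split /=; apply: lerD; first apply: lerD.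
- under eq_bigr do rewrite cardE.
  have := sumW (fun=> 1) (nb J); rewrite sumr_const => <-.
  by apply: ler_sum => S _; under [X in _ <= _ * X]eq_bigr do rewrite mulr1.
- rewrite -hull_boundary // natr_sum -sumW; apply: ler_sum => S _; rewrite ler_wpM2l //.
  under eq_bigr do rewrite -natrM.
  rewrite -natr_sum ler_nat.
  have -> : nb (S :&: nb J) :\: hull J = \bigcup_(v in S :&: nb J) (N v :\: hull J).
    apply/setP => x; rewrite inE; apply/andP/bigcupP => [[xh /nbhs_ofP[v vS xv]]|[v vS]].
      by exists v => //; rewrite inE xh.
    by rewrite inE => /andP[-> xv]; split => //; apply/nbhs_ofP; exists v.
  apply: leq_trans (card_bigcup_le _ _) _.
  rewrite [leqRHS]big_mkcond [leqLHS]big_mkcond /=; apply: leq_sum => v _.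
  by rewrite inE; case: (v \in S); case: (v \in nb J); rewrite ?mul1n.
set q := expR _.
have missE S : (#|missed N D J (S :&: nb J)|%:R : R) <=
    \sum_(u in nb J | (D <= 2 * #|N u :&: hull J|)%N) [disjoint S & nb (N u :&: hull J)]%:R.
  rewrite -sum1_card natr_sum [leLHS]big_mkcond [leRHS]big_mkcond /=; apply: ler_sum => u _.
  rewrite inE; case: (u \in nb J) => //=; case: leqP => //= _.
  case: (boolP (u \in _)) => //= nu; rewrite (_ : [disjoint _ & _]) //.
  apply/pred0P => v /=; apply/negP => /andP[vS /nbhs_ofP[x]]; rewrite inE => /andP[xu xh] vx.
  move/negP: nu; apply; apply/nbhs_ofP; exists x; last by rewrite Nsym.
  rewrite inE xh andbT; apply/nbhs_ofP; exists v; last by rewrite Nsym.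
  by rewrite inE vS; move: xh; rewrite inE => /subsetP; apply.
apply: le_trans (_ : \sum_(S : {set V}) W S * \sum_(u in nb J | (D <= 2 * #|N u :&: hull J|)%N) [disjoint S & nb (N u :&: hull J)]%:R <= _).
  by apply: ler_sum => S _; rewrite ler_wpM2l.
under eq_bigr do rewrite mulr_sumr.
rewrite exchange_big /= -sum1_card natr_sum mulr_suml big_mkcondr /=.
apply: ler_sum => u uY; case: ifP => hu; last by rewrite mul1r expR_ge0.
rewrite mul1r.
set B := nb (N u :&: hull J).
have -> : \sum_(S : {set V}) W S * [disjoint S & B]%:R = (1 - p) ^+ #|B|.
  rewrite -bernoulli_avoid [RHS]big_mkcond /=; apply: eq_bigr => S _.
  by case: ifP => _; rewrite ?mulr1 ?mulr0.
have Bcard : (D * (D - 1) <= 4 * #|B|)%N.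
  have := card_nbhs_of_star Nsym Nreg Ncodeg (subsetIl (N u) (hull J)); rewrite -/B => hB.
  have := leq_mul hu (leqnn (D - 1)); lia.
apply: le_trans (_ : expR (- p) ^+ #|B| <= _).
  by rewrite lerXn2r ?nnegrE ?expR_ge0 ?subr_ge0 // -[1 - p]/(1 + - p) expR_ge1Dx.
rewrite -expRM_natl ler_expR mulrN lerN2 -mulrA [leRHS]mulrC ler_wpM2l // ler_pdivrMr //.
by rewrite -natrM ler_nat [leqRHS]mulnC.
Qed.

Section Slices.
Variables (I : finType).

Definition slice (Q : {set V * I}) i : {set V} := [set v | (v, i) \in Q].

Definition stack (A : I -> {set V}) : {set V * I} := [set q | q.1 \in A q.2].

Lemma slice_stack A i : slice (stack A) i = A i.
Proof. by apply/setP => v; rewrite !inE. Qed.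

Lemma card_stack A : #|stack A| = (\sum_i #|A i|)%N.
Proof.
transitivity (\sum_(q : V * I) (q.1 \in A q.2))%N.
  by rewrite -sum1_card big_mkcond /=; apply: eq_bigr => q _; rewrite inE.
rewrite -(pair_bigA _ (fun v i => (v \in A i) : nat)) /= exchange_big /=.
by apply: eq_bigr => i _; rewrite -sum1_card [RHS]big_mkcond.
Qed.

End Slices.

(** Fingerprints are encoded as subsets [Q] of six copies of [V], at the price expR ell per element,
    so that all choices together cost (1 + expR (- ell))^(6 |V|). Each [Q] carries two probability
    laws on sets [J], whence the factor 2. The price is paid by the powers of 1 + lam gained when
    |N(J)| exceeds the size of the set on which the law lives. *)
Theorem container_sum (lam ell p g kappa : R) (psi : nat) :
  0 < lam -> 0 <= ell -> 0 <= p <= 1 -> 0 <= g -> (0 < psi)%N -> (2 * psi <= D)%N ->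
  (4 * psi)%:R <= g * D%:R ->
  let A := p * #|V|%:R + #|V|%:R * expR (- (p * (D * (D - 1))%:R / 4)) in
  let B := p * D%:R + 4 / psi%:R in
  ell * B + kappa <= g * ln (1 + lam) ->
  ell * (B + 2 * g) + kappa <= ln (1 + lam) ->
  \sum_(J : {set V}) lam ^+ #|J| * (1 + lam) ^- #|nb J| * expR (kappa * (excess J)%:R)
   <= 2 * expR (ell * A) * expR (6 * #|V|%:R * expR (- ell)).
Proof.
move=> lam0 ell0 p01 g0 psi0 psiD psig A B hi1 hi2.
have /andP[p0 p1] := p01.
have lam1 : 0 < 1 + lam by lra.
pose fp (Q : {set V * 'I_6}) := Fingerprint (slice Q (inord 0)) (slice Q (inord 1))
   (slice Q (inord 2)) (slice Q (inord 3)) (slice Q (inord 4)).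
pose SQ Q := container N psi (fp Q).
pose XQ Q := [set w | N w \subset kernel N psi (fp Q) :|: slice Q (inord 5)].
(* The law of a random subset of [S] whose points are kept independently with odds [lam]. *)
pose h (S J : {set V}) : R := (J \subset S)%:R * lam ^+ #|J| * (1 + lam) ^- #|S|.
have h_ge0 S J : 0 <= h S J.
  by rewrite /h !mulr_ge0 // ?exprn_ge0 ?invr_ge0 ?exprn_ge0 // ltW.
have sumh S : \sum_(J : {set V}) h S J = 1.
  rewrite /h -mulr_suml.
  rewrite (_ : \sum_(J : {set V}) _ = (1 + lam) ^+ #|S|) ?divff ?expf_neq0 ?gt_eqF //.
  rewrite -sum_sub_expn [RHS]big_mkcond /=; apply: eq_bigr => J _.
  by case: ifP; rewrite ?mul1r ?mul0r.
have main J : lam ^+ #|J| * (1 + lam) ^- #|nb J| * expR (kappa * (excess J)%:R) <=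
    expR (ell * A) * \sum_(Q : {set V * 'I_6}) expR (- ell) ^+ #|Q| * (h (SQ Q) J + h (XQ Q) J).
  have [T TY Tc] := sample_exists J p01.
  have /= [P1 [P2 [kY XS SK P1c P2c]]] := container_of_sample Nsym Nreg D_gt0 psiD TY.
  set c := Fingerprint _ _ _ _ _ in kY XS SK.
  set t := excess J in Tc *; rewrite -/t in SK P1c P2c.
  have tE : (#|nb J| = #|hull J| + t)%N by rewrite /t /excess subnKC // (card_hull Nsym Nreg D_gt0).
  have P1r : #|P1|%:R <= 2 / psi%:R * t%:R :> R.
    by rewrite mulrAC ler_pdivlMr ?ltr0n // -!natrM ler_nat mulnC.
  have P2r : #|P2|%:R <= 2 / psi%:R * t%:R :> R.
    by rewrite mulrAC ler_pdivlMr ?ltr0n // -!natrM ler_nat mulnC.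
  have SKr : #|container N psi c|%:R <= #|kernel N psi c|%:R + g * t%:R.
    have D0 : 0 < D%:R :> R by rewrite ltr0n.
    rewrite -(ler_pM2l D0) mulrDr.
    have : (D * #|container N psi c|)%:R <= (D * #|kernel N psi c| + 4 * psi * t)%:R :> R by rewrite ler_nat.
    rewrite natrD !natrM => /le_trans; apply; rewrite lerD2l mulrA [D%:R * g]mulrC.
    by rewrite -natrM ler_wpM2r // ler0n.
  have TB : (#|T| + #|nb T :\: hull J| + #|missed N D J T| + #|P1| + #|P2|)%:R <= A + B * t%:R.
    rewrite 2!natrD; apply: (le_trans (lerD (lerD Tc P1r) P2r)).
    have nY : #|nb J|%:R <= #|V|%:R :> R by rewrite ler_nat max_card.
    have e0 := expR_ge0 (- (p * (D * (D - 1))%:R / 4)).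
    have := ler_wpM2l p0 nY; have := ler_wpM2r e0 nY.
    rewrite /A /B natrM; set X := _ * expR _; set Y := _ * expR _ => a1 a2.
    have -> : (p * D%:R + 4 / psi%:R) * t%:R = p * (D%:R * t%:R) + 2 / psi%:R * t%:R + 2 / psi%:R * t%:R.
      by field; rewrite pnatr_eq0 -lt0n.
    lra.
  pose P6 (E : {set V}) (i : 'I_6) := nth set0 [:: T; nb T :\: hull J; missed N D J T; P1; P2; E] i.
  have fpE E : fp (stack (P6 E)) = c by rewrite /fp !slice_stack /P6 !inordK.
  have cE E : #|stack (P6 E)| = (#|T| + #|nb T :\: hull J| + #|missed N D J T| + #|P1| + #|P2| + #|E|)%N.
    by rewrite card_stack !big_ord_recr big_ord0 /= add0n.
  have pick Q (x : R) : 0 <= x -> x <= h (SQ Q) J + h (XQ Q) J ->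
      expR (- ell) ^+ #|Q| * x <= \sum_(Q' : {set V * 'I_6}) expR (- ell) ^+ #|Q'| * (h (SQ Q') J + h (XQ Q') J).
    move=> x0 xh; rewrite (bigD1 Q) //= -[leLHS]addr0 lerD //.
      by rewrite ler_wpM2l // exprn_ge0 // expR_ge0.
    by apply: sumr_ge0 => Q' _; rewrite mulr_ge0 ?exprn_ge0 ?expR_ge0 // addr_ge0.
  have lamE k : (1 + lam) ^+ k = expR (k%:R * ln (1 + lam)) by rewrite expRM_natl lnK.
  have fin (S : {set V}) (Q : {set V * 'I_6}) (b : R) : J \subset S -> h S J <= h (SQ Q) J + h (XQ Q) J ->
      #|Q|%:R <= A + b * t%:R ->
      (ell * b + kappa) * t%:R <= (#|nb J|%:R - #|S|%:R) * ln (1 + lam) ->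
      lam ^+ #|J| * (1 + lam) ^- #|nb J| * expR (kappa * t%:R) <=
      expR (ell * A) * \sum_(Q : {set V * 'I_6}) expR (- ell) ^+ #|Q| * (h (SQ Q) J + h (XQ Q) J).
    move=> JS hS Qb ht.
    apply: le_trans (_ : expR (ell * A) * (expR (- ell) ^+ #|Q| * h S J) <= _); last first.
      by rewrite ler_wpM2l ?expR_ge0 // pick.
    rewrite /h JS mul1r [expR (- ell) ^+ _ * _]mulrCA [leRHS]mulrCA -mulrA.
    rewrite ler_wpM2l ?exprn_ge0 ?(ltW lam0) //.
    rewrite -expRM_natl !lamE -!expRN -!expRD ler_expR.
    by have := ler_wpM2l ell0 Qb; lra.
  (* If the container is smaller than N(J) by at least g t, the gain (1 + lam)^(g t) pays for the
     fingerprint. *)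
  case: (leP (g * t%:R) (#|nb J|%:R - #|container N psi c|%:R)) => [h1|h1].
    apply: (fin (container N psi c) (stack (P6 set0)) B).
    - exact: subset_trans (sub_hull N J) XS.
    - by rewrite /SQ fpE lerDl.
    - by rewrite cE cards0 addn0.
    - have l0 : 0 <= ln (1 + lam) by rewrite ln_ge0 //; lra.
      have := ler_wpM2r l0 h1; have := ler_wpM2r (ler0n R t) hi1; lra.
  (* Otherwise the kernel misses fewer than 2 g t vertices of N(J). Recording them as a sixth
     component determines N(J), hence the hull, which is smaller by exactly t. *)
  set E := nb J :\: kernel N psi c.
  have EE : #|E|%:R = #|nb J|%:R - #|kernel N psi c|%:R :> R.
    by rewrite /E cardsD (setIidPr kY) natrB // subset_leq_card.
  apply: (fin (hull J) (stack (P6 E)) (B + 2 * g)).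
  - exact: sub_hull.
  - rewrite (_ : XQ _ = hull J) ?lerDr //; apply/setP => w.
    have kE : kernel N psi c :|: E = nb J by rewrite /E -{1}(setIidPr kY) setID.
    by rewrite !inE fpE slice_stack /P6 inordK //= kE.
  - by rewrite cE natrD EE; lra.
  - by rewrite tE natrD; have := ler_wpM2r (ler0n R t) hi2; lra.
apply: le_trans (ler_sum _ (fun J _ => main J)) _.
rewrite -mulr_sumr [2 * _]mulrC -[leRHS]mulrA. apply: ler_wpM2l; first exact: expR_ge0.
rewrite exchange_big /=.
under eq_bigr do rewrite -mulr_sumr big_split /= !sumh.
rewrite -mulr_suml sum_set_expn mulrC ler_wpM2l //.
rewrite card_prod card_ord.
apply: le_trans (_ : expR (expR (- ell)) ^+ (#|V| * 6) <= _).
  by rewrite lerXn2r ?nnegrE ?addr_ge0 ?expR_ge0 // expR_ge1Dx.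
by rewrite -expRM_natl ler_expR natrM [_ * 6]mulrC.
Qed.

End ContainerSum.

(** * Generalized Hoelder inequality *)

Section SplitSums.
Variables (R : nmodType) (V : finType).

Lemma sum_sub_setU (A B : {set V}) (f : {set V} -> R) : [disjoint A & B] ->
  \sum_(s : {set V} | s \subset A :|: B) f s =
  \sum_(s : {set V} | s \subset A) \sum_(t : {set V} | t \subset B) f (s :|: t).
Proof.
move=> dAB; have AB0 : A :&: B = set0 by exact/disjoint_setI0.
rewrite pair_big_dep /=.
rewrite (reindex_onto (fun s : {set V} => (s :&: A, s :&: B)) (fun p => p.1 :|: p.2)) /=.
  apply: eq_big => s; last by move=> sAB; rewrite -setIUr (setIidPl sAB).
  rewrite !subsetIr /=; apply/idP/eqP => [sAB|<-]; first by rewrite -setIUr; exact/setIidPl.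
  by rewrite setUSS ?subsetIr.
move=> [s t] /= /andP[sA tB]; congr pair; rewrite setIUl.
  rewrite (setIidPl sA); apply/setUidPl; rewrite -setI_eq0 in dAB.
  apply/subsetP => x; rewrite inE => /andP[/(subsetP tB) xB xA].
  by have /setP/(_ x) := AB0; rewrite !inE xA xB.
rewrite (setIidPl tB); apply/setUidPr.
apply/subsetP => x; rewrite inE => /andP[/(subsetP sA) xA xB].
by have /setP/(_ x) := AB0; rewrite !inE xA xB.
Qed.

Lemma sum_sub_setU1 v (A : {set V}) (f : {set V} -> R) : v \notin A ->
  \sum_(s : {set V} | s \subset v |: A) f s =
  \sum_(s : {set V} | s \subset A) (f s + f (v |: s)).
Proof.
move=> vA; rewrite setUC sum_sub_setU; last by rewrite disjoint_sym disjoints1.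
apply: eq_bigr => s sA; rewrite (bigD1 set0) ?sub0set //= setU0; congr +%R.
rewrite (big_pred1 [set v]) 1?setUC // => t; rewrite /= subset1.
case: (eqVneq t set0) => [->|]; last by rewrite orbF andbT.
by rewrite andbF; apply/esym/negbTE; rewrite eq_sym; apply/set0Pn; exists v; rewrite inE.
Qed.

End SplitSums.

Section Hoelder.
Variable R : realType.

Definition root (m : nat) (a : R) : R := a `^ m%:R^-1.

Lemma root_ge0 m a : 0 <= root m a.
Proof. exact: powR_ge0. Qed.

Lemma rootK m a : (0 < m)%N -> 0 <= a -> root m a ^+ m = a.
Proof.
move=> m0 a0; rewrite -powR_mulrn ?root_ge0 // /root -powRrM mulVf ?powRr1 //.
by rewrite pnatr_eq0 -lt0n.
Qed.

Lemma le_AGM_powers (X : finType) (P : {pred X}) (m : nat) (x : X -> R) :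
  (0 < m)%N -> #|P| = m -> (forall i, 0 <= x i) ->
  \prod_(i in P) x i <= (\sum_(i in P) x i ^+ m) / m%:R.
Proof.
move=> m0 Pm x0.
have mR : 0 < m%:R :> R by rewrite ltr0n.
rewrite -(ler_pXn2r m0) ?nnegrE ?prodr_ge0 ?divr_ge0 ?sumr_ge0 ?ler0n //; last first.
  by move=> i _; rewrite exprn_ge0.
have := @leif_AGM R X P (fun i => x i ^+ m).
by rewrite Pm prodrXl => -[] // i _; rewrite exprn_ge0.
Qed.

(** Division by [c i] normalises each pair to (a_i / c_i)^m + (b_i / c_i)^m = 1, and AM-GM bounds
    both products. If some [c i] vanishes, so does everything. *)
Lemma hoelder2 (X : finType) (P : {pred X}) (m : nat) (a b : X -> R) :
  (0 < m)%N -> #|P| = m -> (forall i, 0 <= a i) -> (forall i, 0 <= b i) ->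
  \prod_(i in P) a i + \prod_(i in P) b i <= \prod_(i in P) root m (a i ^+ m + b i ^+ m).
Proof.
move=> m0 Pm a0 b0; set c := fun i => root m (a i ^+ m + b i ^+ m).
have s0 i : 0 <= a i ^+ m + b i ^+ m by rewrite addr_ge0 ?exprn_ge0.
have cm i : c i ^+ m = a i ^+ m + b i ^+ m by rewrite rootK.
have mR : 0 < m%:R :> R by rewrite ltr0n.
have [/existsP[i /andP[iP /eqP ci]]|/existsPn cn] := boolP [exists i, (i \in P) && (c i == 0)].
  have : a i ^+ m + b i ^+ m == 0 by rewrite -cm ci expr0n -leqn0 leqNgt m0.
  rewrite paddr_eq0 ?exprn_ge0 // !expf_eq0 m0 /= => /andP[/eqP ai /eqP bi].
  have z (f : X -> R) : f i = 0 -> \prod_(j in P) f j = 0.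
    by move=> fi; rewrite (bigD1 i iP) /= fi mul0r.
  by rewrite (z a ai) (z b bi) (z c ci) addr0.
have c0 i : i \in P -> 0 < c i.
  by move=> iP; rewrite lt_neqAle root_ge0 andbT eq_sym; have := cn i; rewrite iP.
have pc : 0 < \prod_(i in P) c i by exact: prodr_gt0.
rewrite -(ler_pM2r (_ : 0 < (\prod_(i in P) c i)^-1)) ?invr_gt0 // divff ?gt_eqF // mulrDl.
rewrite -!prodfV -!big_split /=.
have ag (x : X -> R) : (forall i, 0 <= x i) -> \prod_(i in P) (x i / c i) <= (\sum_(i in P) (x i / c i) ^+ m) / m%:R.
  by move=> x0; apply: le_AGM_powers => // i; rewrite divr_ge0 // root_ge0.
apply: le_trans (lerD (ag a a0) (ag b b0)) _.
rewrite -mulrDl -big_split /= (eq_bigr (fun=> 1)); last first.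
  move=> i iP; rewrite !expr_div_n -mulrDl cm divff // -cm expf_neq0 // gt_eqF // c0 //.
by rewrite sumr_const Pm divff // gt_eqF.
Qed.

(* Each vertex lies in exactly [m] of the sets [B x], whence the exponent [1/m]. *)
Lemma generalized_hoelder (X V : finType) (B : X -> {set V}) (m : nat) (W : {set V})
    (G : X -> {set V} -> R) :
  (0 < m)%N -> (forall v, v \in W -> #|[pred x | v \in B x]| = m) ->
  (forall x s, 0 <= G x s) ->
  (forall x v s, v \notin B x -> G x (v |: s) = G x s) ->
  \sum_(s : {set V} | s \subset W) \prod_x G x s <=
  \prod_x root m (\sum_(s : {set V} | s \subset W :&: B x) G x s ^+ m).
Proof.
move=> m0; have [k] := ubnP #|W|; elim: k W G => // k IH W G Wk Wm G0 Gloc.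
have [->|[v vW]] := set_0Vmem W.
  have e (f : {set V} -> R) : \sum_(s : {set V} | s \subset set0) f s = f set0.
    by rewrite (big_pred1 set0) // => s; rewrite subset0.
  rewrite e; apply: ler_prod => x _; rewrite G0 /= set0I e.
  by rewrite -(ler_pXn2r m0) ?nnegrE ?root_ge0 // rootK // exprn_ge0.
pose W' := W :\ v; have WE : W = v |: W' by rewrite setD1K.
have vW' : v \notin W' by rewrite !inE eqxx.
(* By [hoelder2] the sum over the two states of [v] is absorbed by the [m] factors that see [v]; the
   others do not change. *)
pose G' x s := if v \in B x then root m (G x s ^+ m + G x (v |: s) ^+ m) else G x s.
have G'0 x s : 0 <= G' x s by rewrite /G'; case: ifP => _ //; exact: root_ge0.
have W'm u : u \in W' -> #|[pred x | u \in B x]| = m.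
  by rewrite !inE => /andP[_ uW]; exact: Wm.
have G'loc x u s : u \notin B x -> G' x (u |: s) = G' x s.
  by move=> ux; rewrite /G' setUCA (Gloc x u s ux) (Gloc x u (v |: s) ux).
have W'k : (#|W'| < k)%N by rewrite (cardsD1 v) vW in Wk.
have h := IH W' G' W'k W'm G'0 G'loc.
rewrite [in leLHS]WE sum_sub_setU1 //; apply: le_trans (le_trans _ h) _.
  apply: ler_sum => s sW'.
  rewrite (bigID (fun x => v \in B x)) /= [X in _ + X](bigID (fun x => v \in B x)) /=.
  rewrite [leRHS](bigID (fun x => v \in B x)) /=.
  rewrite [X in _ + _ * X](eq_bigr (fun x => G x s)); last by move=> x vx; rewrite Gloc.
  rewrite [X in _ <= _ * X](eq_bigr (fun x => G x s)); last by move=> x /negPf vx; rewrite /G' vx.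
  rewrite -mulrDl ler_wpM2r ?prodr_ge0 //.
  apply: le_trans (hoelder2 (P := [pred x | v \in B x]) m0 (Wm v vW) (fun x => G0 x s) (fun x => G0 x (v |: s))) _.
  by rewrite le_eqVlt; apply/orP; left; apply/eqP; apply: eq_bigr => x; rewrite inE => vx; rewrite /G' vx.
rewrite le_eqVlt; apply/orP; left; apply/eqP; apply: eq_bigr => x _; congr root.
rewrite WE setIUl; case: (boolP (v \in B x)) => vx.
  rewrite (setIidPl (_ : [set v] \subset B x)) ?sub1set // sum_sub_setU1; last by rewrite inE (negPf vW').
  by apply: eq_bigr => s _; rewrite /G' vx rootK // addr_ge0 ?exprn_ge0.
rewrite (_ : [set v] :&: B x = set0) ?set0U; last first.
  by apply/setP => u; rewrite !inE; case: eqP => // ->; exact: negbTE.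
by apply: eq_bigr => s _; rewrite /G' (negPf vx).
Qed.

End Hoelder.

(** * Reflection positivity *)

Section ReflectionPositivity.
Variable R : realType.

Lemma cauchy_schwarz_sum (I : finType) (P : pred I) (a b : I -> R) :
  (\sum_(i | P i) a i * b i) ^+ 2 <= (\sum_(i | P i) a i ^+ 2) * (\sum_(i | P i) b i ^+ 2).
Proof.
set S := \sum_(i | P i) a i * b i; set Sa := \sum_(i | P i) a i ^+ 2; set Sb := \sum_(i | P i) b i ^+ 2.
have Sb0 : 0 <= Sb by apply: sumr_ge0 => i _; exact: sqr_ge0.
have h : 0 <= \sum_(i | P i) (Sb * a i - S * b i) ^+ 2 by apply: sumr_ge0 => i _; exact: sqr_ge0.
have e : \sum_(i | P i) (Sb * a i - S * b i) ^+ 2 = Sb * (Sa * Sb - S ^+ 2).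
  transitivity (\sum_(i | P i) (Sb ^+ 2 * a i ^+ 2 - 2 * Sb * S * (a i * b i) + S ^+ 2 * b i ^+ 2)).
    by apply: eq_bigr => i _; ring.
  by rewrite big_split sumrB /= -!mulr_sumr -/Sa -/Sb -/S; ring.
have [Sb_eq|Sbn] := eqVneq Sb 0.
  suff -> : S = 0 by rewrite Sb_eq mulr0 expr0n.
  apply: big1 => i Pi; suff : b i == 0 by move=> /eqP ->; rewrite mulr0.
  have := Sb_eq; rewrite /Sb => /eqP; rewrite psumr_eq0; last by move=> j _; exact: sqr_ge0.
  by move=> /allP/(_ i); rewrite mem_index_enum Pi /= sqrf_eq0; apply.
have Sbp : 0 < Sb by rewrite lt_neqAle eq_sym Sbn.
by move: h; rewrite e pmulr_rge0 // subr_ge0.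
Qed.

Variables (V : finType) (theta : V -> V).
Hypothesis thetaK : involutive theta.

Lemma mem_image_invol (s : {set V}) v : (v \in theta @: s) = (theta v \in s).
Proof.
apply/imsetP/idP => [[u us ->]|vs]; first by rewrite thetaK.
by exists (theta v) => //; rewrite thetaK.
Qed.

Lemma image_invol_sub (s A B : {set V}) : theta @: A = B -> (theta @: s \subset B) = (s \subset A).
Proof.
by move=> <-; apply/idP/idP; [move=> /(imsetS theta); rewrite -!imset_comp; do 2!rewrite (eq_imset _ thetaK) imset_id | exact: imsetS].
Qed.

(* [P] is the fixed plane, [L] and [Q] the two open halves exchanged by [theta]. *)
Lemma rp_square (P L Q : {set V}) (A : {set V} -> R) :
  P :|: (L :|: Q) = setT -> [disjoint P & L :|: Q] -> [disjoint L & Q] ->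
  {in P, forall v, theta v = v} -> theta @: L = Q ->
  (forall s, A s = A (s :&: (P :|: L))) ->
  \sum_(s : {set V}) A s * A (theta @: s) =
  \sum_(p : {set V} | p \subset P) (\sum_(l : {set V} | l \subset L) A (p :|: l)) ^+ 2.
Proof.
move=> PLQ dP dLQ fixP LQ loc.
have QL : theta @: Q = L.
  by rewrite -LQ -imset_comp (eq_imset _ thetaK) imset_id.
transitivity (\sum_(s : {set V} | s \subset P :|: (L :|: Q)) A s * A (theta @: s)).
  by apply: eq_bigl => s; rewrite PLQ subsetT.
rewrite sum_sub_setU //; apply: eq_bigr => p pP.
rewrite sum_sub_setU // expr2 mulr_suml; apply: eq_bigr => l lL.
rewrite mulr_sumr.
rewrite [RHS](reindex_onto (fun r : {set V} => theta @: r) (fun r => theta @: r)) /=; last first.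
  by move=> r _; rewrite -imset_comp (eq_imset _ thetaK) imset_id.
apply: eq_big => r.
  rewrite -imset_comp (eq_imset _ thetaK) imset_id eqxx andbT.
  by rewrite (image_invol_sub _ QL).
move=> rQ.
have disj (x : V) : x \in r -> (x \notin P) && (x \notin L).
  move=> /(subsetP rQ) xQ; apply/andP; split; apply/negP => xx.
    by have := disjointFr dP xx; rewrite inE xQ orbT.
  by have := disjointFr dLQ xx; rewrite xQ.
congr (_ * _).
  rewrite loc [RHS]loc; congr A; apply/setP => x; rewrite !inE.
  case: (boolP (x \in r)) => [/disj/andP[/negPf -> /negPf ->]|_]; first by rewrite !andbF.
  by rewrite orbF.
rewrite loc [RHS]loc; congr A; apply/setP => x; rewrite !inE !mem_image_invol !inE.
case: (boolP (x \in P)) => xP /=.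
  rewrite !andbT fixP //; case: (boolP (x \in r)) => [/disj|_]; first by rewrite xP.
  case: (boolP (x \in l)) => [/(subsetP lL) xL|_]; last by rewrite !orbF.
  by have := disjointFr dP xP; rewrite inE xL.
case: (boolP (x \in L)) => xL; last by rewrite !andbF.
rewrite !andbT; have xQ : theta x \in Q by rewrite -LQ imset_f.
have nP : theta x \notin P by apply/negP => /(disjointFr dP); rewrite inE xQ orbT.
have np : theta x \notin p by apply: contra nP; exact: (subsetP pP).
have np' : x \notin p by apply: contra xP; exact: (subsetP pP).
have nl : theta x \notin l by apply/negP => /(subsetP lL)/(disjointFr dLQ); rewrite xQ.
by rewrite (negPf np) (negPf np') (negPf nl).
Qed.

(** For a fixed trace on [P] the sum factors into two half sums; Cauchy-Schwarz applies to the sum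
    over the traces, and [rp_square] identifies the two sums of squares. *)
Lemma rp_cauchy_schwarz (P L Q : {set V}) (A B : {set V} -> R) :
  P :|: (L :|: Q) = setT -> [disjoint P & L :|: Q] -> [disjoint L & Q] ->
  {in P, forall v, theta v = v} -> theta @: L = Q ->
  (forall s, A s = A (s :&: (P :|: L))) -> (forall s, B s = B (s :&: (P :|: Q))) ->
  (\sum_(s : {set V}) A s * B s) ^+ 2 <=
  (\sum_(s : {set V}) A s * A (theta @: s)) * (\sum_(s : {set V}) B s * B (theta @: s)).
Proof.
move=> PLQ dP dLQ fixP LQ locA locB.
have QL : theta @: Q = L by rewrite -LQ -imset_comp (eq_imset _ thetaK) imset_id.
rewrite (rp_square PLQ dP dLQ fixP LQ locA).
rewrite (rp_square (P := P) (L := Q) (Q := L) _ _ _ fixP QL locB); first last.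
- by rewrite disjoint_sym.
- by rewrite setUC.
- by rewrite [Q :|: L]setUC.
suff -> : \sum_(s : {set V}) A s * B s = \sum_(p : {set V} | p \subset P)
   (\sum_(l : {set V} | l \subset L) A (p :|: l)) * (\sum_(r : {set V} | r \subset Q) B (p :|: r)).
  exact: cauchy_schwarz_sum.
transitivity (\sum_(s : {set V} | s \subset P :|: (L :|: Q)) A s * B s).
  by apply: eq_bigl => s; rewrite PLQ subsetT.
rewrite sum_sub_setU //; apply: eq_bigr => p pP.
rewrite sum_sub_setU // mulr_suml; apply: eq_bigr => l lL.
rewrite mulr_sumr; apply: eq_bigr => r rQ; congr (_ * _).
  rewrite locA [RHS]locA; congr A; apply/setP => x; rewrite !inE.
  case: (boolP (x \in r)) => [/(subsetP rQ) xQ|_]; last by rewrite orbF.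
  have -> : x \in P = false by apply/negP => /(disjointFr dP); rewrite inE xQ orbT.
  have -> : x \in L = false by apply/negP => /(disjointFr dLQ); rewrite xQ.
  by rewrite !andbF.
rewrite locB [RHS]locB; congr B; apply/setP => x; rewrite !inE.
case: (boolP (x \in l)) => [/(subsetP lL) xL|_]; last by rewrite orFb.
have -> : x \in P = false by apply/negP => /(disjointFr dP); rewrite inE xL.
have -> : x \in Q = false by apply/negP => xQ; have := disjointFr dLQ xL; rewrite xQ.
by rewrite !andbF.
Qed.

End ReflectionPositivity.

(** * Chessboard estimate on the torus *)

(* Coordinates of the torus are [q.+2 = 2 ^ k.+1] residues; [2 ^ k] is half the period. *)
Section Coordinates.
Variables (q k : nat).
Hypothesis qk : q.+2 = (2 ^ k.+1)%N.
Local Notation Z := 'I_q.+2.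
Local Notation h := (2 ^ k)%N.
Implicit Types (x y c : Z) (b : bool).

Lemma half_period : q.+2 = (h + h)%N.
Proof. by rewrite qk expnS mul2n addnn. Qed.

Lemma half_gt0 : (0 < h)%N. Proof. by rewrite expn_gt0. Qed.

Lemma val_addZ x y : val (x + y) = ((val x + val y) %% q.+2)%N. Proof. by []. Qed.
Lemma val_oppZ x : val (- x) = ((q.+2 - val x) %% q.+2)%N. Proof. by []. Qed.
Lemma val_1Z : val (1 : Z) = 1%N. Proof. by []. Qed.

Lemma odd_period : odd q.+2 = false.
Proof. by rewrite qk expnS mul2n odd_double. Qed.

Lemma odd_modZ n : odd (n %% q.+2) = odd n.
Proof. by rewrite {2}(divn_eq n q.+2) oddD oddM odd_period andbF. Qed.

Lemma odd_addZ x y : odd (val (x + y)) = odd (val x) (+) odd (val y).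
Proof. by rewrite val_addZ odd_modZ oddD. Qed.

Lemma odd_oppZ x : odd (val (- x)) = odd (val x).
Proof.
by rewrite val_oppZ odd_modZ oddB ?(ltnW (ltn_ord x)) // odd_period addFb.
Qed.

Lemma odd_succZ x : odd (val (x + 1)) = ~~ odd (val x).
Proof. by rewrite odd_addZ val_1Z addbT. Qed.

Definition site_refl c y : Z := c - (y - c).
(** The cell [x] is the interval from x to x + 1, so its mirror image starts at the image of x +
    1. *)
Definition cell_refl c x : Z := c - (x - c) - 1.

Lemma site_reflK c : involutive (site_refl c).
Proof. by move=> y; rewrite /site_refl; ring. Qed.

Lemma cell_reflK c : involutive (cell_refl c).
Proof. by move=> y; rewrite /cell_refl; ring. Qed.

Lemma odd_site_refl c y : odd (val (site_refl c y)) = odd (val y).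
Proof. by rewrite /site_refl !(odd_addZ, odd_oppZ); case: (odd (val c)); case: (odd (val y)). Qed.

(** The end of parity [b] of the cell [x]. The period is even, so residues have a parity, and
    reflections in a site preserve it. *)
Definition endpoint x b : Z := if odd (val x) == b then x else x + 1.

Lemma endpoint_refl c x b : site_refl c (endpoint x b) = endpoint (cell_refl c x) b.
Proof.
have e1 : cell_refl c x + 1 = site_refl c x by rewrite /cell_refl subrK.
have e2 : cell_refl c x = site_refl c (x + 1) by rewrite /cell_refl /site_refl; ring.
have -> : endpoint (cell_refl c x) b = if odd (val (cell_refl c x)) == b then cell_refl c x else site_refl c x.
  by rewrite /endpoint e1.
rewrite {1}e2 odd_site_refl odd_succZ /endpoint.
by case: (odd (val x)); case: b => //=; rewrite e2.
Qed.

(** A half consists of [h] cells but of h + 1 sites: the sites c and c + h are fixed by the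
    reflection and belong to both halves. *)
Definition left_cell c x := (val (x - c)%R < h)%N.
Definition left_site c y := (val (y - c)%R <= h)%N.

Lemma val_neg (u : Z) : val (- u) = (if val u == 0 then 0 else q.+2 - val u)%N.
Proof.
rewrite val_oppZ; case: eqP => [->|/eqP u0]; first by rewrite subn0 modnn.
by rewrite modn_small // ltn_subrL lt0n u0.
Qed.

Lemma val_succ (u : Z) : val (u + 1) = (if (val u).+1 == q.+2 then 0 else (val u).+1)%N.
Proof.
rewrite val_addZ val_1Z addn1; case: eqP => [->|/eqP u0]; first by rewrite modnn.
by rewrite modn_small // ltn_neqAle u0 ltn_ord.
Qed.

Lemma left_cell_endpoint c x b : left_cell c x -> left_site c (endpoint x b).
Proof.
rewrite /left_cell /left_site /endpoint => lx; case: ifP => _; first exact: ltnW.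
have -> : x + 1 - c = (x - c) + 1 by ring.
by rewrite val_succ; case: ifP.
Qed.

Lemma left_cell_refl c x : left_cell c (cell_refl c x) = ~~ left_cell c x.
Proof.
rewrite /left_cell /cell_refl; have -> : c - (x - c) - 1 - c = - (x - c + 1) by ring.
rewrite val_neg val_succ -leqNgt; have := half_period; have := ltn_ord (x - c); have := half_gt0.
move: (x - c) => u; rewrite /=; case: ifP; case: ifP; lia.
Qed.

Lemma right_cell_endpoint c x b : ~~ left_cell c x -> left_site c (site_refl c (endpoint x b)).
Proof. by rewrite endpoint_refl -left_cell_refl; exact: left_cell_endpoint. Qed.

Lemma left_site_cover c y : left_site c y || left_site c (site_refl c y).
Proof.
rewrite /left_site /site_refl; have -> : c - (y - c) - c = - (y - c) by ring.
rewrite val_neg; have := half_period; have := ltn_ord (y - c).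
move: (y - c) => u; rewrite /=; case: eqP; lia.
Qed.

Lemma left_site_fix c y : left_site c y -> left_site c (site_refl c y) -> site_refl c y = y.
Proof.
rewrite /left_site /site_refl; have -> : c - (y - c) - c = - (y - c) by ring.
move=> h1 h2; suff e : - (y - c) = y - c by rewrite e addrC subrK.
apply/val_inj; move: h1 h2; rewrite val_neg; have := half_period; have := ltn_ord (y - c).
move: (y - c) => u; rewrite /=; case: eqP; lia.
Qed.

End Coordinates.

Section Torus.
Variables (d q k : nat).
Hypothesis qk : q.+2 = (2 ^ k.+1)%N.
Local Notation Z := 'I_q.+2.

Definition torus := {ffun 'I_d -> 'I_q.+2}.
Implicit Types (x y : torus) (i : 'I_d) (c v : Z).

Definition upd i v x : torus := [ffun j => if j == i then v else x j].

Lemma updE i v x j : upd i v x j = if j == i then v else x j.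
Proof. by rewrite ffunE. Qed.

Lemma upd_upd i v v' x : upd i v (upd i v' x) = upd i v x.
Proof. by apply/ffunP => j; rewrite !updE; case: eqP. Qed.

Lemma upd_id i x : upd i (x i) x = x.
Proof. by apply/ffunP => j; rewrite updE; case: eqP => // ->. Qed.

(* The corners of the cell [x] are labelled by their parities, which makes the
   labelling equivariant under reflections. *)
Definition corner x (z : cube d) : torus := [ffun j => endpoint (x j) (z j)].

Definition pattern x (s : {set torus}) : {set cube d} := [set z | corner x z \in s].

Definition site_reflect i c y := upd i (site_refl c (y i)) y.
Definition cell_reflect i c x := upd i (cell_refl c (x i)) x.

Lemma site_reflectK i c : involutive (site_reflect i c).
Proof.
by move=> y; rewrite /site_reflect upd_upd updE eqxx site_reflK upd_id.
Qed.

Lemma cell_reflectK i c : involutive (cell_reflect i c).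
Proof.
by move=> y; rewrite /cell_reflect upd_upd updE eqxx cell_reflK upd_id.
Qed.

Lemma corner_reflect i c x z : site_reflect i c (corner x z) = corner (cell_reflect i c x) z.
Proof.
apply/ffunP => j; rewrite updE !ffunE; case: eqP => // ->.
by rewrite (endpoint_refl qk).
Qed.

Lemma pattern_reflect i c x (s : {set torus}) :
  pattern x (site_reflect i c @: s) = pattern (cell_reflect i c x) s.
Proof.
apply/setP => z; rewrite !inE (mem_image_invol (@site_reflectK i c)).
by rewrite corner_reflect.
Qed.

Section Chessboard.
Variables (R : realType) (F : bool -> {set cube d} -> R).
Hypothesis F_ge0 : forall b t, 0 <= F b t.

Definition patternZ (a : {ffun torus -> bool}) : R :=
  \sum_(s : {set torus}) \prod_x F (a x) (pattern x s).

Definition fold_left i c (a : {ffun torus -> bool}) : {ffun torus -> bool} :=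
  [ffun x : torus => if left_cell k c (x i) then a x else a (cell_reflect i c x)].

Definition fold_right i c (a : {ffun torus -> bool}) : {ffun torus -> bool} :=
  [ffun x : torus => if left_cell k c (x i) then a (cell_reflect i c x) else a x].

Lemma left_cell_reflect i c x :
  left_cell k c (cell_reflect i c x i) = ~~ left_cell k c (x i).
Proof. by rewrite updE eqxx (left_cell_refl qk). Qed.

Lemma prod_left_reflect i c (f : torus -> R) :
  \prod_(x : torus | left_cell k c (x i)) f (cell_reflect i c x) =
  \prod_(x : torus | ~~ left_cell k c (x i)) f x.
Proof.
rewrite [RHS](reindex_inj (inv_inj (@cell_reflectK i c))) /=.
by apply: eq_bigl => x; rewrite left_cell_reflect negbK.
Qed.

Lemma prod_right_reflect i c (f : torus -> R) :
  \prod_(x : torus | ~~ left_cell k c (x i)) f (cell_reflect i c x) =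
  \prod_(x : torus | left_cell k c (x i)) f x.
Proof.
rewrite -prod_left_reflect; apply: eq_bigr => x _.
by rewrite cell_reflectK.
Qed.

Lemma prod_fold (g : bool -> torus -> R) i c a :
  \prod_x g (fold_left i c a x) x =
    \prod_(x : torus | left_cell k c (x i)) (g (a x) x * g (a x) (cell_reflect i c x)).
Proof.
rewrite (bigID (fun x : torus => left_cell k c (x i))) /= big_split /=; congr (_ * _).
  by apply: eq_bigr => x lx; rewrite ffunE lx.
rewrite -prod_left_reflect; apply: eq_bigr => x lx.
by rewrite ffunE left_cell_reflect lx /= cell_reflectK.
Qed.

Lemma prod_fold_right (g : bool -> torus -> R) i c a :
  \prod_x g (fold_right i c a x) x =
    \prod_(x : torus | ~~ left_cell k c (x i)) (g (a x) x * g (a x) (cell_reflect i c x)).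
Proof.
rewrite (bigID (fun x : torus => left_cell k c (x i))) /= big_split /= mulrC; congr (_ * _).
  by apply: eq_bigr => x /negPf lx; rewrite ffunE lx.
rewrite -prod_right_reflect; apply: eq_bigr => x /negPf lx.
by rewrite ffunE left_cell_reflect lx /= cell_reflectK.
Qed.

(** Reflection positivity across the pair of planes at c and c + h: no cell straddles them, so the
    product over the cells splits into one factor for each closed half. *)
Lemma patternZ_fold i c a :
  patternZ a ^+ 2 <= patternZ (fold_left i c a) * patternZ (fold_right i c a).
Proof.
pose theta := site_reflect i c.
pose P := [set y : torus | left_site k c (y i) && left_site k c (theta y i)].
pose L := [set y : torus | left_site k c (y i) && ~~ left_site k c (theta y i)].
pose Q := [set y : torus | ~~ left_site k c (y i)].
pose A (s : {set torus}) := \prod_(x : torus | left_cell k c (x i)) F (a x) (pattern x s).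
pose B (s : {set torus}) := \prod_(x : torus | ~~ left_cell k c (x i)) F (a x) (pattern x s).
have thE y : theta y i = site_refl c (y i) by rewrite updE eqxx.
have -> : patternZ a = \sum_(s : {set torus}) A s * B s.
  by apply: eq_bigr => s _; rewrite (bigID (fun x : torus => left_cell k c (x i))).
have -> : patternZ (fold_left i c a) = \sum_(s : {set torus}) A s * A (theta @: s).
  apply: eq_bigr => s _; rewrite (prod_fold (fun b x => F b (pattern x s))) big_split /=.
  by congr (_ * _); apply: eq_bigr => x _; rewrite pattern_reflect.
have -> : patternZ (fold_right i c a) = \sum_(s : {set torus}) B s * B (theta @: s).
  apply: eq_bigr => s _; rewrite (prod_fold_right (fun b x => F b (pattern x s))) big_split /=.
  by congr (_ * _); apply: eq_bigr => x _; rewrite pattern_reflect.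
apply: (@rp_cauchy_schwarz _ _ theta (@site_reflectK i c) P L Q).
- apply/setP => y; rewrite !inE.
  by case: (left_site k c (y i)); case: (left_site k c (theta y i)).
- rewrite -setI_eq0; apply/eqP/setP => y; rewrite !inE.
  by case: (left_site k c (y i)); case: (left_site k c (theta y i)).
- rewrite -setI_eq0; apply/eqP/setP => y; rewrite !inE.
  by case: (left_site k c (y i)); case: (left_site k c (theta y i)).
- move=> y; rewrite inE thE => /andP[h1 h2].
  by rewrite /theta /site_reflect (left_site_fix qk) // upd_id.
- apply/setP => y; rewrite (mem_image_invol (@site_reflectK i c)) !inE.
  rewrite /theta site_reflectK.
  have := left_site_cover qk c (y i); rewrite -thE -/theta.
  by case: (left_site k c (y i)); case: (left_site k c (theta y i)).
- move=> s; apply: eq_bigr => x lx; congr F; apply/setP => z; rewrite !inE.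
  have -> : left_site k c (corner x z i) by rewrite ffunE; exact: left_cell_endpoint.
  by case: (left_site k c _); rewrite /= ?andbT.
- move=> s; apply: eq_bigr => x lx; congr F; apply/setP => z; rewrite !inE.
  have -> : left_site k c (theta (corner x z) i).
    by rewrite thE ffunE; exact: (right_cell_endpoint qk).
  by case: (left_site k c _); rewrite /= ?andbT.
Qed.

Section Closed.
Variable M : {ffun torus -> bool} -> Prop.
Hypothesis M_fold : forall i c a, M a -> M (fold_left i c a).

Definition indep (a : {ffun torus -> bool}) j := forall x v, a (upd j v x) = a x.

Lemma indep_fold (a : {ffun torus -> bool}) i c j : j != i -> indep a j -> indep (fold_left i c a) j.
Proof.
move=> ji aj x v; rewrite ffunE [RHS]ffunE updE (eq_sym i) (negPf ji).
case: ifP => _; first exact: aj.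
have -> : cell_reflect i c (upd j v x) = upd j v (cell_reflect i c x).
  apply/ffunP => l; rewrite !updE (eq_sym i) (negPf ji).
  by case: (eqVneq l i) => // ->; rewrite eq_sym (negPf ji).
exact: aj.
Qed.

(* Reflecting at the left end of a constant run doubles its length. *)
Lemma run_doubling (a : {ffun torus -> bool}) i c l : (l <= 2 ^ k)%N ->
  (forall x, (val (x i - c)%R < l)%N -> a x = a (upd i c x)) ->
  exists c', forall x, (val (x i - c')%R < 2 * l)%N ->
    fold_left i c a x = fold_left i c a (upd i c' x).
Proof.
move=> lk run; case: (posnP l) => [->|l0]; first by exists c.
have hp := half_period qk.
have val_l : val (inord l : Z) = l by rewrite /= inordK //; have := half_gt0 k; lia.
have key x : (val (x i - c + inord l)%R < 2 * l)%N -> fold_left i c a x = a (upd i c x).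
  rewrite ffunE /left_cell => hx.
  case: ltnP => hl.
    apply: run; move: hx; rewrite val_addZ val_l; move: (val _) hl => u hl.
    rewrite modn_small; lia.
  rewrite run.
    by rewrite /cell_reflect upd_upd.
  rewrite updE eqxx /cell_refl.
  have -> : c - (x i - c) - 1 - c = - (x i - c + 1) by ring.
  rewrite val_neg val_succ.
  move: hx; rewrite val_addZ val_l; have := ltn_ord (x i - c); move: (val _) hl => u hl uN.
  case: (ltnP (u + l) q.+2) => hul; first by rewrite modn_small //; lia.
  by move=> _; case: (eqVneq u.+1 q.+2) => ? /=; lia.
exists (c - inord l) => x hx.
rewrite !key ?upd_upd //.
  rewrite updE eqxx (_ : _ + _ = 0) /=; last by ring.
  by rewrite muln_gt0.
by rewrite (_ : _ + _ = x i - (c - inord l)) //; ring.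
Qed.

(** A run of length one fills the period after k + 1 doublings; this is where a side that is a power
    of two is convenient. *)
Lemma closed_indep1 (a : {ffun torus -> bool}) i : M a -> exists2 b, M b & indep b i /\
  (forall j, j != i -> indep a j -> indep b j).
Proof.
move=> Ma.
have main t : (t <= k.+1)%N -> exists2 b, M b &
    (exists c, forall x, (val (x i - c)%R < 2 ^ t)%N -> b x = b (upd i c x)) /\
    (forall j, j != i -> indep a j -> indep b j).
  elim: t => [_|t IH tk].
    exists a => //; split=> //; exists 0 => x; rewrite expn0 ltnS leqn0 subr0 => /eqP h.
    by rewrite (_ : 0 = x i) ?upd_id //; apply: val_inj; rewrite /= h.
  have [b Mb [[c hc] hb]] := IH (ltnW tk).
  exists (fold_left i c b); first exact: M_fold.
  split; last by move=> j ji aj; apply: indep_fold => //; exact: hb.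
  by rewrite expnS; apply: run_doubling => //; rewrite leq_exp2l.
have [b Mb [[c hc] hb]] := main k.+1 (leqnn _).
exists b => //; split=> // x v.
rewrite hc; last by rewrite -qk ltn_ord.
by rewrite upd_upd -hc // -qk ltn_ord.
Qed.

Lemma closed_const a : M a -> exists b, M [ffun=> b].
Proof.
move=> Ma.
have [b Mb hb] : exists2 b, M b & forall j, indep b j.
  have main (r : seq 'I_d) : exists2 b, M b & {in r, forall j, indep b j}.
    elim: r => [|i r [b Mb hb]]; first by exists a.
    have [b' Mb' [b'i hb']] := closed_indep1 i Mb.
    exists b' => // j; rewrite inE; case: (eqVneq j i) => [-> //|ji /= jr].
    by apply: hb' => //; exact: hb.
  by have [b Mb hb] := main (enum 'I_d); exists b => // j; apply: hb; rewrite mem_enum.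
exists (b [ffun=> 0]); suff -> : [ffun=> b [ffun=> 0]] = b by [].
apply/ffunP => x; rewrite ffunE.
have main (r : seq 'I_d) : b [ffun j => if j \in r then x j else 0] = b [ffun=> 0].
  elim: r => [|i r IH]; first by congr (b _); apply/ffunP => j; rewrite !ffunE.
  rewrite -IH -[RHS](hb i _ (x i)); congr (b _); apply/ffunP => j.
  by rewrite updE !ffunE inE; case: eqP => // ->.
rewrite -(main (enum 'I_d)); congr (b _); apply/ffunP => j.
by rewrite ffunE mem_enum.
Qed.

End Closed.

(** By [patternZ_fold] the ratio [M] of the two sides is at most the geometric mean of its values at
    the two folds. The set of its maximisers is therefore closed under folding and contains a
    constant, where the hypothesis applies. *)
Theorem chessboard (w : bool -> R) a :
  (forall b, 0 < w b) ->
  (forall b, patternZ [ffun=> b] <= w b ^+ #|torus|) ->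
  patternZ a <= \prod_x w (a x).
Proof.
move=> w0 hw.
have pw (b : {ffun torus -> bool}) : 0 < \prod_x w (b x) by apply: prodr_gt0.
pose M (b : {ffun torus -> bool}) := patternZ b / \prod_x w (b x).
have M0 b : 0 <= M b.
  by rewrite divr_ge0 ?(ltW (pw _)) // sumr_ge0 // => s _; rewrite prodr_ge0.
suff h b : M b <= 1 by have := h a; rewrite ler_pdivrMr // mul1r.
pose m := [arg max_(b' > b) M b']%O.
have mmax b' : M b' <= M m by rewrite /m; case: arg_maxP => // m' _; apply.
apply: le_trans (mmax b) _; case: (leP (M m) 0) => [/le_trans -> //|m0].
pose isM b' := M b' = M m.
have fold i c b' : isM b' -> isM (fold_left i c b').
  rewrite /isM => bm; apply/eqP; rewrite eq_le mmax /=.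
  have : M b' ^+ 2 <= M (fold_left i c b') * M (fold_right i c b').
    rewrite /M expr_div_n mulrACA -invfM.
    have -> : (\prod_x w (fold_left i c b' x)) * (\prod_x w (fold_right i c b' x)) = (\prod_x w (b' x)) ^+ 2.
      rewrite (prod_fold (fun b _ => w b)) (prod_fold_right (fun b _ => w b)).
      rewrite -prodrXl [RHS](bigID (fun x : torus => left_cell k c (x i))) /=.
      by congr (_ * _); apply: eq_bigr => x _; rewrite expr2.
    by rewrite ler_pM2r ?patternZ_fold // invr_gt0 exprn_gt0.
  rewrite bm expr2 => /le_trans -/(_ _ (ler_wpM2l (M0 _) (mmax _))).
  by rewrite ler_pM2r.
have [b' <-] := closed_const fold (erefl : isM m).
rewrite /M ler_pdivrMr ?pw // mul1r; apply: le_trans (hw b') _.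
by rewrite (eq_bigr (fun=> w b')) ?prodr_const // => x _; rewrite ffunE.
Qed.

End Chessboard.
End Torus.

(** * The hard-core model on the torus *)

Section CubeHardCore.
Variable d : nat.
Implicit Types (z : cube d) (t : {set cube d}).

Definition parity z : bool := odd (\sum_i z i).

Lemma parity_flip i z : parity (flip i z) = ~~ parity z.
Proof.
rewrite /parity (bigD1 i) //= [in RHS](bigD1 i) //= flipE eqxx.
rewrite (eq_bigr (fun j => nat_of_bool (z j))) => [|j /negPf ji]; last by rewrite flipE ji.
by rewrite !oddD; case: (z i) => //=; rewrite negbK.
Qed.

Definition cube_indep t : bool := [forall z in t, forall i, flip i z \notin t].

Lemma cube_indepP t : reflect (forall z i, z \in t -> flip i z \notin t) (cube_indep t).
Proof.
apply: (iffP forall_inP) => [h z i zt|h z zt]; first exact: (forallP (h z zt) i).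
by apply/forallP => i; exact: h.
Qed.

Lemma cube_indep_parity b t : (forall z, z \in t -> parity z = b) -> cube_indep t.
Proof.
move=> h; apply/cube_indepP => z i zt; apply/negP => /h.
by rewrite parity_flip (h _ zt); case: b {h}.
Qed.

End CubeHardCore.

Section TorusHardCore.
Variables (d q k : nat).
Hypothesis qk : q.+2 = (2 ^ k.+1)%N.
Hypothesis d_gt0 : (0 < d)%N.
Local Notation torus := (torus d q).
Local Notation m := (2 ^ d)%N.
Implicit Types (x v : torus) (z : cube d) (s : {set torus}).

Definition parities v : cube d := [ffun j => odd (val (v j))].

Lemma odd_endpoint (x : 'I_q.+2) b : odd (val (endpoint x b)) = b.
Proof.
rewrite /endpoint; case: eqP => // /eqP; rewrite (odd_succZ qk x).
by case: (odd (val x)); case: b.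
Qed.

Lemma parities_corner x z : parities (corner x z) = z.
Proof. by apply/ffunP => j; rewrite !ffunE odd_endpoint. Qed.

Lemma corner_inj x : injective (corner x).
Proof. exact: can_inj (parities_corner x). Qed.

Definition corners x : {set torus} := [set corner x z | z in setT].

Lemma in_corners x v : (v \in corners x) = (corner x (parities v) == v).
Proof.
apply/imsetP/eqP => [[z _ ->]|<-]; first by rewrite parities_corner.
by exists (parities v).
Qed.

Definition step (b : bool) : 'I_q.+2 := if b then 1 else 0.

Definition translate x (y : cube d) : torus := [ffun j => x j + step (y j)].

Lemma card_cells_at v : #|[pred x | v \in corners x]| = m.
Proof.
pose f (y : cube d) : torus := [ffun j => v j - step (y j)].
have f_inj : injective f.
  move=> y y' /ffunP h; apply/ffunP => j; have := h j; rewrite !ffunE => /addrI/oppr_inj.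
  by rewrite /step; case: (y j); case: (y' j).
rewrite -(card_cube d) -cardsT -(card_imset _ f_inj); apply: eq_card => x.
rewrite inE in_corners; apply/eqP/imsetP => [/ffunP h|[y _ ->]].
  exists [ffun j => x j != v j] => //; apply/ffunP => j; have := h j.
  rewrite !ffunE /endpoint; case: eqP => [_ ->|_ <-]; first by rewrite eqxx subr0.
  rewrite (_ : x j != x j + 1) ?addrK //.
  by rewrite -subr_eq0 opprD addrA subrr sub0r oppr_eq0 oner_eq0.
apply/ffunP => j; rewrite !ffunE /endpoint /step; case: (y j); last by rewrite subr0 eqxx.
have -> : odd (val (v j)) = ~~ odd (val (v j - 1)) by rewrite -(odd_succZ qk) subrK.
by rewrite subrK; case: (odd _).
Qed.

Lemma card_pattern x s : #|pattern x s| = #|s :&: corners x|.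
Proof.
rewrite -(card_imset _ (@corner_inj x)); apply: eq_card => v.
rewrite inE in_corners; apply/imsetP/andP => [[z]|[vs /eqP e]].
  by rewrite inE => h ->; rewrite parities_corner.
by exists (parities v); rewrite ?inE e.
Qed.

Lemma sum_card_pattern s : (\sum_x #|pattern x s| = m * #|s|)%N.
Proof.
transitivity (\sum_(v in s) \sum_x (v \in corners x))%N.
  rewrite exchange_big /=; apply: eq_bigr => x _; rewrite card_pattern.
  rewrite -sum1_card big_mkcond [RHS]big_mkcond; apply: eq_bigr => v _.
  by rewrite inE; case: (v \in s); case: (v \in corners x).
rewrite (eq_bigr (fun=> m)) ?sum_nat_const 1?mulnC // => v _.
by rewrite -(card_cells_at v) -sum1_card [RHS]big_mkcond.
Qed.

Section Hoelder.
Variables (R : realType) (F : bool -> {set cube d} -> R).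
Hypothesis F_ge0 : forall b t, 0 <= F b t.

(** Each site lies in 2^d cells. This decouples the cells, so that the constant markings needed by
    [chessboard] are controlled by sums over one hypercube. *)
Lemma patternZ_hoelder (a : {ffun torus -> bool}) :
  patternZ F a <= \prod_x root m (\sum_t F (a x) t ^+ m).
Proof.
have m0 : (0 < m)%N by rewrite expn_gt0.
have loc x v s : v \notin corners x -> F (a x) (pattern x (v |: s)) = F (a x) (pattern x s).
  move=> vx; congr F; apply/setP => z; rewrite !inE; case: eqP => //= e.
  by move: vx; rewrite -e imset_f.
have h := @generalized_hoelder R _ _ corners m setT (fun x s => F (a x) (pattern x s)) m0
  (fun v _ => card_cells_at v) (fun x s => F_ge0 (a x) (pattern x s)) loc.
have -> : patternZ F a = \sum_(s : {set torus} | s \subset setT) \prod_x F (a x) (pattern x s).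
  by apply: eq_bigl => s; rewrite subsetT.
apply: le_trans h _; rewrite le_eqVlt; apply/orP; left; apply/eqP.
apply: eq_bigr => x _; congr root; rewrite setTI.
rewrite [LHS](reindex_onto (fun t : {set cube d} => corner x @: t) (fun s => pattern x s)) /=.
  apply: eq_big => [t|t _].
    rewrite imsetS ?subsetT //; apply/eqP/setP => z.
    by rewrite inE mem_imset //; exact: corner_inj.
  by congr (F _ _ ^+ _); apply/setP => z; rewrite inE mem_imset //; exact: corner_inj.
move=> s /subsetP sx; apply/setP => v; apply/imsetP/idP => [[z]|vs].
  by rewrite inE => h ->.
have := sx v vs; rewrite in_corners => /eqP e.
by exists (parities v); rewrite ?inE e.
Qed.

End Hoelder.

Section Weights.
Variables (R : realType) (lam : R).
Hypothesis lam_gt0 : 0 < lam.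

Definition torus_indep s : bool := [forall x, cube_indep (pattern x s)].

Definition hc_weight s : R := (torus_indep s)%:R * lam ^+ #|s|.

Definition hc_Z : R := \sum_(s : {set torus}) hc_weight s.

Definition cube_Z (P : pred {set cube d}) : R :=
  \sum_(t : {set cube d} | cube_indep t && P t) lam ^+ #|t|.

Lemma hc_weight_ge0 s : 0 <= hc_weight s.
Proof. by rewrite mulr_ge0 ?ler0n // exprn_ge0 // ltW. Qed.

Lemma card_even_sites : (#|[set v | ~~ parity (parities v)]| * 2 = #|torus|)%N.
Proof.
pose i0 := Ordinal d_gt0.
pose f v : torus := upd i0 (v i0 + 1) v.
have f_inj : injective f.
  move=> v w /ffunP h; apply/ffunP => j; have := h j; rewrite !updE; case: eqP => [->|//].
  exact: addIr.
have fpar v : parity (parities (f v)) = ~~ parity (parities v).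
  rewrite -(parity_flip i0); congr parity; apply/ffunP => j.
  rewrite flipE ffunE updE ffunE; case: eqP => [->|//]; exact: (odd_succZ qk).
rewrite -cardsT -(cardsID [set v | ~~ parity (parities v)] setT) setTI setTD muln2 -addnn.
congr addn; rewrite -(card_imset _ f_inj); apply: eq_card => v.
have [g fg gf] : bijective f by exact: injF_bij f_inj.
rewrite !inE negbK; apply/imsetP/idP => [[w]|pv]; first by rewrite inE => pw ->; rewrite fpar.
by exists (g v); rewrite ?gf // inE -fpar gf.
Qed.

(** All subsets of the even sublattice, which is half of the torus, are independent. *)
Lemma hc_Z_lower : (1 + lam) ^+ #|torus| <= hc_Z ^+ 2.
Proof.
have e1 : 0 <= 1 + lam by have := lam_gt0; lra.
rewrite -card_even_sites exprM lerXn2r ?nnegrE ?exprn_ge0 ?sumr_ge0 // => [s _|].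
  exact: hc_weight_ge0.
rewrite -sum_sub_expn big_mkcond /=; apply: ler_sum => s _.
case: ifP => [/subsetP sE|_]; last exact: hc_weight_ge0.
rewrite /hc_weight (_ : torus_indep s) ?mul1r //; apply/forallP => x.
apply: (@cube_indep_parity d false) => z; rewrite inE => /sE; rewrite inE parities_corner.
exact: negbTE.
Qed.

Section BadCells.
Variables (bad : pred {set cube d}) (G eta : R).
Hypothesis cube_bound :
  cube_Z predT + expR G * cube_Z bad <= (1 + lam) ^+ (2 ^ d.-1) * expR eta.

(** A site lies in [m] cells and gives each of them the [m]-th root of its activity. On marked bad
    cells the bonus expR (G / m) becomes expR G once Hoelder's inequality takes [m]-th powers. *)
Definition cell_weight (b : bool) (t : {set cube d}) : R :=
  (cube_indep t)%:R * root m lam ^+ #|t| * (if b && bad t then expR (G / m%:R) else 1).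

Let m_gt0 : (0 < m)%N. Proof. by rewrite expn_gt0. Qed.

Lemma cell_weight_ge0 b t : 0 <= cell_weight b t.
Proof.
rewrite !mulr_ge0 ?ler0n ?exprn_ge0 ?root_ge0 //.
by case: ifP => _; rewrite ?expR_ge0.
Qed.

Lemma prod_cell_weight (a : {ffun torus -> bool}) s :
  \prod_x cell_weight (a x) (pattern x s) =
  hc_weight s * expR (G / m%:R * #|[set x | a x & bad (pattern x s)]|%:R).
Proof.
rewrite !big_split /=; congr (_ * _ * _).
- case: (boolP (torus_indep s)) => [/forallP h|]; first by rewrite big1 // => x _; rewrite h.
  rewrite negb_forall => /existsP[x /negPf h].
  by rewrite (bigD1 x) //= h mul0r.
- by rewrite prodrXr sum_card_pattern exprM rootK // ltW.
- rewrite -big_mkcond /= prodr_const -expRM_natr; congr (expR _); congr (_ * _%:R).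
  by apply: eq_card => x; rewrite !inE.
Qed.

(** Chessboard estimate with [w0], the partition function per site, as value of an unmarked cell. By
    Hoelder and [cube_bound] a marked cell is worth at most expR (eta / m) sqrt(1 + lam), and sqrt(1
    + lam) <= w0 by [hc_Z_lower]. *)
Theorem bad_cells_laplace (S : {set torus}) :
  \sum_(s : {set torus}) hc_weight s * expR (G / m%:R * #|[set x in S | bad (pattern x s)]|%:R)
  <= expR (eta / m%:R * #|S|%:R) * hc_Z.
Proof.
have mR : 0 < m%:R :> R by rewrite ltr0n.
pose a0 : {ffun torus -> bool} := [ffun=> false].
pose aS : {ffun torus -> bool} := [ffun x => x \in S].
have Z0 : hc_Z = patternZ cell_weight a0.
  apply: eq_bigr => s _; rewrite prod_cell_weight (_ : [set x | _ & _] = set0).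
    by rewrite cards0 mulr0 expR0 mulr1.
  by apply/setP => x; rewrite !inE ffunE.
have ZS : \sum_(s : {set torus}) hc_weight s * expR (G / m%:R * #|[set x in S | bad (pattern x s)]|%:R)
   = patternZ cell_weight aS.
  apply: eq_bigr => s _; rewrite prod_cell_weight; congr (_ * expR (_ * _%:R)).
  by apply: eq_card => x; rewrite !inE ffunE.
have lam1 : 0 < 1 + lam by have := lam_gt0; lra.
have Zge0 : 0 <= hc_Z by apply: sumr_ge0 => s _; exact: hc_weight_ge0.
have Zpos : 0 < hc_Z.
  rewrite lt_neqAle Zge0 andbT eq_sym; apply/negP => /eqP z0.
  have := hc_Z_lower; rewrite z0 expr0n /= => h.
  by have := exprn_gt0 #|torus| lam1; rewrite ltNge h.
have T0 : (0 < #|torus|)%N by apply/card_gt0P; exists [ffun=> 0].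
pose w1 := root m (\sum_t cell_weight true t ^+ m).
pose w0 := root #|torus| hc_Z.
have w0T : w0 ^+ #|torus| = hc_Z by rewrite rootK.
have w0_gt0 : 0 < w0.
  by rewrite lt_neqAle root_ge0 andbT eq_sym; apply/negP => /eqP e; move: Zpos; rewrite -w0T e expr0n -leqn0 leqNgt T0 ltxx.
have w02 : 1 + lam <= w0 ^+ 2.
  rewrite -(ler_pXn2r T0) ?nnegrE ?exprn_ge0 ?root_ge0 ?(ltW lam1) //.
  by rewrite exprAC w0T; exact: hc_Z_lower.
have sum1 : \sum_t cell_weight true t ^+ m <= (1 + lam) ^+ (2 ^ d.-1) * expR eta.
  apply: le_trans cube_bound.
  rewrite /cube_Z mulr_sumr [X in _ <= X + _]big_mkcond [X in _ <= _ + X]big_mkcond /= -big_split /=.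
  apply: ler_sum => t _; rewrite /cell_weight andbT !exprMn -exprM mulnC exprM rootK ?(ltW lam_gt0) //.
  case: (cube_indep t) => /=; last by rewrite expr0n -leqn0 leqNgt m_gt0 !mul0r addr0.
  rewrite expr1n mul1r; have l0 : 0 <= lam ^+ #|t| by rewrite exprn_ge0 // ltW.
  case: (bad t); last by rewrite expr1n mulr1 addr0.
  rewrite -expRM_natl mulrC [_ * (G / _)]mulrC divfK ?gt_eqF //.
  by rewrite lerDr.
have w10 : w1 <= expR (eta / m%:R) * w0.
  rewrite -(ler_pXn2r m_gt0) ?nnegrE ?mulr_ge0 ?root_ge0 ?expR_ge0 //.
  have s0 : 0 <= \sum_t cell_weight true t ^+ m.
    by apply: sumr_ge0 => t _; rewrite exprn_ge0 // cell_weight_ge0.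
  rewrite /w1 rootK //.
  apply: le_trans sum1 _; rewrite exprMn -expRM_natl [_ * (eta / _)]mulrC divfK ?gt_eqF //.
  rewrite mulrC ler_wpM2l ?expR_ge0 //.
  rewrite -{2}(prednK d_gt0) expnS exprM lerXn2r ?nnegrE ?exprn_ge0 ?root_ge0 //.
  exact: ltW.
pose w (b : bool) := if b then expR (eta / m%:R) * w0 else w0.
have wp b : 0 < w b by case: b => //=; rewrite mulr_gt0 ?expR_gt0.
have hw b : patternZ cell_weight ([ffun=> b] : {ffun torus -> bool}) <= w b ^+ #|torus|.
  case: b => /=; last first.
    by rewrite w0T Z0.
  apply: le_trans (patternZ_hoelder cell_weight_ge0 _) _.
  rewrite (eq_bigr (fun=> w1)) => [|x _]; last by rewrite ffunE.
  by rewrite prodr_const lerXn2r ?nnegrE ?mulr_ge0 ?root_ge0 ?expR_ge0.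
rewrite ZS; apply: le_trans (chessboard qk cell_weight_ge0 aS wp hw) _.
rewrite (bigID (mem S)) /=.
rewrite (eq_bigr (fun=> expR (eta / m%:R) * w0)) => [|x xS]; last by rewrite ffunE xS.
rewrite [X in _ * X](eq_bigr (fun=> w0)) => [|x /negPf xS]; last by rewrite ffunE xS.
rewrite big_split /= -mulrA.
have -> : (\prod_(x in S) w0) * (\prod_(x | x \notin S) w0) = hc_Z.
  by rewrite -w0T -prodr_const [RHS](bigID (mem S)).
by rewrite prodr_const -expRM_natr.
Qed.

End BadCells.
End Weights.
End TorusHardCore.

(** * Independent sets in the hypercube *)

Section CubeGraph.
Variable n : nat.
Implicit Types (I : {set 'I_n}) (u v z : cube n) (J t W : {set cube n}).

(** Omitting one direction from [I] separates two opposite facets, so that the container bound also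
    applies to a facet. *)
Definition cube_nbhs I z : {set cube n} := [set flip j z | j in I].

Lemma cube_nbhsP I u z : reflect (exists2 j, j \in I & u = flip j z) (u \in cube_nbhs I z).
Proof. exact: imsetP. Qed.

Lemma cube_nbhs_sym I u v : (u \in cube_nbhs I v) = (v \in cube_nbhs I u).
Proof.
by apply/cube_nbhsP/cube_nbhsP => -[j jI ->]; exists j; rewrite ?flipK.
Qed.

Lemma flip_dir_inj z : injective (fun i => flip i z).
Proof.
move=> i j /ffunP/(_ i); rewrite !flipE eqxx; case: eqP => // _.
by case: (z i).
Qed.

Lemma card_cube_nbhs I z : #|cube_nbhs I z| = #|I|.
Proof. by rewrite card_imset //; exact: flip_dir_inj. Qed.

Lemma cube_codegree I u v : u != v -> (#|cube_nbhs I u :&: cube_nbhs I v| <= 2)%N.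
Proof.
move=> uv; have [->|[w]] := set_0Vmem (cube_nbhs I u :&: cube_nbhs I v); first by rewrite cards0.
rewrite inE => /andP[/cube_nbhsP[i _ wi] /cube_nbhsP[j _ wj]].
have vE : v = flip j (flip i u) by rewrite -wi wj flipK.
apply: (@leq_trans #|[set flip i u; flip j u]|); last first.
  by rewrite cards2; case: (_ != _).
apply: subset_leq_card; apply/subsetP => x; rewrite !inE.
move=> /andP[/cube_nbhsP[i' _ xi] /cube_nbhsP[j' _ xj]].
have vE' : v = flip j' (flip i' u) by rewrite -xi xj flipK.
have ij' : i' != j'.
  by apply/negP => /eqP e; move: uv; rewrite vE' e flipK eqxx.
have := vE'; rewrite vE => /ffunP/(_ i'); rewrite !flipE eqxx (negPf ij') xi.
case: (eqVneq i' i) => [->|_]; first by rewrite eqxx.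
case: (eqVneq i' j) => [->|_]; first by rewrite eqxx orbT.
by case: (u i').
Qed.

Definition odd_part : {set cube n} := [set z | parity z].
Definition even_part : {set cube n} := [set z | ~~ parity z].

Lemma odd_evenU W : (odd_part :&: W) :|: (even_part :&: W) = W.
Proof. by rewrite -setIUl; apply/setP => z; rewrite !inE orbN. Qed.

Lemma odd_even_disjoint W : [disjoint odd_part :&: W & even_part :&: W].
Proof.
rewrite -setI_eq0; apply/eqP/setP => z; rewrite !inE.
by case: (parity z); rewrite ?andbF.
Qed.

Local Notation nb I := (nbhs_of (cube_nbhs I)).

Lemma nbhs_of_odd I J : J \subset odd_part -> nb I J \subset even_part.
Proof.
move=> /subsetP Jo; apply/subsetP => z /nbhs_ofP[v /Jo + /cube_nbhsP[j _ ->]].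
by rewrite !inE parity_flip negbK.
Qed.

Definition indep_in I t : bool := [disjoint nb I t & t].

Lemma cube_indep_in t : cube_indep t -> indep_in setT t.
Proof.
move=> /cube_indepP h; apply/pred0P => z /=; apply/negP => /andP[/nbhs_ofP[v vt /cube_nbhsP[j _ ->]]].
exact/negP/h.
Qed.

Section Weights.
Variables (R : realType) (lam : R).
Hypothesis lam_gt0 : 0 < lam.

Let lam1 : 0 < 1 + lam. Proof. have := lam_gt0; lra. Qed.

(* Summing out the even part of an independent set leaves the factor
   [(1 + lam) ^ (number of free even vertices)]. *)
Lemma indep_sum_le I W (P : pred {set cube n}) (Q : pred {set cube n}) (b : R) :
  (forall z j, z \in W -> j \in I -> flip j z \in W) ->
  (forall J K : {set cube n}, J \subset odd_part :&: W -> K \subset (even_part :&: W) :\: nb I J ->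
     P (J :|: K) -> Q J) ->
  \sum_(J : {set cube n} | Q J) lam ^+ #|J| * (1 + lam) ^- #|nb I J| <= b ->
  \sum_(t : {set cube n} | (t \subset W) && (indep_in I t && P t)) lam ^+ #|t| <=
    (1 + lam) ^+ #|even_part :&: W| * b.
Proof.
move=> WI PQ hb.
have := sum_sub_setU (fun t => (indep_in I t && P t)%:R * lam ^+ #|t|) (odd_even_disjoint W).
rewrite odd_evenU => e.
rewrite big_mkcondr /= (eq_bigr (fun t => (indep_in I t && P t)%:R * lam ^+ #|t|)); last first.
  by move=> t _; case: (_ && _); rewrite ?mul1r ?mul0r.
rewrite e; apply: le_trans (ler_wpM2l (exprn_ge0 _ (ltW lam1)) hb).
rewrite mulr_sumr big_mkcond [leRHS]big_mkcond /=; apply: ler_sum => J _.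
have pos : 0 <= (1 + lam) ^+ #|even_part :&: W| * (lam ^+ #|J| * (1 + lam) ^- #|nb I J|).
  by rewrite !mulr_ge0 ?exprn_ge0 ?invr_ge0 ?exprn_ge0 ?(ltW lam1) // ltW.
case: ifP => JW; last by case: ifP.
set E := (even_part :&: W) :\: nb I J.
have nbJ : nb I J \subset even_part :&: W.
  rewrite subsetI nbhs_of_odd ?(subset_trans JW) ?subsetIl //=.
  apply/subsetP => z /nbhs_ofP[v vJ /cube_nbhsP[j jI ->]]; apply: WI => //.
  by have := subsetP JW v vJ; rewrite inE => /andP[].
have KE (K : {set cube n}) : K \subset even_part :&: W -> indep_in I (J :|: K) -> K \subset E.
  move=> KW ind; apply/subsetP => z zK; rewrite inE (subsetP KW) // andbT.
  apply/negP => zJ; have /pred0P/(_ z)/= := ind; rewrite inE zK orbT andbT => /negP; apply.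
  by apply: subsetP zJ; apply: nbhs_ofS; exact: subsetUl.
have step : \sum_(K : {set cube n} | K \subset even_part :&: W)
     (indep_in I (J :|: K) && P (J :|: K))%:R * lam ^+ #|J :|: K| <=
   (Q J)%:R * (lam ^+ #|J| * (1 + lam) ^+ #|E|).
  rewrite -sum_sub_expn mulrA mulr_sumr big_mkcond [leRHS]big_mkcond /=; apply: ler_sum => K _.
  have l0 k : 0 <= lam ^+ k by rewrite exprn_ge0 // ltW.
  case: ifP => KW; last by case: ifP => //; rewrite !mulr_ge0 ?ler0n.
  case: (boolP (indep_in I _)) => ind; last by rewrite mul0r; case: ifP => //; rewrite !mulr_ge0 ?ler0n.
  have KE' := KE K KW ind; rewrite KE'.
  case: (boolP (P _)) => PJK; last by rewrite mul0r !mulr_ge0 ?ler0n //.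
  rewrite (PQ J K) // !mul1r -exprD cardsU (_ : J :&: K = set0) ?cards0 ?subn0 //.
  apply/eqP; rewrite setI_eq0; exact: (disjointW JW KW (odd_even_disjoint W)).
apply: le_trans step _; case: (Q J); rewrite ?mul0r // mul1r.
rewrite mulrCA ler_wpM2l ?exprn_ge0 ?(ltW lam_gt0) //.
rewrite -(subnK (subset_leq_card nbJ)) exprD mulfK ?expf_neq0 ?gt_eqF //.
by rewrite /E cardsD (setIidPr nbJ).
Qed.

(** Exponential Markov inequality with parameter [s]. *)
Lemma small_sum_le (B : {set cube n}) (K s : R) : 0 <= s ->
  \sum_(a : {set cube n} | (a \subset B) && (#|a|%:R <= K)) lam ^+ #|a| <=
  expR (s * K) * (1 + lam * expR (- s)) ^+ #|B|.
Proof.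
move=> s0; rewrite -sum_sub_expn mulr_sumr big_mkcondr /=; apply: ler_sum => a _.
have l0 : 0 <= lam ^+ #|a| by rewrite exprn_ge0 // ltW.
rewrite exprMn mulrCA; case: ifP => aK; last by rewrite mulr_ge0 // mulr_ge0 ?exprn_ge0 ?expR_ge0.
rewrite -[leLHS]mulr1 ler_wpM2l // -expRM_natl -expRD.
apply: le_trans (_ : expR 0 <= _); first by rewrite expR0.
rewrite ler_expR.
rewrite mulrN subr_ge0 [leLHS]mulrC. exact: (ler_wpM2l s0 aK).
Qed.

End Weights.
End CubeGraph.

(** * Weights of the bad traces on a hypercube *)

Section BadCubes.
Variable n : nat.
Hypothesis n_gt1 : (1 < n)%N.
Implicit Types (i : 'I_n) (u v z : cube n) (J t : {set cube n}).

Local Notation odd_part := (@odd_part n).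
Local Notation even_part := (@even_part n).
Local Notation nbrs I := (nbhs_of (@cube_nbhs n I)).

Definition facet i b : {set cube n} := [set z : cube n | z i == b].

Lemma card_flip_half i (A B W : {set cube n}) :
  A :|: B = W -> [disjoint A & B] -> flip i @: A = B -> (#|A| * 2 = #|W|)%N.
Proof.
move=> <- dAB AB; rewrite cardsU (disjoint_setI0 dAB) cards0 subn0 -AB.
by rewrite card_imset ?muln2 ?addnn //; exact: flip_inj.
Qed.

Lemma mem_flip_image i (A : {set cube n}) z : (z \in flip i @: A) = (flip i z \in A).
Proof. exact: (mem_image_invol (@flipK n i)). Qed.

Lemma card_even_part : #|even_part| = (2 ^ n.-1)%N.
Proof.
pose i0 := Ordinal (ltnW n_gt1).
have h := @card_flip_half i0 even_part odd_part setT _ _ _.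
apply/eqP; rewrite -(eqn_pmul2l (_ : 0 < 2)%N) // -expnS prednK; last exact: ltnW.
rewrite mulnC h ?cardsT ?card_cube //.
- by apply/setP => z; rewrite !inE orNb.
- by rewrite -setI_eq0; apply/eqP/setP => z; rewrite !inE andNb.
- by apply/setP => z; rewrite mem_flip_image !inE parity_flip negbK.
Qed.

Lemma card_facet i b : #|facet i b| = (2 ^ n.-1)%N.
Proof.
have h := @card_flip_half i (facet i b) (facet i (~~ b)) setT _ _ _.
apply/eqP; rewrite -(eqn_pmul2l (_ : 0 < 2)%N) // -expnS prednK; last exact: ltnW.
rewrite mulnC h ?cardsT ?card_cube //.
- by apply/setP => z; rewrite !inE; case: (z i); case: (b).
- by rewrite -setI_eq0; apply/eqP/setP => z; rewrite !inE; case: (z i); case: (b).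
- by apply/setP => z; rewrite mem_flip_image !inE flipE eqxx; case: (z i); case: (b).
Qed.

Lemma other_dir i : exists j, j != i.
Proof.
case: (eqVneq i (Ordinal (ltnW n_gt1))) => [->|h]; last by exists (Ordinal (ltnW n_gt1)); rewrite eq_sym.
by exists (Ordinal n_gt1).
Qed.

Lemma card_even_facet i b : #|even_part :&: facet i b| = (2 ^ n.-2)%N.
Proof.
have [j ji] := other_dir i.
have h := @card_flip_half j (even_part :&: facet i b) (odd_part :&: facet i b) (facet i b) _ _ _.
apply/eqP; rewrite -(eqn_pmul2l (_ : 0 < 2)%N) // -expnS (_ : n.-2.+1 = n.-1); last by lia.
rewrite mulnC h ?card_facet //.
- by rewrite setUC odd_evenU.
- by rewrite disjoint_sym odd_even_disjoint.
- apply/setP => z; rewrite mem_flip_image !inE parity_flip negbK flipE (eq_sym i) (negPf ji).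
  by [].
Qed.

Lemma card_odd_facet i b : #|odd_part :&: facet i b| = (2 ^ n.-2)%N.
Proof.
have [j ji] := other_dir i.
rewrite -(card_even_facet i b) -(card_imset _ (@flip_inj n j)); apply: eq_card => z.
by rewrite mem_flip_image !inE parity_flip flipE (eq_sym i) (negPf ji).
Qed.

Section Real.
Variable R : realType.

Lemma hull_excess (K : R) J : J \subset odd_part -> 0 <= K -> K <= 2 ^+ n / 4 ->
  K <= #|J|%:R -> #|nbrs setT J|%:R <= 2 ^+ n / 2 - K ->
  K / (2 * Num.sqrt n%:R) <= (excess (cube_nbhs setT) J)%:R.
Proof.
move=> Jodd K0 Km KJ YK.
pose i0 := Ordinal (ltnW n_gt1).
set N := cube_nbhs setT in YK *.
have Nsym := @cube_nbhs_sym n setT.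
have Nreg := @card_cube_nbhs n setT.
set X := hull N J; set Y := nbhs_of N J.
have Yeven : Y \subset even_part by exact: nbhs_of_odd.
have Xflip : flip i0 @: X \subset Y.
  apply/subsetP => z; rewrite mem_flip_image inE => /subsetP; apply.
  by apply/cube_nbhsP; exists i0; rewrite ?flipK ?inE.
have Xodd : X \subset odd_part.
  apply/subsetP => z zX; have /(subsetP Yeven) : flip i0 z \in Y.
    by apply: (subsetP Xflip); rewrite mem_flip_image flipK.
  by rewrite !inE parity_flip negbK.
pose A := X :|: flip i0 @: X.
have cX : #|flip i0 @: X| = #|X| by rewrite card_imset //; exact: flip_inj.
have cA : #|A| = (2 * #|X|)%N.
  rewrite cardsU cX (_ : X :&: _ = set0) ?cards0 ?subn0 ?mul2n ?addnn //.
  apply/setP => z; rewrite [LHS]inE [RHS]inE; apply/negP => /andP[/(subsetP Xodd) h1].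
  by move=> /(subsetP Xflip)/(subsetP Yeven); move: h1; rewrite !inE => ->.
pose E := Y :\: flip i0 @: X.
have tE : (excess N J)%:R = #|E|%:R :> R.
  by rewrite /excess -/X -/Y /E cardsD (setIidPr Xflip) cX.
have dB : (#|inner_boundary (~: A)| <= 2 * #|E|)%N.
  apply: (@leq_trans #|E :|: flip i0 @: E|); last first.
    apply: leq_trans (leq_card_setU _ _) _.
    by rewrite card_imset ?mul2n ?addnn //; exact: flip_inj.
  apply: subset_leq_card; apply/subsetP => z; rewrite inE in_setC in_setU mem_flip_image negb_or.
  move=> /andP[/andP[zX zfX] /existsP[i]]; rewrite in_setC in_setU mem_flip_image negbK.
  have XY x j : flip j x \in X -> x \in Y.
    rewrite inE => /subsetP; apply.
    by apply/cube_nbhsP; exists j; rewrite ?flipK ?inE.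
  case/orP => [/XY zY|h]; first by rewrite in_setU in_setD mem_flip_image zfX zY.
  rewrite in_setU mem_flip_image !in_setD !mem_flip_image flipK zX /=.
  apply/orP; right; apply: (@XY _ i); move: h; congr (_ \in X).
  by apply/ffunP => j; rewrite !flipE; case: (j == i0); case: (j == i).
have iso := @isoperimetry R n (~: A).
have cBA : #|~: A|%:R = 2 ^+ n - 2 * #|X|%:R :> R.
  have := cardsC A; rewrite card_cube cA => /(congr1 (fun k => k%:R : R)).
  by rewrite natrD natrX natrM => <-; rewrite addrC addKr.
rewrite cBA in iso.
have sn : 0 < Num.sqrt n%:R :> R by rewrite sqrtr_gt0 ltr0n; lia.
rewrite ler_pdivrMr ?mulr_gt0 //.
have dBr : #|inner_boundary (~: A)|%:R <= 2 * #|E|%:R :> R by rewrite -natrM ler_nat.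
have N0 : 0 < 2 ^+ n :> R by rewrite exprn_gt0.
have XJ : #|J|%:R <= #|X|%:R :> R by rewrite ler_nat subset_leq_card // sub_hull.
have XYr : #|X|%:R <= #|Y|%:R :> R.
  by rewrite ler_nat -cX subset_leq_card.
rewrite -(ler_pM2l N0) tE.
have := ler_wpM2l (ltW (mulr_gt0 N0 sn)) dBr.
move: iso YK; rewrite -/Y; move: KJ XJ XYr N0 sn Km K0.
move: (#|X|%:R) (#|Y|%:R) (#|J|%:R) (#|E|%:R) (#|inner_boundary _|%:R) (2 ^+ n) (Num.sqrt n%:R).
move=> x y j e bd M sn Kj jx xy M0 sn0 KM K0 iso yM hb.
have h1 : 0 <= (2 * x - 2 * K) * (M - 2 * K - 2 * x) by apply: mulr_ge0; lra.
have h2 : 0 <= K * (M / 4 - K) by apply: mulr_ge0; lra.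
nra.
Qed.

Definition few (K : R) (P t : {set cube n}) : bool := #|t :&: P|%:R <= K.

(** The second clause makes a good trace reveal its phase on every facet; adjacent cells share a
    facet, hence their phases agree. *)
Definition bad_cube (K : R) : pred {set cube n} := fun t =>
  (~~ few K odd_part t && ~~ few K even_part t) ||
  [exists i, exists b, few K odd_part (t :&: facet i b) && few K even_part (t :&: facet i b)].

Lemma few_sub K P t t' : t \subset t' -> few K P t' -> few K P t.
Proof.
move=> tt'; apply: le_trans; rewrite ler_nat subset_leq_card //.
by rewrite setSI.
Qed.

Lemma good_cube_type K t : ~~ bad_cube K t -> few K odd_part t = ~~ few K even_part t.
Proof.
rewrite negb_or => /andP[h1 h2].
case: (boolP (few K odd_part t)) h1 => ho /=; last by rewrite negbK => ->.
move=> _; apply/esym/negP => he; move/negP: h2; apply.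
apply/existsP; exists (Ordinal n_gt1); apply/existsP; exists true.
by rewrite !(few_sub (subsetIl t _)).
Qed.

Lemma good_cube_facet K t i b : ~~ bad_cube K t ->
  few K odd_part t -> ~~ few K even_part (t :&: facet i b).
Proof.
rewrite negb_or => /andP[_ h2] ho; apply: contra h2 => he.
apply/existsP; exists i; apply/existsP; exists b.
by rewrite he (few_sub (subsetIl t _)).
Qed.

Variables (lam : R).
Hypothesis lam_gt0 : 0 < lam.

(** The edges between the two opposite facets are dropped. The sparse facet is handled by
    [small_sum_le] in each parity class, the other facet by the container bound [C]. *)
Lemma facet_sum_le i b (K s C : R) : 0 <= s ->
  \sum_(J : {set cube n}) lam ^+ #|J| * (1 + lam) ^- #|nbrs (~: [set i]) J| <= C ->
  cube_Z lam (fun t => few K odd_part (t :&: facet i b) && few K even_part (t :&: facet i b)) <=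
  (expR (s * K) * (1 + lam * expR (- s)) ^+ (2 ^ n.-2)) ^+ 2 * ((1 + lam) ^+ (2 ^ n.-2) * C).
Proof.
move=> s0 hC; set f := facet i b; set f' := facet i (~~ b).
have ff' : f :|: f' = setT.
  by apply/setP => z; rewrite !inE; case: (z i); case: (b).
have dff' : [disjoint f & f'].
  by rewrite -setI_eq0; apply/eqP/setP => z; rewrite !inE; case: (z i); case: (b).
pose FF t := few K odd_part t && few K even_part t.
have l0 k : 0 <= lam ^+ k by rewrite exprn_ge0 // ltW.
have step1 : cube_Z lam (fun t => few K odd_part (t :&: f) && few K even_part (t :&: f)) <=
    (\sum_(u : {set cube n} | (u \subset f) && FF u) lam ^+ #|u|) *
    (\sum_(v : {set cube n} | (v \subset f') && indep_in (~: [set i]) v) lam ^+ #|v|).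
  rewrite /cube_Z -[X in X <= _]/(\sum_(t | _) _) big_mkcond /=.
  rewrite (eq_bigl (fun t => t \subset f :|: f')); last by move=> t; rewrite ff' subsetT.
  rewrite sum_sub_setU // mulr_suml big_mkcondr /=; apply: ler_sum => u uf.
  case: ifP => uFF; last first.
    rewrite big1 // => v vf'; have -> : (u :|: v) :&: f = u; last by rewrite -/(FF u) uFF andbF.
    rewrite setIUl (setIidPl uf) (_ : v :&: f = set0) ?setU0 //.
    by apply/eqP; rewrite setI_eq0 disjoint_sym; apply: disjointWr dff'.
  rewrite mulr_sumr big_mkcondr /=; apply: ler_sum => v vf'.
  have uv : u :&: v = set0 by apply/eqP; rewrite setI_eq0; exact: disjointW uf vf' dff'.
  case: ifP => /andP.
    case=> /cube_indep_in ind _; have -> : indep_in (~: [set i]) v.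
      apply/pred0P => z /=; apply/negP => /andP[/nbhs_ofP[y yv /cube_nbhsP[j _ zj]] zv].
      have /pred0P/(_ z)/negP := ind; apply; rewrite /= inE zv orbT andbT.
      by apply/nbhs_ofP; exists y; rewrite ?inE ?yv ?orbT //; apply/cube_nbhsP; exists j.
    by rewrite -exprD cardsU uv cards0 subn0.
  by move=> _; case: ifP => _; rewrite ?mulr0 ?mulr_ge0.
apply: le_trans step1 _.
apply: ler_pM; rewrite ?sumr_ge0 //.
  apply: le_trans (_ : (\sum_(a : {set cube n} | (a \subset odd_part :&: f) && (#|a|%:R <= K)) lam ^+ #|a|) *
    (\sum_(a : {set cube n} | (a \subset even_part :&: f) && (#|a|%:R <= K)) lam ^+ #|a|) <= _).
    rewrite big_mkcondr /= -{1}(odd_evenU f) sum_sub_setU ?odd_even_disjoint //.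
    rewrite mulr_suml big_mkcondr /=; apply: ler_sum => u uo.
    have uE : u :&: odd_part = u by apply/setIidPl; apply: subset_trans uo (subsetIl _ _).
    have uE' : u :&: even_part = set0.
      by apply/setP => z; rewrite -uE !inE -andbA andbN andbF.
    case: ifP => uK; last first.
      rewrite big1 // => v ve; case: ifP => // /andP[h _]; move: uK; rewrite -uE.
      by move=> /negP; case; apply: le_trans h; rewrite ler_nat subset_leq_card // setSI // subsetUl.
    rewrite mulr_sumr [leRHS]big_mkcondr /=; apply: ler_sum => v ve.
    have vE : v :&: even_part = v by apply/setIidPl; apply: subset_trans ve (subsetIl _ _).
    case: ifP => [/andP[_ h]|_]; last by case: ifP => _; rewrite ?mulr_ge0.
    have -> : #|v|%:R <= K.
      by rewrite -vE; apply: le_trans h; rewrite ler_nat subset_leq_card // setSI // subsetUr.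
    rewrite -exprD cardsU (_ : u :&: v = set0) ?cards0 ?subn0 //.
    by rewrite -vE setIA [u :&: v]setIC -setIA uE' setI0.
  rewrite expr2; apply: ler_pM; rewrite ?sumr_ge0 //.
    by rewrite -(card_odd_facet i b); apply: small_sum_le.
  by rewrite -(card_even_facet i b); apply: small_sum_le.
rewrite -(card_even_facet i (~~ b)).
apply: le_trans (indep_sum_le lam_gt0 (P := predT) (Q := predT) (I := ~: [set i]) (W := f') (b := C) _ _ _).
- by rewrite le_eqVlt; apply/orP; left; apply/eqP; apply: eq_bigl => v; rewrite andbT.
- by move=> z j; rewrite !inE flipE => zf ji; rewrite (eq_sym i) (negPf ji).
- by [].
- exact: hC.
Qed.

Lemma cube_Z_le (C : R) :
  \sum_(J : {set cube n}) lam ^+ #|J| * (1 + lam) ^- #|nbrs setT J| <= C ->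
  cube_Z (d := n) lam predT <= (1 + lam) ^+ (2 ^ n.-1) * C.
Proof.
move=> hC; rewrite -card_even_part (_ : #|even_part| = #|even_part :&: setT|); last by rewrite setIT.
apply: le_trans (indep_sum_le lam_gt0 (P := predT) (Q := predT) (I := setT) (W := setT) (b := C) _ _ hC) => //; last by move=> z j _ _; rewrite inE.
rewrite /cube_Z big_mkcond [leRHS]big_mkcond; apply: ler_sum => t _.
rewrite subsetT !andbT; case: ifP => [/cube_indep_in -> //|_].
by case: ifP => // _; rewrite exprn_ge0 // ltW.
Qed.

(** The even points avoid the neighbourhood of the odd ones. Having more than [K] of each therefore
    leaves room in that neighbourhood, and [hull_excess] makes the excess at least K / (2 sqrt n);
    the factor expR (kappa * excess) turns this into a gain. *)
Lemma mixed_sum_le (K C kappa : R) : 0 <= K -> K <= 2 ^+ n / 4 -> 0 <= kappa ->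
  \sum_(J : {set cube n}) lam ^+ #|J| * (1 + lam) ^- #|nbrs setT J|
      * expR (kappa * (excess (cube_nbhs setT) J)%:R) <= C ->
  cube_Z lam (fun t => ~~ few K odd_part t && ~~ few K even_part t) <=
  (1 + lam) ^+ (2 ^ n.-1) * (expR (- (kappa * (K / (2 * Num.sqrt n%:R)))) * C).
Proof.
move=> K0 Km k0 hC; rewrite -card_even_part (_ : #|even_part| = #|even_part :&: setT|); last by rewrite setIT.
have lam1 : 0 < 1 + lam by have := lam_gt0; lra.
pose Q (J : {set cube n}) := [&& J \subset odd_part, K <= #|J|%:R & #|nbrs setT J|%:R <= 2 ^+ n / 2 - K].
set b := _ * C.
have hb : \sum_(J : {set cube n} | Q J) lam ^+ #|J| * (1 + lam) ^- #|nbrs setT J| <= b.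
  rewrite /b -ler_pdivrMl ?expR_gt0 // -expRN opprK; apply: le_trans hC.
  rewrite mulr_sumr big_mkcond; apply: ler_sum => J _.
  case: ifP => [/and3P[h1 h2 h3]|_]; last first.
    by rewrite !mulr_ge0 ?invr_ge0 ?exprn_ge0 ?expR_ge0 // ltW.
  rewrite mulrC ler_wpM2l ?mulr_ge0 ?invr_ge0 ?exprn_ge0 ?(ltW lam_gt0) ?(ltW lam1) //.
  by rewrite ler_expR ler_wpM2l // hull_excess.
apply: le_trans (indep_sum_le lam_gt0 (I := setT) (W := setT)
  (P := fun t => ~~ few K odd_part t && ~~ few K even_part t) _ _ hb).
  rewrite /cube_Z big_mkcond [leRHS]big_mkcond; apply: ler_sum => t _.
  rewrite subsetT; case: ifP => [/andP[/cube_indep_in -> ->] //|_].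
  by case: ifP => // _; rewrite exprn_ge0 // ltW.
  by move=> z j _ _; rewrite inE.
move=> J E; rewrite !setIT => Jo; rewrite subsetD => /andP[Ee dE].
have JE : (J :|: E) :&: odd_part = J.
  rewrite setIUl (setIidPl Jo) (_ : E :&: _ = set0) ?setU0 //.
  by apply/setP => z; rewrite !inE; apply/negP => /andP[/(subsetP Ee)]; rewrite inE => /negP.
have JE' : (J :|: E) :&: even_part = E.
  rewrite setIUl (setIidPl Ee) (_ : J :&: _ = set0) ?set0U //.
  by apply/setP => z; rewrite !inE; apply/negP => /andP[/(subsetP Jo)]; rewrite inE => ->.
rewrite /few JE JE' -!ltNge => /andP[/ltW KJ /ltW KE].
rewrite /Q Jo KJ /=.
have : (#|nbrs setT J| + #|E| <= 2 ^ n.-1)%N.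
  rewrite -card_even_part -[X in (_ + X <= _)%N]addn0 addnA.
  have := cardsUI (nbrs setT J) E.
  have -> : nbrs setT J :&: E = set0 by apply/eqP; rewrite setI_eq0 disjoint_sym.
  rewrite cards0 !addn0 => <-; apply: subset_leq_card; rewrite subUset Ee andbT.
  exact: nbhs_of_odd.
rewrite -(ler_nat R) natrD natrX => h.
have -> : 2 ^+ n / 2 = 2 ^+ n.-1 :> R.
  by rewrite -{1}(prednK (ltnW n_gt1)) exprS mulrC mulKf.
lra.
Qed.

Lemma bad_cube_Z_le (K : R) :
  cube_Z lam (bad_cube K) <=
    cube_Z lam (fun t => ~~ few K odd_part t && ~~ few K even_part t) +
    \sum_i \sum_(b : bool) cube_Z lam
      (fun t => few K odd_part (t :&: facet i b) && few K even_part (t :&: facet i b)).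
Proof.
have l0 k : 0 <= lam ^+ k by rewrite exprn_ge0 // ltW.
rewrite /cube_Z big_mkcond /= [X in _ <= X + _]big_mkcond /=.
pose h i (b : bool) (t : {set cube n}) : R := if cube_indep t && (few K odd_part (t :&: facet i b) && few K even_part (t :&: facet i b)) then lam ^+ #|t| else 0.
have h0 i b t : 0 <= h i b t by rewrite /h; case: ifP.
have -> : \sum_i \sum_(b : bool) \sum_(t | cube_indep t && (few K odd_part (t :&: facet i b) && few K even_part (t :&: facet i b))) lam ^+ #|t| = \sum_t \sum_i \sum_(b : bool) h i b t.
  rewrite [RHS]exchange_big /=; apply: eq_bigr => i _; rewrite [RHS]exchange_big /=.
  by apply: eq_bigr => b _; rewrite big_mkcond.
rewrite -big_split /=; apply: ler_sum => t _.
case: ifP => [/andP[it /orP[mt|/existsP[i /existsP[b fb]]]]|_].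
- by rewrite it mt lerDl !sumr_ge0 // => i _; rewrite sumr_ge0.
- rewrite -[leLHS]add0r lerD //; first by case: ifP.
  rewrite (bigD1 i) //= -[leLHS]addr0 lerD //; last first.
    by rewrite sumr_ge0 // => j _; rewrite sumr_ge0.
  rewrite (bigD1 b) //= -[leLHS]addr0 lerD // ?sumr_ge0 //.
  by rewrite /h it fb.
- by rewrite addr_ge0 ?sumr_ge0 // => [|i _]; [case: ifP | rewrite sumr_ge0].
Qed.

End Real.
End BadCubes.

(** * Choice of the constants on a hypercube *)

Section CubeBound.
Variables (R : realType) (n : nat) (lam : R).
Hypothesis lam_gt0 : 0 < lam.
Local Notation N := (n%:R : R).
Local Notation L := (ln N).
Local Notation M := (2 ^+ n : R).

Definition act : R := Num.min lam 1.
Local Notation th := act.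

Hypothesis L_ge : (20 * 100) <= L.
Hypothesis th_large : L ^+ 6 <= th ^+ 3 * N.
Hypothesis M_large : N ^+ 3 <= M.

Lemma act_gt0 : 0 < th. Proof. by rewrite /act lt_min lam_gt0 ltr01. Qed.
Lemma act_le1 : th <= 1. Proof. by rewrite /act ge_min lexx orbT. Qed.
Lemma act_le : th <= lam. Proof. by rewrite /act ge_min lexx. Qed.

Lemma N_gt0 : 0 < N.
Proof. by rewrite ltNge; apply/negP => /ln0 h; move: L_ge; rewrite h; lra. Qed.

Lemma N_large : (20 * 100) <= N.
Proof.
apply: le_trans L_ge _; have := ln_sublinear N_gt0; exact: ltW.
Qed.

Lemma n_gt1 : (1 < n)%N.
Proof. by rewrite -(ltr_nat R); have := N_large; lra. Qed.

Lemma expR_le_lin (x : R) : 0 <= x -> x <= 2^-1 -> expR x <= 1 + 2 * x.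
Proof.
move=> x0 x1; have h := expR_ge1Dx (- x).
have e : expR x * expR (- x) = 1 by rewrite -expRD subrr expR0.
have p := expR_gt0 x; have : expR x * (1 - x) <= 1 by rewrite -[leRHS]e ler_pM2l.
nra.
Qed.

Lemma ln1_act : th / 2 <= ln (1 + lam).
Proof.
have t0 := act_gt0; have t1 := act_le1; have tl := act_le.
rewrite -ler_expR lnK ?posrE; last by lra.
apply: le_trans (expR_le_lin _ _) _; lra.
Qed.

Lemma expR_3L : expR (- (3 * L)) = N ^- 3.
Proof. by rewrite expRN expRM_natl lnK // posrE; exact: N_gt0. Qed.

Definition kappa0 : R := th ^+ 2 / ((2 * 100) * L).
(** The value of [container_sum] for ell = 3 L: the sample accounts for 75 units of L^2 M / N^2, the
    sum over the fingerprints for less than one. *)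
Definition C0 : R := 2 * expR (76 * (L ^+ 2 * M / N ^+ 2)).

Lemma kappa0_ge0 : 0 <= kappa0.
Proof. by rewrite divr_ge0 ?sqr_ge0 //; have := L_ge; lra. Qed.

Lemma numeric_B (psi : R) : th * N / ((4 * 96) * L) <= psi ->
  3 * L * (24 * L / N ^+ 2 * N + 4 / psi) <= th ^+ 2 / ((10 * 100) * L).
Proof.
move=> hpsi; have t0 := act_gt0; have t1 := act_le1; have N0 := N_gt0.
have L0 : 0 < L by have := L_ge; lra.
have q0 : 0 < th * N / ((4 * 96) * L) by rewrite divr_gt0 ?mulr_gt0 //; lra.
have e1 : 4 / psi <= (16 * 96) * L / (th * N).
  have -> : (16 * 96) * L / (th * N) = 4 / (th * N / ((4 * 96) * L)).
    by field; rewrite !gt_eqF.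
  by rewrite ler_pM2l // lef_pV2 // posrE // (lt_le_trans q0).
have e2 : 24 * L / N ^+ 2 * N <= 24 * L / (th * N).
  have -> : 24 * L / N ^+ 2 * N = 24 * L / N by field; rewrite gt_eqF.
  rewrite ler_pM2l; last by lra.
  by rewrite lef_pV2 ?posrE ?mulr_gt0 // ler_piMl // ltW.
apply: le_trans (_ : 3 * L * ((20 * 78) * L / (th * N)) <= _).
  rewrite ler_pM2l; last by lra.
  have -> : (20 * 78) * L / (th * N) = 24 * L / (th * N) + (16 * 96) * L / (th * N) by field; rewrite !gt_eqF.
  exact: lerD.
have -> : 3 * L * ((20 * 78) * L / (th * N)) = (60 * 78) * L ^+ 2 / (th * N) by field; rewrite !gt_eqF.
rewrite ler_pdivrMr ?mulr_gt0 // [leRHS]mulrAC ler_pdivlMr; last by lra.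
have -> : th ^+ 2 * (th * N) = th ^+ 3 * N by ring.
apply: le_trans th_large.
have -> : L ^+ 6 = L ^+ 3 * L ^+ 3 by ring.
have -> : (60 * 78) * L ^+ 2 * ((10 * 100) * L) = (60 * 78 * (10 * 100)) * L ^+ 3 by ring.
rewrite ler_pM2r ?exprn_gt0 //.
have : (20 * 100) ^+ 3 <= L ^+ 3 by rewrite lerXn2r ?nnegrE //; lra.
lra.
Qed.

Lemma cube_container (I : {set 'I_n}) : (n <= #|I| + 1)%N ->
  \sum_(J : {set cube n}) lam ^+ #|J| * (1 + lam) ^- #|nbhs_of (cube_nbhs I) J|
     * expR (kappa0 * (excess (cube_nbhs I) J)%:R) <= C0.
Proof.
move=> In; set D := #|I| in In.
have t0 := act_gt0; have t1 := act_le1; have N0 := N_gt0; have NL := N_large.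
have L0 : (20 * 100) <= L := L_ge.
have Lp : 0 < L by lra.
have DN : D%:R <= N by rewrite ler_nat -[leqRHS]card_ord max_card.
have ND : N - 1 <= D%:R by have := In; rewrite -(ler_nat R) natrD; lra.
have D0 : (0 < D)%N by rewrite -(ltr_nat R); lra.
(* The constant 48 makes 3 L (2 g) equal to th / 8, a quarter of the lower bound th / 2 for ln (1 +
   lam). *)
pose g : R := th / (48 * L).
have g0 : 0 < g by rewrite divr_gt0 //; lra.
have g1 : g <= 1 by rewrite ler_pdivrMr; lra.
have gN : 10 <= g * N.
  rewrite /g [leRHS]mulrAC ler_pdivlMr; last by lra.
  have h1 : th ^+ 3 * N <= th * N.
    by rewrite ler_pM2r // exprS ler_piMr ?(ltW t0) // expr_le1 // ltW.
  apply: le_trans h1; apply: le_trans th_large.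
  have h2 : L <= L ^+ 5 by rewrite [leRHS]exprS ler_peMr ?exprn_ege1 //; lra.
  have -> : L ^+ 6 = L * L ^+ 5 by ring.
  have -> : 10 * (48 * L) = L * 480 by ring.
  by rewrite ler_pM2l //; lra.
(* The largest integer allowed by 4 psi <= g D when D = n - 1, the degree inside a facet; a large
   [psi] makes the greedy corrections cheap. *)
pose psi := Num.truncn (g * (N - 1) / 4).
have psi_le : psi%:R <= g * (N - 1) / 4.
  by rewrite truncn_le // divr_ge0 // mulr_ge0 ?(ltW g0) //; lra.
have psi_ge : g * N / 8 <= psi%:R.
  have : g * (N - 1) / 4 < psi.+1%:R by rewrite truncnS_gt.
  by rewrite -(natr1 psi); lra.
have psi0 : (0 < psi)%N by rewrite -(ltr_nat R); lra.
have psiD : (2 * psi <= D)%N.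
  rewrite -(ler_nat R) natrM; have : g * (N - 1) <= N - 1 by rewrite ler_piMl //; lra.
  lra.
have psig : (4 * psi)%:R <= g * D%:R.
  by rewrite natrM; have := ler_wpM2l (ltW g0) ND; lra.
(* With this density p D (D - 1) / 4 >= 2 L, so a vertex is missed with probability at most 1 /
   n^2. *)
pose p : R := 24 * L / N ^+ 2.
have p01 : 0 <= p <= 1.
  rewrite /p divr_ge0 ?exprn_ge0 //=; last by lra.
  rewrite ler_pdivrMr ?exprn_gt0 // mul1r expr2.
  have : L <= N by apply: ltW; exact: ln_sublinear.
  nra.
have B : 3 * L * (p * D%:R + 4 / psi%:R) <= th ^+ 2 / ((10 * 100) * L).
  apply: le_trans (numeric_B (psi := psi%:R) _).
    rewrite ler_pM2l; last by lra.
    by rewrite lerD2r ler_wpM2l //; case/andP: p01.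
  apply: le_trans psi_ge; rewrite /g le_eqVlt; apply/orP; left; apply/eqP.
  by field; rewrite gt_eqF.
have l0 := ln1_act.
have thL : th ^+ 2 / L <= th / (20 * 100).
  rewrite ler_pdivrMr // [leRHS]mulrAC ler_pdivlMr // expr2 -mulrA ler_pM2l //.
  by apply: le_trans L0; lra.
have c1 : 3 * L * (p * D%:R + 4 / psi%:R) + kappa0 <= g * ln (1 + lam).
  apply: le_trans (lerD B (lexx _)) _.
  apply: le_trans (_ : g * (th / 2) <= _); last by rewrite ler_pM2l.
  rewrite /kappa0 /g.
  have -> : th / (48 * L) * (th / 2) = th ^+ 2 / L * (1 / 96) by field; rewrite gt_eqF.
  have -> : th ^+ 2 / ((10 * 100) * L) + th ^+ 2 / ((2 * 100) * L) = th ^+ 2 / L * (6 / (10 * 100)) by field; rewrite gt_eqF.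
  rewrite ler_wpM2l ?divr_ge0 ?sqr_ge0 //; lra.
have c2 : 3 * L * (p * D%:R + 4 / psi%:R + 2 * g) + kappa0 <= ln (1 + lam).
  rewrite mulrDr.
  have -> : 3 * L * (2 * g) = th / 8 by rewrite /g; field; rewrite gt_eqF.
  have k : kappa0 = th ^+ 2 / L / (2 * 100) by rewrite /kappa0; field; rewrite gt_eqF.
  have B' : th ^+ 2 / ((10 * 100) * L) = th ^+ 2 / L / (10 * 100) by field; rewrite gt_eqF.
  by rewrite k; rewrite B' in B; lra.
(* The price ell = 3 L makes expR (- ell) equal to 1 / n^3, so the number of possible fingerprints
   hardly matters. *)
have L3 : 0 <= 3 * L by lra.
have := container_sum (@cube_nbhs_sym n I) (@card_cube_nbhs n I) (@cube_codegree n I) D0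
  lam_gt0 L3 p01 (ltW g0) psi0 psiD psig c1 c2.
move/le_trans; apply; rewrite -mulrA -expRD /C0 ler_pM2l // ler_expR.
rewrite card_cube natrX expR_3L.
have M0 : 0 < M by rewrite exprn_gt0.
have e1 : expR (- (p * (D * (D - 1))%:R / 4)) <= N ^- 2.
  have -> : N ^- 2 = expR (- (2 * L)) by rewrite expRN expRM_natl lnK // posrE.
  rewrite ler_expR lerN2 natrM natrB //.
  have : (N - 1) * (N - 2) <= D%:R * (D%:R - 1) by apply: ler_pM; lra.
  have : N ^+ 2 / 3 <= (N - 1) * (N - 2) by nra.
  move=> h1 h2; rewrite ler_pdivlMr // /p [leRHS]mulrAC ler_pdivlMr ?exprn_gt0 //.
  have -> : 2 * L * 4 * N ^+ 2 = 24 * L * (N ^+ 2 / 3) by field.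
  by rewrite ler_wpM2l //; lra.
have e2 : p * M + M * expR (- (p * (D * (D - 1))%:R / 4)) <= 25 * (L * M / N ^+ 2).
  apply: le_trans (_ : p * M + M * N ^- 2 <= _); first by rewrite lerD2l ler_pM2l.
  have -> : p * M + M * N ^- 2 = (24 * L + 1) * (M / N ^+ 2) by rewrite /p; field; rewrite gt_eqF.
  have -> : 25 * (L * M / N ^+ 2) = (25 * L) * (M / N ^+ 2) by field; rewrite gt_eqF.
  by rewrite ler_pM2r ?divr_gt0 ?exprn_gt0 //; lra.
have e3 := ler_wpM2l L3 e2.
apply: le_trans (lerD e3 (lexx _)) _.
have -> : 3 * L * (25 * (L * M / N ^+ 2)) = 75 * (L ^+ 2 * M / N ^+ 2) by field; rewrite gt_eqF.
have -> : 6 * M * N ^- 3 = (6 / N) * (M / N ^+ 2) by field; rewrite gt_eqF.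
have -> : 76 * (L ^+ 2 * M / N ^+ 2) = 75 * (L ^+ 2 * M / N ^+ 2) + L ^+ 2 * (M / N ^+ 2) by field; rewrite gt_eqF.
rewrite lerD2l ler_pM2r ?divr_gt0 ?exprn_gt0 //.
apply: le_trans (_ : 1 <= _); first by rewrite ler_pdivrMr // mul1r; lra.
by rewrite expr2; nra.
Qed.

Definition K0 : R := th / (2 * 100) * M.
(** Half the exponent kappa0 K0 / (2 sqrt n) of [mixed_sum_le]; [kappa0] contributes th^2 and [K0]
    the third factor. *)
Definition G0 : R := th ^+ 3 * M / ((4 * 100 * (4 * 100)) * L * Num.sqrt N).
(** The 76 units of [C0] and three more, which absorb the factor 3 * 2 in front of the
    exponential. *)
Definition eta0 : R := 79 * (L ^+ 2 * M / N ^+ 2).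

Lemma G0_ge0 : 0 <= G0.
Proof.
rewrite divr_ge0 ?mulr_ge0 ?exprn_ge0 ?sqrtr_ge0 ?(ltW act_gt0) //.
by have := L_ge; lra.
Qed.

(** The parameter s = 3 + ln (1 + lam) makes lam * expR (- s) at most ln (1 + lam) / 8. A sparse
    facet then weighs much less than (1 + lam)^(2^(n-2)), the weight it would have in a pure
    phase. *)
Lemma facet_numeric :
  (expR ((3 + ln (1 + lam)) * K0) *
     (1 + lam * expR (- (3 + ln (1 + lam)))) ^+ (2 ^ n.-2)) ^+ 2 * (1 + lam) ^+ (2 ^ n.-2)
  <= (1 + lam) ^+ (2 ^ n.-1) * expR (- (M * th / 20)).
Proof.
have t0 := act_gt0; have t1 := act_le1; have tl := act_le; have l0 := ln1_act.
have lam1 : 0 < 1 + lam by have := lam_gt0; lra.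
set l := ln (1 + lam) in l0 *.
have le : 1 + lam = expR l by rewrite lnK.
have x0 : 0 <= lam * expR (- (3 + l)) by rewrite mulr_ge0 ?expR_ge0 // ltW.
have x1 : 1 + lam * expR (- (3 + l)) <= expR (l / 8).
  apply: le_trans (expR_ge1Dx _) _; rewrite ler_expR.
  have : expR (- 3) <= 1 / 8 :> R.
    rewrite expRN -[3]mulr1 expRM_natl.
    have : 2 <= expR 1 :> R by have := @expR_ge1Dx R 1; lra.
    move=> e2; rewrite div1r lef_pV2 ?posrE ?exprn_gt0 ?expR_gt0 //.
    have : 2 ^+ 3 <= expR 1 ^+ 3 :> R by rewrite lerXn2r ?nnegrE ?expR_ge0.
    lra.
  move=> e3; rewrite opprD expRD.
  have e4 : lam * expR (- l) <= l.
    have : 1 - l <= expR (- l) by exact: expR_ge1Dx.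
    have e5 : expR l * expR (- l) = 1 by rewrite -expRD subrr expR0.
    rewrite -le in e5; have -> : lam * expR (- l) = 1 - expR (- l) by rewrite -e5; ring.
    lra.
  have e6 : 0 <= lam * expR (- l) by rewrite mulr_ge0 ?expR_ge0 // ltW.
  have := ler_wpM2l e6 e3; lra.
have mE : (2 ^ n.-1)%:R = M / 2 :> R.
  by rewrite natrX -{2}(prednK (ltnW n_gt1)) exprS mulrC mulKf.
have mE2 : (2 ^ n.-2)%:R = M / 4 :> R.
  have -> : M / 4 = (2 ^ n.-1)%:R / 2 by rewrite mE; field.
  have n1 : (0 < n.-1)%N by rewrite -subn1 subn_gt0; exact: n_gt1.
  by rewrite !natrX -{2}(prednK n1) exprS mulrC mulKf.
apply: le_trans (_ : (expR ((3 + l) * K0) * expR (l / 8) ^+ (2 ^ n.-2)) ^+ 2 * (1 + lam) ^+ (2 ^ n.-2) <= _).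
  rewrite ler_wpM2r ?exprn_ge0 ?(ltW lam1) // lerXn2r ?nnegrE ?mulr_ge0 ?exprn_ge0 ?expR_ge0 //.
    by rewrite addr_ge0.
  by rewrite ler_wpM2l ?expR_ge0 // lerXn2r ?nnegrE ?expR_ge0 // addr_ge0.
rewrite le -!expRM_natl -expRD -expRM_natl -!expRD ler_expR mE mE2 /K0.
have M0 : 0 < M by rewrite exprn_gt0.
have h : (3 + l) * th / 100 + l / 16 + l / 4 <= l / 2 - th / 20.
  have : l * th <= l by rewrite ler_piMr //; lra.
  lra.
have := ler_wpM2l (ltW M0) h; lra.
Qed.

Theorem cube_bound :
  cube_Z (d := n) lam predT + expR G0 * cube_Z lam (bad_cube (n := n) K0) <=
  (1 + lam) ^+ (2 ^ n.-1) * expR eta0.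
Proof.
have t0 := act_gt0; have t1 := act_le1; have tl := act_le; have l0 := ln1_act.
have lam1 : 0 < 1 + lam by have := lam_gt0; lra.
have N0 := N_gt0; have NL := N_large; have Lp : 0 < L by have := L_ge; lra.
have M0 : 0 < M by rewrite exprn_gt0.
have C0p : 0 < C0 by rewrite mulr_gt0 ?expR_gt0.
have n1 := n_gt1.
set H := (1 + lam) ^+ (2 ^ n.-1); have H0 : 0 < H by rewrite exprn_gt0.
have plain (I : {set 'I_n}) : (n <= #|I| + 1)%N ->
   \sum_(J : {set cube n}) lam ^+ #|J| * (1 + lam) ^- #|nbhs_of (cube_nbhs I) J| <= C0.
  move=> In; apply: le_trans (cube_container In); apply: ler_sum => J _.
  rewrite -[leLHS]mulr1 ler_wpM2l ?mulr_ge0 ?invr_ge0 ?exprn_ge0 ?(ltW lam1) ?(ltW lam_gt0) //.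
  by rewrite -[leLHS](expR0 R) ler_expR mulr_ge0 // kappa0_ge0.
have cT : (n <= #|[set: 'I_n]| + 1)%N by rewrite cardsT card_ord addn1.
have cF i : (n <= #|~: [set i : 'I_n]| + 1)%N.
  by have := cardsC [set i]; rewrite cards1 card_ord addnC => ->.
have b1 : cube_Z (d := n) lam predT <= H * C0 by apply: cube_Z_le => //; exact: plain.
have K0_ge0 : 0 <= K0 by rewrite mulr_ge0 ?divr_ge0 ?(ltW t0) // ltW.
have K0_le : K0 <= M / 4 by rewrite /K0 mulrC ler_pM2l //; lra.
have b2 := mixed_sum_le n1 lam_gt0 K0_ge0 K0_le kappa0_ge0 (cube_container cT).
have kG : kappa0 * (K0 / (2 * Num.sqrt N)) = 2 * G0.
  have s0 : 0 < Num.sqrt N by rewrite sqrtr_gt0.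
  by rewrite /kappa0 /K0 /G0; field; rewrite !gt_eqF.
rewrite kG -/H in b2.
have s0 : 0 <= 3 + ln (1 + lam) by lra.
have b3 i b : cube_Z lam (fun t => few K0 (@odd_part n) (t :&: facet i b) && few K0 (@even_part n) (t :&: facet i b))
    <= H * expR (- (M * th / 20)) * C0.
  apply: le_trans (facet_sum_le n1 lam_gt0 b K0 s0 (plain _ (cF i))) _.
  by rewrite mulrA ler_pM2r // facet_numeric.
have b4 := bad_cube_Z_le n lam_gt0 K0.
have b5 : cube_Z lam (bad_cube (n := n) K0) <= H * C0 * (expR (- (2 * G0)) + 2 * N * expR (- (M * th / 20))).
  apply: le_trans b4 _; apply: le_trans (lerD b2 (ler_sum _ (fun i _ => ler_sum _ (fun b _ => b3 i b)))) _.
  have s2 (x : R) : \sum_(i < n) \sum_(b : bool) x = 2 * N * x.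
    by rewrite sumr_const card_ord big_bool -[LHS]mulr_natl /=; ring.
  by rewrite s2 le_eqVlt; apply/orP; left; apply/eqP; ring.
have G_le : G0 <= M * th / 40.
  rewrite /G0 ler_pdivrMr; last by rewrite !mulr_gt0 ?sqrtr_gt0 //; lra.
  have h1 : th ^+ 3 * M <= th * M.
    by rewrite ler_pM2r // exprS ler_piMr ?(ltW t0) // expr_le1 // ltW.
  apply: le_trans h1 _; have Mt : 0 < th * M by rewrite mulr_gt0.
  have : 1 <= Num.sqrt N by rewrite -[leLHS]sqrtr1 ler_sqrt ?ler0n //; lra.
  have := L_ge; move: (Num.sqrt N) => r h2 h3.
  have h4 : 1 <= (40 * 100) * L * r by nra.
  have -> : M * th / 40 * ((4 * 100 * (4 * 100)) * L * r) = th * M * ((40 * 100) * L * r) by field.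
  by rewrite ler_peMr // ltW.
(* The number 2 n of facets and the bonus expR G0 each use up half of the exponent M th / 20. *)
have n_le : 2 * N <= expR (M * th / 40).
  apply: le_trans (expR_ge1Dx _).
  have thN : 1 <= th * N.
    have : th ^+ 3 * N <= th * N.
      by rewrite ler_pM2r // exprS ler_piMr ?(ltW t0) // expr_le1 // ltW.
    apply: le_trans; apply: le_trans th_large; apply: exprn_ege1.
    by have := L_ge; lra.
  have : N ^+ 2 <= M * th.
    apply: le_trans (_ : N ^+ 3 * th <= _); last by rewrite ler_pM2r.
    have -> : N ^+ 3 * th = N ^+ 2 * (th * N) by ring.
    by rewrite ler_peMr // exprn_ge0 // ltW.
  by rewrite expr2; nra.
have b6 : expR G0 * (expR (- (2 * G0)) + 2 * N * expR (- (M * th / 20))) <= 2.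
  rewrite mulrDr.
  have : expR G0 * expR (- (2 * G0)) <= 1.
    rewrite -expRD -[leRHS](expR0 R) ler_expR; have := G0_ge0; lra.
  have : expR G0 * (2 * N * expR (- (M * th / 20))) <= 1.
    apply: le_trans (_ : expR (M * th / 40) * (expR (M * th / 40) * expR (- (M * th / 20))) <= _).
      by rewrite ler_pM ?expR_ge0 ?mulr_ge0 ?expR_ge0 ?ler_expR ?(ltW N0) // ler_pM2r ?expR_gt0.
    by rewrite -!expRD -[leRHS](expR0 R) ler_expR; lra.
  lra.
apply: le_trans (_ : H * C0 + H * C0 * 2 <= _).
  apply: lerD => //; apply: le_trans (ler_wpM2l (expR_ge0 G0) b5) _.
  by rewrite mulrCA ler_pM2l // mulr_gt0.
have -> : H * C0 + H * C0 * 2 = H * (3 * C0) by ring.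
rewrite ler_pM2l // /C0 /eta0.
have -> : 79 * (L ^+ 2 * M / N ^+ 2) = 3 * (L ^+ 2 * M / N ^+ 2) + 76 * (L ^+ 2 * M / N ^+ 2) by ring.
rewrite expRD mulrA ler_pM2r ?expR_gt0 //.
have Y : 6 <= L ^+ 2 * M / N ^+ 2.
  rewrite ler_pdivlMr ?exprn_gt0 //.
  have : N ^+ 2 <= M.
    by apply: le_trans M_large; rewrite [leRHS]exprS ler_peMl ?exprn_ge0 ?(ltW N0) //; lra.
  have : 6 <= L ^+ 2 by have := L_ge; rewrite expr2; nra.
  move=> h1 h2; have := exprn_gt0 2 N0; nra.
by apply: le_trans (expR_ge1Dx _); lra.
Qed.

End CubeBound.

(** * Blocks of cells *)

Section Blocks.
Variables (R : realType) (n q k : nat).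
Hypothesis qk : q.+2 = (2 ^ k.+1)%N.
Hypothesis n_gt1 : (1 < n)%N.
Variable K : R.
Local Notation torus := (torus n q).
Local Notation M := (2 ^+ n : R).
Implicit Types (x v : torus) (i : 'I_n) (y z : cube n) (s : {set torus}).

Definition shift i x : torus := upd i (x i + 1) x.

Definition bad_cell s x : bool := bad_cube K (pattern x s).
Definition even_cell s x : bool := ~~ bad_cell s x && few K (@odd_part n) (pattern x s).
Definition odd_cell s x : bool := ~~ bad_cell s x && few K (@even_part n) (pattern x s).

Lemma cell_cases s x : [|| bad_cell s x, even_cell s x | odd_cell s x].
Proof.
rewrite /even_cell /odd_cell; case: (boolP (bad_cell s x)) => //= /(good_cube_type n_gt1) ->.
by case: (few _ _ _).
Qed.

Lemma even_odd_cell s x : even_cell s x -> odd_cell s x -> False.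
Proof.
move=> /andP[/(good_cube_type n_gt1) h]; rewrite h => e /andP[_ o].
by rewrite o in e.
Qed.

(** The cells [x] and [shift i x] share the facet at coordinate x i + 1, whose parity label is
    opposite to that of x i. *)
Lemma pattern_shift_facet s x i :
  pattern x s :&: facet i (~~ odd (val (x i))) = pattern (shift i x) s :&: facet i (~~ odd (val (x i))).
Proof.
apply/setP => z; rewrite !inE; case: eqP => zi; last by rewrite !andbF.
rewrite !andbT; congr (_ \in s); apply/ffunP => j; rewrite !ffunE.
case: (eqVneq j i) => [->|//]; rewrite /endpoint (odd_succZ qk) zi eqxx.
by case: (odd (val (x i))).
Qed.

Lemma even_odd_shift s x i : even_cell s x -> odd_cell s (shift i x) -> False.
Proof.
move=> /andP[bx ex] /andP[bx' ox']; have := good_cube_facet i (~~ odd (val (x i))) bx ex.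
by rewrite pattern_shift_facet => /negP; apply; apply: few_sub ox'; exact: subsetIl.
Qed.

Lemma odd_even_shift s x i : odd_cell s x -> even_cell s (shift i x) -> False.
Proof.
move=> /andP[bx ox] /andP[bx' ex']; have := good_cube_facet i (~~ odd (val (x i))) bx' ex'.
by rewrite -pattern_shift_facet => /negP; apply; apply: few_sub ox; exact: subsetIl.
Qed.

Definition bad_block_cells s x : {set cube n} := [set y | bad_cell s (translate x y)].
Definition even_block_cells s x : {set cube n} := [set y | even_cell s (translate x y)].
Definition odd_block_cells s x : {set cube n} := [set y | odd_cell s (translate x y)].

Definition coarse_bad s x : bool :=
  M / (100 * Num.sqrt n%:R) <= #|bad_block_cells s x|%:R.
Definition coarse_even s x : bool := M / 2 < #|even_block_cells s x|%:R.
Definition coarse_odd s x : bool := M / 2 < #|odd_block_cells s x|%:R.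

Lemma translate_flip x y i : ~~ y i -> translate x (flip i y) = shift i (translate x y).
Proof.
move=> yi; apply/ffunP => j; rewrite updE !ffunE; case: (eqVneq j i) => [->|//].
by rewrite (negPf yi) /step addr0.
Qed.

Lemma translate_neighbours s x y i :
  even_cell s (translate x y) -> odd_cell s (translate x (flip i y)) -> False.
Proof.
move=> e o; case: (boolP (y i)) => yi.
  apply: (@odd_even_shift s (translate x (flip i y)) i) => //.
  by rewrite -translate_flip ?flipK // flipE eqxx yi.
by apply: (@even_odd_shift s (translate x y) i) => //; rewrite -translate_flip.
Qed.

Lemma sqrt_gt0 : 0 < Num.sqrt n%:R :> R.
Proof. by rewrite sqrtr_gt0 ltr0n (ltn_trans _ n_gt1). Qed.

Lemma sqrt_ge1 : 1 <= Num.sqrt n%:R :> R.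
Proof. by rewrite -[leLHS]sqrtr1 ler_sqrt ?ler0n // ler1n (ltn_trans _ n_gt1). Qed.

Lemma block_split s x : (#|bad_block_cells s x| + (#|even_block_cells s x| + #|odd_block_cells s x|) = 2 ^ n)%N.
Proof.
rewrite -card_cube -!sum1_card (big_mkcond (mem (bad_block_cells s x))).
rewrite (big_mkcond (mem (even_block_cells s x))) (big_mkcond (mem (odd_block_cells s x))) -!big_split /=.
apply: eq_bigr => y _; rewrite !inE.
have := cell_cases s (translate x y); have := @even_odd_cell s (translate x y).
rewrite /even_cell /odd_cell; case: (bad_cell _ _) => //=.
by case: (few _ _ _); case: (few _ _ _) => // /(_ isT isT).
Qed.

(* The outer vertex boundary of the even cells consists of bad cells, so the
   isoperimetric inequality makes one of the two phases dominate the block. *)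
Lemma block_dichotomy s x : ~~ coarse_bad s x ->
  (coarse_even s x /\ #|~: even_block_cells s x|%:R <= M / 40) \/
  (~~ coarse_even s x /\ #|~: odd_block_cells s x|%:R <= M / 30).
Proof.
rewrite /coarse_bad -ltNge => hb.
set A := even_block_cells s x; set b : R := #|bad_block_cells s x|%:R in hb.
have s1 := sqrt_ge1; have s0 := sqrt_gt0.
have M0 : 0 < M by rewrite exprn_gt0.
have bM : b < M / 100.
  apply: lt_le_trans hb _; rewrite ler_pdivrMr ?mulr_gt0 //.
  have -> : M / 100 * (100 * Num.sqrt n%:R) = M * Num.sqrt n%:R by field.
  by rewrite ler_peMr // ltW.
have ib : #|inner_boundary (~: A)|%:R <= b.
  rewrite ler_nat subset_leq_card //; apply/subsetP => y; rewrite inE in_setC => /andP[yA /existsP[i]].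
  rewrite in_setC negbK inE => e; rewrite inE.
  have := cell_cases s (translate x y); case: (boolP (bad_cell _ _)) => //= _ /orP[h|h].
    by move: yA; rewrite inE h.
  by exfalso; apply: (@translate_neighbours s x (flip i y) i); rewrite ?flipK.
have iso := @isoperimetry R n (~: A).
have cA : #|~: A|%:R = M - #|A|%:R :> R.
  have := cardsC A; rewrite card_cube => /(congr1 (fun k => k%:R : R)).
  by rewrite natrD natrX => <-; rewrite [RHS]addrC addKr.
have cO : #|~: odd_block_cells s x|%:R = b + #|A|%:R :> R.
  have := cardsC (odd_block_cells s x); rewrite card_cube -(block_split s x).
  rewrite addnA [X in _ = X -> _]addnC => /addnI ->; by rewrite natrD.
have key : (M - #|A|%:R) * #|A|%:R < M * (M / 100).
  rewrite cA in iso; apply: le_lt_trans (_ : M * (Num.sqrt n%:R * b) < _).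
    apply: le_trans (_ : M * (Num.sqrt n%:R * #|inner_boundary (~: A)|%:R) <= _).
      by apply: le_trans iso; rewrite opprB addrCA subrr addr0.
    by rewrite ler_pM2l // ler_pM2l.
  rewrite ltr_pM2l //; move: hb; rewrite ltr_pdivlMr ?mulr_gt0 //; nra.
have A0 : 0 <= #|A|%:R :> R by [].
have AM : #|A|%:R <= M by have : 0 <= #|~: A|%:R :> R by []; rewrite cA; lra.
rewrite /coarse_even -/A cA cO; move: key AM A0; move: (#|A|%:R : R) => a key aM a0.
case: (ltP (M / 2) a) => ha; [left|right]; split=> //; nra.
Qed.

Lemma coarse_even_odd s x : ~~ coarse_bad s x -> coarse_odd s x = ~~ coarse_even s x.
Proof.
have M0 : 0 < M by rewrite exprn_gt0.
have co : #|odd_block_cells s x|%:R = M - #|~: odd_block_cells s x|%:R :> R.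
  have := cardsC (odd_block_cells s x); rewrite card_cube => /(congr1 (fun k => k%:R : R)).
  by rewrite natrD natrX => <-; rewrite addrK.
have sub : #|odd_block_cells s x|%:R <= #|~: even_block_cells s x|%:R :> R.
  rewrite ler_nat subset_leq_card //; apply/subsetP => y; rewrite !inE => o; apply/negP => e.
  exact: even_odd_cell e o.
move/block_dichotomy => [[-> h]|[h1 h2]]; rewrite /coarse_odd.
  by apply/negbTE; rewrite -leNgt; lra.
by rewrite h1 co; apply/idP; lra.
Qed.

Lemma card_dir i : #|[set y : cube n | y i]| = (2 ^ n.-1)%N.
Proof.
rewrite -(card_facet n_gt1 i true); apply: eq_card => y; rewrite !inE.
by case: (y i).
Qed.

(** The two exceptional sets have at most 2^n / 15 points together and cannot cover the half cube of
    all [y] with [y i]. *)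
Lemma common_cell i (U W : {set cube n}) :
  #|~: U|%:R <= M / 30 -> #|~: W|%:R <= M / 30 ->
  exists y, [/\ y i, y \in U & flip i y \in W].
Proof.
move=> hU hW; apply: contrapT => hn.
have : [set y : cube n | y i] \subset ~: U :|: flip i @: ~: W.
  apply/subsetP => y; rewrite inE => yi; rewrite in_setU mem_flip_image !in_setC.
  by rewrite -negb_and; apply/negP => /andP[yU yW]; apply: hn; exists y.
move/subset_leq_card; rewrite card_dir => /leq_trans -/(_ _ (leq_card_setU _ _)).
rewrite card_imset; last exact: flip_inj.
rewrite -(ler_nat R) natrD natrX => h.
have M0 : 0 < M by rewrite exprn_gt0.
have : M = 2 * 2 ^+ n.-1 by rewrite -exprS prednK // ltnW.
lra.
Qed.

(* Two bases whose blocks contain equal or adjacent cells. *)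
Definition linked i x x' : Prop := forall y, y i ->
  translate x' (flip i y) = translate x y \/ translate x' (flip i y) = shift i (translate x y).

Lemma linked_shift i x : linked i x (shift i x).
Proof.
move=> y yi; left; apply/ffunP => j; rewrite !ffunE; case: (eqVneq j i) => [->|//].
by rewrite yi /step addr0.
Qed.

Lemma linked_shift2 i x : linked i x (shift i (shift i x)).
Proof.
move=> y yi; right; apply/ffunP => j; rewrite !ffunE eqxx; case: (eqVneq j i) => [->|//].
by rewrite yi /step addr0.
Qed.

Lemma linked_coarse s i x x' : linked i x x' -> ~~ coarse_bad s x -> ~~ coarse_bad s x' ->
  coarse_even s x = coarse_even s x'.
Proof.
move=> l /block_dichotomy h /block_dichotomy h'.
have M0 : 0 < M by rewrite exprn_gt0.
case: h => -[e1 e2]; case: h' => -[e1' e2']; rewrite ?e1 ?(negPf e1) ?e1' ?(negPf e1') //; exfalso.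
  have [|//|y [yi]] := @common_cell i (even_block_cells s x) (odd_block_cells s x'); first lra.
  rewrite !inE => e; case: (l y yi) => ->; first exact: even_odd_cell.
  exact: even_odd_shift.
have [//||y [yi]] := @common_cell i (odd_block_cells s x) (even_block_cells s x'); first lra.
rewrite !inE => o; case: (l y yi) => ->; first by move/even_odd_cell; apply.
exact: odd_even_shift.
Qed.

End Blocks.

(** * Probability that many blocks are bad *)

Section CoarseProbability.
Variables (R : realType) (n q k : nat).
Hypothesis qk : q.+2 = (2 ^ k.+1)%N.
Variable lam : R.
Hypothesis lam_gt0 : 0 < lam.
Local Notation N := (n%:R : R).
Local Notation L := (ln N).
Local Notation M := (2 ^+ n : R).
Hypothesis L_ge : (20 * 100) <= L.
Hypothesis th_large : L ^+ 6 <= act lam ^+ 3 * N.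
Hypothesis M_large : N ^+ 3 <= M.
Local Notation torus := (torus n q).
Local Notation K := (K0 n lam).

(** In units of L^2 M / N^2, which is at least 1, the loss is 79, while [th_large] and L >= 2000
    make the gain at least L^3 / (16 * 10^6) >= 86. *)
Lemma coarse_numeric : eta0 R n - G0 n lam / (100 * Num.sqrt N) <= - 7.
Proof.
have N0 := N_gt0 L_ge; have NL := N_large L_ge.
have Lp : 0 < L by have := L_ge; lra.
have M0 : 0 < M by rewrite exprn_gt0.
have s0 : 0 < Num.sqrt N by rewrite sqrtr_gt0.
have sE : Num.sqrt N ^+ 2 = N by rewrite sqr_sqrtr // ltW.
have e : G0 n lam / (100 * Num.sqrt N) = act lam ^+ 3 * N * (M / (4 * 100 * (4 * 100) * 100 * L * N ^+ 2)).
  have gen (t m l r : R) : 0 < l -> 0 < r -> t * m / ((4 * 100 * (4 * 100)) * l * r) / (100 * r) =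
      t * r ^+ 2 * (m / (4 * 100 * (4 * 100) * 100 * l * (r ^+ 2) ^+ 2)).
    by move=> l0 r0; field; rewrite !gt_eqF.
  by rewrite /G0 gen // sE.
have Y : 1 <= L ^+ 2 * M / N ^+ 2.
  rewrite ler_pdivlMr ?exprn_gt0 // mul1r.
  apply: le_trans (_ : M <= _).
    apply: le_trans M_large; rewrite [leRHS]exprS ler_peMl ?exprn_ge0 ?(ltW N0) //; lra.
  rewrite ler_peMl ?(ltW M0) // exprn_ege1 //; have := L_ge; lra.
have h1 : L ^+ 6 * (M / (4 * 100 * (4 * 100) * 100 * L * N ^+ 2)) <= G0 n lam / (100 * Num.sqrt N).
  rewrite e ler_wpM2r // divr_ge0 ?(ltW M0) // !mulr_ge0 ?exprn_ge0 ?(ltW N0) ?(ltW Lp) //; lra.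
have h2 : L ^+ 6 * (M / (4 * 100 * (4 * 100) * 100 * L * N ^+ 2)) =
   (L ^+ 3 / (4 * 100 * (4 * 100) * 100)) * (L ^+ 2 * M / N ^+ 2) by field; rewrite !gt_eqF.
have h3 : 86 <= L ^+ 3 / (4 * 100 * (4 * 100) * 100).
  have : (20 * 100) ^+ 3 <= L ^+ 3 by rewrite lerXn2r ?nnegrE //; lra.
  move: (L ^+ 3) => y hy; lra.
rewrite h2 in h1; rewrite /eta0.
move: h1 h3 Y; move: (_ / (4 * 100 * (4 * 100) * 100)) (_ / N ^+ 2) (G0 n lam / _) => a y g h1 h3 y1.
nra.
Qed.

Lemma expR_m7 : expR (- 7) <= 1 / 100 :> R.
Proof.
rewrite expRN -[7]mulr1 expRM_natl.
have e2 : 2 <= expR 1 :> R by have := @expR_ge1Dx R 1; lra.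
have : 2 ^+ 7 <= expR 1 ^+ 7 :> R by rewrite lerXn2r ?nnegrE ?expR_ge0.
move=> h; rewrite div1r lef_pV2 ?posrE ?exprn_gt0 ?expR_gt0 //.
by apply: le_trans h; lra.
Qed.

(** Exponential Markov inequality on the union of the blocks, whose disjointness is the hypothesis:
    each bad block brings 2^n / (100 sqrt n) bad cells, that is the gain G0 / (100 sqrt n), against
    the loss [eta0]. *)
Theorem coarse_bad_prob (S : {set torus}) :
  (forall x x' y y', x \in S -> x' \in S -> translate x y = translate x' y' -> x = x' /\ y = y') ->
  \sum_(s : {set torus} | [forall x in S, coarse_bad K s x]) hc_weight lam s
    <= (1 / 100) ^+ #|S| * hc_Z n q lam.
Proof.
move=> inj.
have n1 := n_gt1 L_ge.
pose cells : {set torus} := [set translate p.1 p.2 | p in setX S [set: cube n]].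
have inj' : {in setX S setT &, injective (fun p : torus * cube n => translate p.1 p.2)}.
  move=> [x y] [x' y']; rewrite !inE /= !andbT => xS x'S e.
  by have [-> ->] := inj _ _ _ _ xS x'S e.
have cc : #|cells| = (#|S| * 2 ^ n)%N by rewrite card_in_imset // cardsX cardsT card_cube.
have M0 : 0 < M by rewrite exprn_gt0.
have mE : (2 ^ n)%:R = M :> R by rewrite natrX.
set dl := M / (100 * Num.sqrt N).
have nb s : [forall x in S, coarse_bad K s x] ->
   dl * #|S|%:R <= #|[set x in cells | bad_cube K (pattern x s)]|%:R.
  move=> /forall_inP h.
  have -> : #|[set x in cells | bad_cube K (pattern x s)]| = (\sum_(x in S) #|bad_block_cells K s x|)%N.
    have -> : [set x in cells | bad_cube K (pattern x s)] =
       [set translate p.1 p.2 | p in [set p in setX S [set: cube n] | bad_cell K s (translate p.1 p.2)]].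
      apply/setP => x; rewrite inE; apply/andP/imsetP => [[/imsetP[p pS ->] b]|[p]].
        by exists p => //; rewrite inE pS.
      by rewrite inE => /andP[pS b] ->; split => //; apply/imsetP; exists p.
    rewrite card_in_imset; last first.
      by move=> p p' /=; rewrite !(inE, in_setX) => /andP[pS _] /andP[p'S _]; apply: inj'; rewrite !(inE, in_setX).
    rewrite -sum1_card (eq_bigl (fun p : torus * cube n => (p.1 \in S) && (p.2 \in bad_block_cells K s p.1))).
      by rewrite -(pair_big_dep (mem S) (fun x y => y \in bad_block_cells K s x) (fun _ _ => 1%N)) /=; apply: eq_bigr => x _; rewrite sum1_card.
    by move=> [x y]; rewrite !inE /= andbT.
  rewrite natr_sum mulr_natr -sumr_const; apply: ler_sum => x xS; exact: h.
have bound := bad_cells_laplace qk (ltnW n1) lam_gt0 (cube_bound lam_gt0 L_ge th_large M_large) cells.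
rewrite cc natrM mE in bound.
have E1 : eta0 R n / M * (#|S|%:R * M) = eta0 R n * #|S|%:R by field; rewrite gt_eqF.
rewrite E1 in bound.
set g := G0 n lam / (100 * Num.sqrt N).
have Zge0 : 0 <= hc_Z n q lam by apply: sumr_ge0 => s _; exact: hc_weight_ge0.
have low : expR (g * #|S|%:R) * (\sum_(s : {set torus} | [forall x in S, coarse_bad K s x]) hc_weight lam s)
    <= expR (eta0 R n * #|S|%:R) * hc_Z n q lam.
  apply: le_trans bound; rewrite mulr_sumr big_mkcond /=; apply: ler_sum => s _.
  case: ifP => [/nb hs|_]; last by rewrite mulr_ge0 ?expR_ge0 // hc_weight_ge0.
  rewrite mulrC ler_wpM2l ?hc_weight_ge0 // ler_expR.
  have g0 : 0 <= G0 n lam / M by rewrite divr_ge0 ?(ltW M0) // G0_ge0.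
  apply: le_trans (ler_wpM2l g0 hs); rewrite le_eqVlt; apply/orP; left; apply/eqP.
  rewrite /g /dl; field; rewrite !gt_eqF //.
  by rewrite sqrtr_gt0; exact: N_gt0.
rewrite -(ler_pM2l (expR_gt0 (g * #|S|%:R))); apply: le_trans low _.
rewrite mulrA ler_wpM2r //.
have -> : eta0 R n * #|S|%:R = g * #|S|%:R + #|S|%:R * (eta0 R n - g) by ring.
rewrite expRD ler_pM2l ?expR_gt0 // expRM_natl lerXn2r ?nnegrE ?expR_ge0 //.
by apply: le_trans expR_m7; rewrite ler_expR coarse_numeric.
Qed.

End CoarseProbability.

(** * Contours in a planar grid *)

(** King moves, staying put included: the connectivity dual to that of nearest neighbours, along
    which the phase propagates. *)
Definition star_adj (u v : nat * nat) : bool :=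
  [&& u.1 <= v.1.+1, v.1 <= u.1.+1, u.2 <= v.2.+1 & v.2 <= u.2.+1]%N.

Section Contour.
Variables (r : nat) (b e : nat -> nat -> bool).
Hypothesis e_horizontal : forall i j, (i < r)%N -> (j <= r)%N ->
  ~~ b i j -> ~~ b i.+1 j -> e i j = e i.+1 j.
Hypothesis e_vertical : forall i j, (i <= r)%N -> (j < r)%N ->
  ~~ b i j -> ~~ b i j.+1 -> e i j = e i j.+1.

Local Notation grid := ('I_r.+1 * 'I_r.+1)%type.
Definition to_nat2 (u : grid) : nat * nat := (val u.1, val u.2).
Local Notation bad u := (b (val u.1) (val u.2)).

Definition bad_star : rel grid := fun u v =>
  [&& star_adj (to_nat2 u) (to_nat2 v), bad u & bad v].

(** The union of all star-connected bad clusters that meet the bottom row; the parity argument needs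
    no choice among them. *)
Definition bottom_cluster (v : grid) : bool :=
  bad v && [exists u : grid, [&& val u.2 == 0%N, bad u & connect bad_star u v]].

Lemma bottom_cluster_star (u v : grid) : bottom_cluster u -> bad v ->
  star_adj (to_nat2 u) (to_nat2 v) -> bottom_cluster v.
Proof.
move=> /andP[bu /existsP[w /and3P[w0 bw wu]]] bv uv; rewrite /bottom_cluster bv /=.
apply/existsP; exists w; rewrite w0 bw /=; apply: connect_trans wu _.
by apply: connect1; rewrite /bad_star uv bu bv.
Qed.

Lemma bottom_cluster_bottom (u : grid) : val u.2 = 0%N -> bad u -> bottom_cluster u.
Proof.
by move=> u0 bu; rewrite /bottom_cluster bu; apply/existsP; exists u; rewrite bu u0 connect0.
Qed.

Definition inK i j : bool := bottom_cluster (inord i, inord j).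

Lemma inK_star i j i' j' : (i <= r)%N -> (j <= r)%N -> (i' <= r)%N -> (j' <= r)%N ->
  inK i j -> b i' j' -> star_adj (i, j) (i', j') -> inK i' j'.
Proof.
move=> hi hj hi' hj' k bb st; apply: bottom_cluster_star k _ _; first by rewrite /= !inordK.
by rewrite /to_nat2 /= !inordK.
Qed.

Definition cutH i j := (e i j != e i.+1 j) && (inK i j || inK i.+1 j).
Definition cutV i j := (e i j != e i j.+1) && (inK i j || inK i j.+1).

(** The phase changes around a plaquette cancel modulo 2. If one corner is in the cluster, so are
    all bad corners, being star-adjacent; as a change needs a bad end, every change is counted. If
    no corner is, none is counted. *)
Lemma cut_plaquette i j : (i < r)%N -> (j < r)%N ->
  cutH i j (+) cutH i j.+1 = cutV i j (+) cutV i.+1 j.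
Proof.
move=> hi hj; have hi' := ltnW hi; have hj' := ltnW hj.
case: (boolP [|| inK i j, inK i.+1 j, inK i j.+1 | inK i.+1 j.+1]); last first.
  by rewrite !negb_or /cutH /cutV => /and4P[/negPf -> /negPf -> /negPf -> /negPf ->]; rewrite !andbF.
move=> hk.
have inb i' j' : (i <= i' <= i.+1)%N -> (j <= j' <= j.+1)%N -> b i' j' -> inK i' j'.
  move=> /andP[a1 a2] /andP[a3 a4] bb.
  have R1 : (i' <= r)%N by apply: leq_trans hi.
  have R2 : (j' <= r)%N by apply: leq_trans hj.
  by case/or4P: hk => k; apply: (inK_star _ _ _ _ k bb) => //; rewrite /star_adj /=; apply/and4P; split; lia.
have H a : (j <= a <= j.+1)%N -> cutH i a = (e i a != e i.+1 a).
  move=> ha; rewrite /cutH; case: (eqVneq (e i a) (e i.+1 a)) => //= hne.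
  have [_ a2] := andP ha; have ar : (a <= r)%N by apply: leq_trans a2 hj.
  case: (boolP (b i a)) => [bb|nb]; first by rewrite inb // leqnn leqnSn.
  case: (boolP (b i.+1 a)) => [bb|nb']; first by rewrite (inb i.+1 a) ?orbT // leqnn leqnSn.
  by move: hne; rewrite e_horizontal // eqxx.
have V a : (i <= a <= i.+1)%N -> cutV a j = (e a j != e a j.+1).
  move=> ha; rewrite /cutV; case: (eqVneq (e a j) (e a j.+1)) => //= hne.
  have [_ a2] := andP ha; have ar : (a <= r)%N by apply: leq_trans a2 hi.
  case: (boolP (b a j)) => [bb|nb]; first by rewrite inb // leqnn leqnSn.
  case: (boolP (b a j.+1)) => [bb|nb']; first by rewrite (inb a j.+1) ?orbT // leqnn leqnSn.
  by move: hne; rewrite e_vertical // eqxx.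
rewrite !H ?V ?leqnn ?leqnSn //.
by case: (e i j); case: (e i.+1 j); case: (e i j.+1); case: (e i.+1 j.+1).
Qed.

(* Summing [cut_plaquette] over a row of plaquettes telescopes; if the cluster of
   the bottom row misses the other three sides, the number of phase changes along
   the bottom row is even. *)
Lemma cluster_reaches_side : e 0 0 != e r 0 ->
  exists v : grid, bottom_cluster v /\ (val v.1 = 0%N \/ val v.1 = r \/ val v.2 = r).
Proof.
move=> er; apply: contrapT => none.
have noK i j : (i <= r)%N -> (j <= r)%N -> (i == 0%N) || (i == r) || (j == r) -> inK i j = false.
  move=> hi hj h; apply/negP => k; apply: none; exists (inord i, inord j); split=> //=.
  by rewrite !inordK //; case/orP: h => [/orP[]|] /eqP ->; auto.
pose Hrow j := \big[addb/false]_(0 <= i < r) cutH i j.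
have tele (f : nat -> bool) n : \big[addb/false]_(0 <= i < n) (f i (+) f i.+1) = f 0%N (+) f n.
  elim: n => [|n IH]; first by rewrite big_geq // addbb.
  by rewrite big_nat_recr //= IH -addbA (addbA (f n)) addbb addFb.
have row j : (j < r)%N -> Hrow j = Hrow j.+1.
  move=> hj; have : Hrow j (+) Hrow j.+1 = false; last by case: (Hrow j); case: (Hrow j.+1).
  rewrite /Hrow -big_split /=.
  rewrite (eq_big_nat _ _ (F2 := fun i => cutV i j (+) cutV i.+1 j)); last first.
    by move=> i /andP[_ hi]; exact: cut_plaquette.
  rewrite (tele (cutV^~ j)) /cutV !noK ?leqnn ?eqxx ?orbT ?andbF //; exact: ltnW.
have top j : (j <= r)%N -> Hrow 0 = Hrow j.
  by elim: j => // j IH hj; rewrite (IH (ltnW hj)) (row _ hj).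
have Hr : Hrow r = false.
  rewrite /Hrow big_nat_cond big1 // => i; rewrite andbT => /andP[_ hi].
  by rewrite /cutH !noK ?eqxx ?orbT ?andbF // ltnW.
have H0 : Hrow 0 = e 0 0 (+) e r 0.
  rewrite -(tele (e^~ 0) r); apply: eq_big_nat => i /andP[_ hi].
  rewrite /cutH; case: (eqVneq (e i 0) (e i.+1 0)) => [->|ne]; first by rewrite addbb.
  have -> : e i 0 (+) e i.+1 0 by move: ne; case: (e i 0); case: (e i.+1 0).
  have inb a : (a <= r)%N -> b a 0 -> inK a 0.
    by move=> ha ba; apply: bottom_cluster_bottom; rewrite /= ?inordK.
  case: (boolP (b i 0)) => [/inb -> //|nb]; first exact: ltnW.
  case: (boolP (b i.+1 0)) => [/inb -> //|nb']; first by rewrite orbT.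
  by move: ne; rewrite e_horizontal ?eqxx.
by move: er H0; rewrite (top r) // Hr; case: (e 0 0)%N; case: (e r 0)%N.
Qed.

Lemma star_path_length (u : grid) p : path bad_star u p ->
  (val u.1 <= val (last u p).1 + size p)%N /\ (val (last u p).1 <= val u.1 + size p)%N /\
  (val (last u p).2 <= val u.2 + size p)%N.
Proof.
elim: p u => [|v p IH] u /=; first by rewrite !addn0.
move=> /andP[/and3P[/and4P[/= h1 h2 h3 h4] _ _] /IH].
rewrite /to_nat2 /= in h1 h2 h3 h4 *; lia.
Qed.

(** A star path from (i, 0) to the left, right or top side has at least min(i, r - i) steps. It is
    cut to exactly this length, so that words of a fixed length enumerate the contours. *)
Lemma contour_exists : e 0 0 != e r 0 ->
  exists (i : nat) (p : seq (nat * nat)),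
    [/\ (i <= r)%N, size p = minn i (r - i), path star_adj (i, 0%N) p, uniq ((i, 0%N) :: p) &
        all (fun u => [&& u.1 <= r, u.2 <= r & b u.1 u.2]%N) ((i, 0%N) :: p)].
Proof.
move=> /cluster_reaches_side[v [/andP[bv /existsP[u /and3P[/eqP u0 bu /connectP[p0 up0 vp0]]]] side]].
case/shortenP: up0 vp0 => p up uniq_p _ vp.
have [l1 [l2 l3]] := star_path_length up; rewrite -vp in l1 l2 l3.
have ur : (val u.1 <= r)%N by rewrite -ltnS ltn_ord.
set k := minn (val u.1) (r - val u.1).
have kp : (k <= size p)%N.
  rewrite /k geq_min; apply/orP; case: side => [s|[s|s]].
  - by left; move: l1; rewrite s.
  - by right; move: l2; rewrite s leq_subLR.
  - by left; apply: leq_trans ur _; move: l3; rewrite s u0.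
exists (val u.1), (map to_nat2 (take k p)).
have uE : to_nat2 u = (val u.1, 0%N) by rewrite /to_nat2 u0.
have to_inj : injective to_nat2.
  by move=> [x y] [x' y'] [] /val_inj -> /val_inj ->.
split => //.
- by rewrite size_map size_takel.
- rewrite -uE path_map; have : path bad_star u (take k p) by move: up; rewrite -{1}(cat_take_drop k p) cat_path => /andP[].
  by apply: sub_path => x y /and3P[].
- rewrite -uE -map_cons map_inj_uniq //; move: uniq_p => /= /andP[h1 h2].
  by rewrite (contra (@mem_take _ _ _ _) h1) take_uniq.
- rewrite -uE -map_cons all_map; apply/allP => w.
  have hv (z : 'I_r.+1) : (val z <= r)%N by rewrite -ltnS ltn_ord.
  rewrite inE => /predU1P[->|wp] /=; first by rewrite !hv.
  rewrite !hv /=.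
  have : all (fun w => bad w) p.
    elim: p u up {uniq_p vp l1 l2 l3 ur k kp uE wp bu u0} => //= x p IH u /andP[/and3P[_ _ ->] /IH].
    by [].
  by move=> /allP; apply; exact: mem_take wp.
Qed.

End Contour.

(** The two ternary digits of [c], lowered by one, are the displacements. Truncation at 0 is
    harmless, since it only matters that every king move has a code. *)
Definition star_move (u : nat * nat) (c : 'I_9) : nat * nat :=
  ((u.1 + c %% 3).-1, (u.2 + c %/ 3).-1)%N.

Fixpoint star_walk (u : nat * nat) (c : seq 'I_9) : seq (nat * nat) :=
  if c is a :: c' then star_move u a :: star_walk (star_move u a) c' else [::].

Lemma size_star_walk u c : size (star_walk u c) = size c.
Proof. by elim: c u => //= a c IH u; rewrite IH. Qed.

Lemma star_walkP u p : path star_adj u p -> exists c : (size p).-tuple 'I_9, p = star_walk u c.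
Proof.
elim: p u => [|v p IH] u /=; first by exists [tuple].
move=> /andP[/and4P[h1 h2 h3 h4] /IH[c pc]].
have h : ((v.1 + 1 - u.1) + 3 * (v.2 + 1 - u.2) < 9)%N by lia.
exists [tuple of Ordinal h :: c] => /=.
have -> : star_move u (Ordinal h) = v; last by rewrite -pc.
case: v h1 h2 h3 h4 h {pc IH} => v1 v2 /= h1 h2 h3 h4 h; rewrite /star_move /=.
by congr pair; lia.
Qed.

(** * Long-range order *)

Section Translation.
Variables (R : realType) (n q k : nat).
Hypothesis qk : q.+2 = (2 ^ k.+1)%N.
Variables (K lam : R).
Local Notation torus := (torus n q).
Implicit Types (x v : torus) (i : 'I_n) (y z : cube n) (s : {set torus}).

Lemma shift_inj i : injective (@shift n q i).
Proof.
move=> v w /ffunP h; apply/ffunP => j; have := h j; rewrite !updE.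
by case: eqP => [->|//]; exact: addIr.
Qed.

(** Corners are labelled by parities, so a unit translation flips a label; this is how it exchanges
    the phases. *)
Lemma corner_shift i x z : corner (shift i x) z = shift i (corner x (flip i z)).
Proof.
apply/ffunP => j; rewrite updE !ffunE !eqxx; case: (eqVneq j i) => [->|//].
rewrite /endpoint (odd_succZ qk); case: (odd (val (x i))); case: (z i) => //=.
Qed.

Lemma pattern_translate i x s : pattern (shift i x) (shift i @: s) = flip i @: pattern x s.
Proof.
apply/setP => z; rewrite mem_flip_image !inE corner_shift mem_imset //.
exact: shift_inj.
Qed.

Lemma cube_indep_flip i (t : {set cube n}) : cube_indep (flip i @: t) = cube_indep t.
Proof.
have flipC j z : flip i (flip j z) = flip j (flip i z).
  by apply/ffunP => l; rewrite !flipE; case: (l == i); case: (l == j).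
apply/cube_indepP/cube_indepP => h z j.
  by move=> zt; have := h (flip i z) j; rewrite !mem_flip_image flipC !flipK; apply.
by rewrite !mem_flip_image flipC; exact: h.
Qed.

Lemma few_flip i (P Q t : {set cube n}) : flip i @: Q = P -> few K P (flip i @: t) = few K Q t.
Proof.
move=> <-; rewrite /few -imsetI; last by move=> ? ? _ _; exact: flip_inj.
by rewrite card_imset //; exact: flip_inj.
Qed.

Lemma flip_odd_part i : flip i @: (@odd_part n) = @even_part n.
Proof. by apply/setP => z; rewrite mem_flip_image !inE parity_flip. Qed.

Lemma flip_even_part i : flip i @: (@even_part n) = @odd_part n.
Proof. by apply/setP => z; rewrite mem_flip_image !inE parity_flip negbK. Qed.

Lemma flip_facet i j b : flip i @: facet j b = facet j (b (+) (j == i)).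
Proof.
apply/setP => z; rewrite mem_flip_image !inE flipE; case: (j == i); last by rewrite addbF.
by case: (z j); case: b.
Qed.

Lemma bad_cube_flip i (t : {set cube n}) : bad_cube K (flip i @: t) = bad_cube K t.
Proof.
rewrite /bad_cube (few_flip _ (flip_even_part i)) (few_flip _ (flip_odd_part i)) andbC; congr orb.
have inter j b : (flip i @: t) :&: facet j b = flip i @: (t :&: facet j (b (+) (j == i))).
  rewrite imsetI; last by move=> ? ? _ _; exact: flip_inj.
  by rewrite flip_facet -addbA addbb addbF.
have swap (u : {set cube n}) : few K (@odd_part n) (flip i @: u) && few K (@even_part n) (flip i @: u) =
    few K (@odd_part n) u && few K (@even_part n) u.
  by rewrite (few_flip _ (flip_even_part i)) (few_flip _ (flip_odd_part i)) andbC.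
apply/existsP/existsP => -[j /existsP[b hb]]; exists j; apply/existsP; exists (b (+) (j == i)).
  by move: hb; rewrite inter swap.
by rewrite inter swap -addbA addbb addbF.
Qed.

Lemma bad_cell_translate i s x : bad_cell K (shift i @: s) (shift i x) = bad_cell K s x.
Proof. by rewrite /bad_cell pattern_translate bad_cube_flip. Qed.

Lemma even_cell_translate i s x : even_cell K (shift i @: s) (shift i x) = odd_cell K s x.
Proof.
by rewrite /even_cell /odd_cell bad_cell_translate pattern_translate (few_flip _ (flip_even_part i)).
Qed.

Lemma translate_shift i x y : translate (shift i x) y = shift i (translate x y).
Proof.
apply/ffunP => j; rewrite !ffunE; case: (eqVneq j i) => [->|//].
by rewrite addrAC.
Qed.

Lemma coarse_even_translate i s x : coarse_even K (shift i @: s) (shift i x) = coarse_odd K s x.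
Proof.
rewrite /coarse_even /coarse_odd; congr (_ < _%:R); apply: eq_card => y.
by rewrite !inE translate_shift even_cell_translate.
Qed.

Lemma hc_weight_translate i s : hc_weight lam (shift i @: s) = hc_weight lam s.
Proof.
rewrite /hc_weight card_imset; last exact: shift_inj.
suff -> : torus_indep (shift i @: s) = torus_indep s by [].
apply/forallP/forallP => h x.
  by have := h (shift i x); rewrite pattern_translate cube_indep_flip.
have [g gK Kg] : bijective (@shift n q i) by exact: injF_bij (@shift_inj i).
by rewrite -(Kg x) pattern_translate cube_indep_flip.
Qed.

Lemma sum_translate i (P : pred {set torus}) :
  \sum_(s : {set torus} | P s) hc_weight lam s = \sum_(s : {set torus} | P (shift i @: s)) hc_weight lam s.
Proof.
rewrite (reindex_inj (imset_inj (@shift_inj i))) /=.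
by apply: eq_bigr => s _; rewrite hc_weight_translate.
Qed.

End Translation.

Lemma balance_bound (R : realFieldType) (a b z c d : R) :
  a <= 1 / 100 * z -> b <= 1 / 100 * z -> c + d = z ->
  c <= d + (a + b) -> d <= c + (a + b) -> 49 / 100 * z <= c /\ 49 / 100 * z <= d.
Proof. by move=> *; lra. Qed.

Section LongRangeOrder.
Variables (R : realType) (n q k : nat).
Hypothesis qk : q.+2 = (2 ^ k.+2)%N.
Variable lam : R.
Hypothesis lam_gt0 : 0 < lam.
Local Notation N := (n%:R : R).
Local Notation L := (ln N).
Local Notation M := (2 ^+ n : R).
Hypothesis L_ge : (20 * 100) <= L.
Hypothesis th_large : L ^+ 6 <= act lam ^+ 3 * N.
Hypothesis M_large : N ^+ 3 <= M.
Local Notation torus := (torus n q).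
Local Notation K := (K0 n lam).
Local Notation r := (2 ^ k)%N.
Local Notation Z := (hc_Z n q lam).

Definition hc_mass (P : pred {set torus}) : R := \sum_(s : {set torus} | P s) hc_weight lam s.

Lemma hc_mass_le (P Q : pred {set torus}) : (forall s, P s -> Q s) -> hc_mass P <= hc_mass Q.
Proof.
move=> PQ; rewrite /hc_mass big_mkcond [leRHS]big_mkcond; apply: ler_sum => s _.
case: ifP => [/PQ -> //|_]; case: ifP => // _; exact: hc_weight_ge0.
Qed.

Lemma hc_mass_or (P Q : pred {set torus}) : hc_mass (fun s => P s || Q s) <= hc_mass P + hc_mass Q.
Proof.
rewrite /hc_mass !(big_mkcond _ (hc_weight lam)) /= -big_split; apply: ler_sum => s _.
have := hc_weight_ge0 lam_gt0 s; case: (P s); case: (Q s) => /=; lra.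
Qed.

Lemma hc_mass_compl (P : pred {set torus}) : hc_mass P + hc_mass (fun s => ~~ P s) = Z.
Proof. by rewrite /hc_mass /hc_Z [RHS](bigID P). Qed.

Lemma hc_mass_exists (I : finType) (P : I -> pred {set torus}) :
  hc_mass (fun s => [exists i, P i s]) <= \sum_i hc_mass (P i).
Proof.
rewrite /hc_mass big_mkcond /=; under [leRHS]eq_bigr do rewrite big_mkcond.
rewrite exchange_big /=; apply: ler_sum => s _.
have h0 i : 0 <= if P i s then hc_weight lam s else 0.
  by case: ifP => // _; exact: hc_weight_ge0.
case: existsP => [[i Pi]|_]; last by rewrite sumr_ge0.
by rewrite (bigD1 i) //= Pi lerDl sumr_ge0.
Qed.

Lemma coarse_bad1 x : hc_mass (fun s => coarse_bad K s x) <= (1 / 100) * Z.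
Proof.
have := coarse_bad_prob qk lam_gt0 L_ge th_large M_large (S := [set x]).
rewrite cards1 expr1 => h; apply: le_trans (h _).
  apply: hc_mass_le => s b; apply/forall_inP => y; by rewrite inE => /eqP ->.
move=> a b y y'; rewrite !inE => /eqP -> /eqP -> /ffunP e; split=> //.
apply/ffunP => j; have := e j; rewrite !ffunE => /addrI.
by rewrite /step; case: (y j); case: (y' j).
Qed.

(** A unit translation turns the even phase at [x] into the odd phase at the preceding base. The two
    blocks are linked, so unless one of them is bad this is the odd phase at [x]. *)
Lemma balanced x :
  49 / 100 * Z <= hc_mass (fun s => coarse_even K s x) /\
  49 / 100 * Z <= hc_mass (fun s => ~~ coarse_even K s x).
Proof.
have n1 := n_gt1 L_ge.
pose i0 := Ordinal (ltnW n1).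
pose w : torus := upd i0 (x i0 - 1) x.
have wx : shift i0 w = x.
  by apply/ffunP => j; rewrite !ffunE eqxx subrK; case: eqP => // ->.
have e1 : hc_mass (fun s => coarse_even K s x) = hc_mass (fun s => coarse_odd K s w).
  rewrite /hc_mass (sum_translate qk lam i0) -wx; apply: eq_bigl => s.
  by rewrite (coarse_even_translate qk).
have cases s : coarse_bad K s w \/ coarse_bad K s x \/ coarse_odd K s w = ~~ coarse_even K s x.
  case: (boolP (coarse_bad K s w)) => bw; [by left|right].
  case: (boolP (coarse_bad K s x)) => bx; [by left|right].
  rewrite (coarse_even_odd qk n1) //; congr negb.
  apply: (linked_coarse (i := i0) qk n1) => //; rewrite -wx; exact: linked_shift.
have bw := coarse_bad1 w; have bx := coarse_bad1 x.
have c := hc_mass_compl (fun s => coarse_even K s x).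
have h1 : hc_mass (fun s => coarse_odd K s w) <=
   hc_mass (fun s => ~~ coarse_even K s x) + (hc_mass (fun s => coarse_bad K s w) + hc_mass (fun s => coarse_bad K s x)).
  apply: le_trans (lerD (lexx _) (hc_mass_or _ _)); apply: le_trans (hc_mass_or _ _).
  by apply: hc_mass_le => s /=; case: (cases s) => [->|[->|->]]; rewrite ?orbT // => ->.
have h2 : hc_mass (fun s => ~~ coarse_even K s x) <=
   hc_mass (fun s => coarse_odd K s w) + (hc_mass (fun s => coarse_bad K s w) + hc_mass (fun s => coarse_bad K s x)).
  apply: le_trans (lerD (lexx _) (hc_mass_or _ _)); apply: le_trans (hc_mass_or _ _).
  by apply: hc_mass_le => s /=; case: (cases s) => [->|[->|->]]; rewrite ?orbT // => ->.
rewrite -e1 in h1 h2; exact: balance_bound bw bx c h1 h2.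
Qed.

Definition plane_coord (u : nat * nat) (i : 'I_n) : nat :=
  if val i == 0%N then u.1 else if val i == 1%N then u.2 else 0%N.

(** Spacing 2 makes the blocks disjoint while neighbouring ones remain [linked]. For coordinates up
    to [r] the blocks do not wrap around, the side being 4 r. *)
Definition plane_site (u : nat * nat) : torus := [ffun i => (2 * plane_coord u i)%:R].

Lemma val_natZ a : val (a%:R : 'I_q.+2) = (a %% q.+2)%N.
Proof. by rewrite Zp_nat. Qed.

Lemma plane_inj u u' y y' : (u.1 <= r)%N -> (u.2 <= r)%N -> (u'.1 <= r)%N -> (u'.2 <= r)%N ->
  translate (plane_site u) y = translate (plane_site u') y' -> u = u' /\ y = y'.
Proof.
move=> h1 h2 h1' h2' /ffunP e.
have qr : (q.+2 = 4 * r)%N by rewrite qk !expnS; lia.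
have r0 : (0 < r)%N by rewrite expn_gt0.
have key i : plane_coord u i = plane_coord u' i /\ y i = y' i.
  have := e i; rewrite !ffunE.
  have sE (b : bool) : step q b = (nat_of_bool b)%:R by case: b.
  rewrite !sE -!natrD => /(congr1 val); rewrite !val_natZ.
  have c (v : nat * nat) : (v.1 <= r)%N -> (v.2 <= r)%N -> (plane_coord v i <= r)%N.
    by move=> ? ?; rewrite /plane_coord; case: ifP => // _; case: ifP.
  have := c u h1 h2; have := c u' h1' h2'.
  move: (plane_coord u i) (plane_coord u' i) => a a' ha' ha.
  rewrite !modn_small ?qr.
  - by case: (y i); case: (y' i) => /=; lia.
  - by case: (y' i) => /=; lia.
  - by case: (y i) => /=; lia.
split; last by apply/ffunP => i; have [] := key i.
have n1 := n_gt1 L_ge.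
have [] := key (Ordinal (ltnW n1)); have [] := key (Ordinal n1).
by rewrite /plane_coord /=; move: u u' {h1 h2 h1' h2' e key} => [? ?] [? ?] /= -> _ -> _.
Qed.

Lemma plane_shift1 a b (h : (0 < n)%N) :
  plane_site (a.+1, b) = shift (Ordinal h) (shift (Ordinal h) (plane_site (a, b))).
Proof.
apply/ffunP => i; rewrite !ffunE eqxx; case: (eqVneq i (Ordinal h)) => [->|ih].
  by rewrite /plane_coord /= !mulnS addnC natrD mulr2n addrA.
rewrite /plane_coord; case: eqP => // i0; case/eqP: ih; exact: val_inj.
Qed.

Lemma plane_shift2 a b (h : (1 < n)%N) :
  plane_site (a, b.+1) = shift (Ordinal h) (shift (Ordinal h) (plane_site (a, b))).
Proof.
apply/ffunP => i; rewrite !ffunE eqxx; case: (eqVneq i (Ordinal h)) => [->|ih].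
  by rewrite /plane_coord /= !mulnS addnC natrD mulr2n addrA.
rewrite /plane_coord; case: eqP => // _; case: eqP => // i0; case/eqP: ih; exact: val_inj.
Qed.

Definition in_plane (u : nat * nat) : bool := (u.1 <= r)%N && (u.2 <= r)%N.

Lemma bad_walk_prob (w : seq (nat * nat)) : uniq w -> all in_plane w ->
  hc_mass (fun s => all (fun u => coarse_bad K s (plane_site u)) w) <= (1 / 100) ^+ size w * Z.
Proof.
move=> uw pw.
have inj : {in w &, injective plane_site}.
  move=> u u' /(allP pw)/andP[a1 a2] /(allP pw)/andP[b1 b2] e.
  by have [] := @plane_inj u u' [ffun=> false] [ffun=> false] a1 a2 b1 b2 (congr1 (@translate _ _ ^~ _) e).
pose S := [set x in map plane_site w].
have cS : #|S| = size w.
  by rewrite cardsE -(size_map plane_site) -(card_uniqP _) // map_inj_in_uniq.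
have := coarse_bad_prob qk lam_gt0 L_ge th_large M_large (S := S); rewrite cS => h.
apply: le_trans (h _).
  apply: hc_mass_le => s /allP b; apply/forall_inP => x; rewrite inE => /mapP[u uw' ->].
  exact: b.
move=> x x' y y'; rewrite !inE => /mapP[u uw' ->] /mapP[u' uw'' ->].
have /andP[a1 a2] := allP pw _ uw'; have /andP[b1 b2] := allP pw _ uw''.
by move=> /plane_inj -/(_ a1 a2 b1 b2) [-> ->].
Qed.

Lemma geometric_le (x : R) m : 0 <= x -> x < 1 -> \sum_(i < m) x ^+ i <= (1 - x)^-1.
Proof.
move=> x0 x1; rewrite -[leRHS]mul1r ler_pdivlMr ?subr_gt0 //.
rewrite mulrC -opprB mulNr -subrX1 opprB.
by have := exprn_ge0 m x0; lra.
Qed.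

(** A contour with m steps is one of 9^m walks and has m + 1 bad blocks. Replacing the minimum by
    both alternatives gives two geometric series of ratio 9/100, with total at most 2/91. *)
Lemma contour_sum : \sum_(i < r.+1) 9 ^+ minn i (r - i) * (1 / 100) ^+ (minn i (r - i)).+1 <= 1 / 40 :> R.
Proof.
apply: le_trans (_ : \sum_(i < r.+1) (1 / 100) * ((9 / 100) ^+ i + (9 / 100) ^+ (r - i)) <= _).
  apply: ler_sum => i _; rewrite exprS mulrCA -exprMn mulrA mulr1.
  rewrite ler_wpM2l //; set m := minn _ _.
  have p0 j : 0 <= (9 / 100) ^+ j :> R by rewrite exprn_ge0.
  by rewrite /m /minn; case: ifP => _; rewrite ?lerDl ?lerDr.
rewrite -mulr_sumr big_split /=.
rewrite [X in _ + X](reindex_inj rev_ord_inj) /=.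
rewrite [X in _ + X](eq_bigr (fun i : 'I_r.+1 => (9 / 100) ^+ i)); last first.
  by move=> i _; congr (_ ^+ _); rewrite subSS subKn // -ltnS.
have g : \sum_(i < r.+1) (9 / 100) ^+ i <= (1 - 9 / 100)^-1 :> R by apply: geometric_le; lra.
have e : (1 - 9 / 100)^-1 = 100 / 91 :> R by field.
rewrite e in g; lra.
Qed.

Theorem peierls :
  hc_mass (fun s => coarse_even K s (plane_site (0, 0)%N) != coarse_even K s (plane_site (r, 0)%N))
    <= 1 / 40 * Z.
Proof.
have n1 := n_gt1 L_ge.
have Zge0 : 0 <= Z by apply: sumr_ge0 => s _; exact: hc_weight_ge0.
pose walk (i : nat) (c : seq 'I_9) := (i, 0%N) :: star_walk (i, 0%N) c.
pose P (i : 'I_r.+1) s := [exists c : (minn i (r - i)).-tuple 'I_9,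
  [&& uniq (walk i c), all in_plane (walk i c) & all (fun u => coarse_bad K s (plane_site u)) (walk i c)]].
apply: le_trans (_ : hc_mass (fun s => [exists i, P i s]) <= _).
  apply: hc_mass_le => s ne.
  have [||//|i [p [ir sp pp up ap]]] :=
      @contour_exists r (fun a b => coarse_bad K s (plane_site (a, b)))
        (fun a b => coarse_even K s (plane_site (a, b))).
  - move=> i j _ _ b1 b2; apply: (linked_coarse (i := Ordinal (ltnW n1)) qk n1) => //.
    by rewrite (plane_shift1 _ _ (ltnW n1)); exact: linked_shift2.
  - move=> i j _ _ b1 b2; apply: (linked_coarse (i := Ordinal n1) qk n1) => //.
    by rewrite (plane_shift2 _ _ n1); exact: linked_shift2.
  have [c pc] := star_walkP pp; rewrite sp in c pc.
  apply/existsP; exists (Ordinal (ir : (i < r.+1)%N)); apply/existsP; exists c.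
  rewrite /walk /= -pc; apply/and3P; split => //.
    by apply: sub_all ap => u /and3P[h1 h2 _]; rewrite /in_plane h1.
  by apply: sub_all ap => -[a b] /and3P[_ _].
apply: le_trans (hc_mass_exists _) _.
rewrite -[leRHS]mulrC; apply: le_trans (ler_wpM2l Zge0 contour_sum).
rewrite mulr_sumr; apply: ler_sum => i _.
apply: le_trans (hc_mass_exists _) _.
set m := minn i (r - i).
apply: le_trans (_ : \sum_(c : m.-tuple 'I_9) (1 / 100) ^+ m.+1 * Z <= _).
  apply: ler_sum => c _.
  case: (boolP (uniq (walk i c))) => uw; last first.
    rewrite /hc_mass big1 ?mulr_ge0 ?exprn_ge0 //.
  case: (boolP (all in_plane (walk i c))) => aw; last first.
    by rewrite /hc_mass big1 ?mulr_ge0 ?exprn_ge0 // => s; rewrite andbF.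
  by have := bad_walk_prob uw aw; rewrite /= size_star_walk size_tuple.
rewrite sumr_const card_tuple card_ord -[leLHS]mulr_natl natrX; lra.
Qed.

End LongRangeOrder.

From mathcomp Require Import boolp classical_sets.

(** * Probability measures on configurations *)

Section Determined.
Local Open Scope classical_set_scope.
Variable T : eqType.
Implicit Types (s : seq T) (A B : set (config T)).

Definition determined s A : Prop :=
  forall w w' : T -> bool, {in s, w =1 w'} -> A w -> A w'.

Definition setv (v : T) (b : bool) (w : T -> bool) : T -> bool :=
  fun u => if u == v then b else w u.

Lemma measurable_coord (v : T) (b : bool) : measurable ([set w | w v = b] : set (config T)).
Proof. by apply: sub_sigma_algebra; exists v, b. Qed.

Lemma determined_measurable s A : determined s A -> measurable A.
Proof.
elim: s A => [|v s IH] A dA.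
  case: (pselect (exists w, A w)) => [[w Aw]|nA].
    rewrite (_ : A = setT); first exact: measurableT.
    by apply/seteqP; split => // w' _; apply: dA Aw.
  rewrite (_ : A = set0); first exact: measurable0.
  by apply/seteqP; split => // w Aw; apply: nA; exists w.
pose Ab b : set (config T) := [set w | A (setv v b w)].
have mAb b : measurable (Ab b).
  apply: IH => w w' ww' /=; apply: dA => u us; rewrite /setv.
  by case: eqP => // /eqP uv; apply: ww'; move: us; rewrite inE (negPf uv).
have setv_id w b : w v = b -> setv v b w = w.
  by move=> <-; apply/funext => u; rewrite /setv; case: eqP => // ->.
rewrite (_ : A = ([set w | w v = true] `&` Ab true) `|` ([set w | w v = false] `&` Ab false)).
  by apply: measurableU; apply: measurableI => //; exact: measurable_coord.
apply/seteqP; split => w /=.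
  by move=> Aw; case wv: (w v); [left|right]; split=> //; rewrite /Ab /= setv_id.
by case=> -[wv]; rewrite /Ab /= setv_id.
Qed.

Lemma determinedI s s' A B : determined s A -> determined s' B -> determined (s ++ s') (A `&` B).
Proof.
move=> dA dB w w' ww' [Aw Bw]; split.
  by apply: dA Aw => u us; apply: ww'; rewrite mem_cat us.
by apply: dB Bw => u us; apply: ww'; rewrite mem_cat us orbT.
Qed.

End Determined.

Lemma pushforward_measure d1 d2 (T1 : measurableType d1) (T2 : measurableType d2)
    (R : realType) (m : {measure set T1 -> \bar R}) (f : T1 -> T2) :
  measurable_fun setT f ->
  (exists m' : {measure set T2 -> \bar R}, forall A, m' A = m (f @^-1` A)%classic) /\
  (m setT = 1%E -> exists P : probability T2 R, forall A, P A = m (f @^-1` A)%classic).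
Proof.
move=> mf.
have mp (A : set T2) : measurable A -> measurable (f @^-1` A)%classic.
  by move=> mA; rewrite -[X in measurable X]setTI; exact: mf.
pose g (A : set T2) := m (f @^-1` A)%classic.
have g0 : g set0 = 0%E by rewrite /g preimage_set0 measure0.
have gpos A : (0 <= g A)%E by exact: measure_ge0.
have gsig : semi_sigma_additive g.
  move=> F mF tF mU; rewrite /g preimage_bigcup; apply: measure_semi_sigma_additive.
  - by move=> n; exact: mp.
  - apply/trivIsetP => /= i j _ _ ij; rewrite -preimage_setI.
    by move/trivIsetP : tF => /(_ _ _ _ _ ij) ->//; rewrite preimage_set0.
  - by rewrite -preimage_bigcup; exact: mp.
pose M := isMeasure.Build _ _ _ g g0 gpos gsig.
pose m' : {measure set T2 -> \bar R} := HB.pack g M.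
split=> [|m1]; first by exists m'.
have g1 : m' setT = 1%E by rewrite -[LHS]/(g setT) /g preimage_setT.
pose P : probability T2 R := HB.pack g M (Measure_isProbability.Build _ _ _ m' g1).
by exists P.
Qed.

(** * Probability measures from finitely additive set functions *)

Section Extension.
Local Open Scope classical_set_scope.
Variables (R : realType) (V : countType) (p : set (V -> bool) -> R).
Hypothesis p_ge0 : forall A, 0 <= p A.
Hypothesis pT : p setT = 1.
Hypothesis pU : forall A B, A `&` B = set0 -> p (A `|` B) = p A + p B.
Implicit Types (r : seq bool) (w : V -> bool).

Lemma p_set0 : p set0 = 0.
Proof. by have := pU (set0I set0); rewrite setU0 => h; apply: (addrI (p set0)); rewrite addr0. Qed.

Definition bit n w : bool := if pickle_inv n is Some v then w v else false.

(* The binary word [r] lists the first [size r] bits of a configuration, last bit first. *)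
Fixpoint cyl r : set (V -> bool) :=
  if r is b :: r' then cyl r' `&` [set w | bit (size r') w = b] else setT.

Fixpoint lo r : R :=
  if r is b :: r' then lo r' + (if b then p (cyl (false :: r')) else 0) else 0.

Lemma p_split (A : set (V -> bool)) n :
  p A = p (A `&` [set w | bit n w = true]) + p (A `&` [set w | bit n w = false]).
Proof.
rewrite -pU.
  rewrite -setIUr (_ : _ `|` _ = setT) ?setIT //.
  by apply/seteqP; split => // w _ /=; case: (bit n w); [left|right].
by rewrite setIACA setIid (_ : _ `&` [set w | _] = set0) ?setI0 //; apply/seteqP; split => // w /= [->].
Qed.

Lemma cyl_split r : p (cyl r) = p (cyl (true :: r)) + p (cyl (false :: r)).
Proof. exact: p_split. Qed.

(* The point [x] of [0, 1[ is expanded along the nested partitions into intervals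
   of lengths [p (cyl r)]. *)
Fixpoint digits n (x : R) : seq bool :=
  if n is n'.+1 then (lo (true :: digits n' x) <= x) :: digits n' x else [::].

Lemma size_digits n x : size (digits n x) = n.
Proof. by elim: n => //= n ->. Qed.

Lemma digits_itv n x : 0 <= x < 1 ->
  lo (digits n x) <= x < lo (digits n x) + p (cyl (digits n x)).
Proof.
move=> x01; elim: n => [|n /andP[h1 h2]] /=; first by rewrite add0r pT.
rewrite cyl_split /= in h2.
case: (leP (lo (digits n x) + p (cyl (digits n x) `&` [set w | bit (size (digits n x)) w = false])) x) => h3.
  by rewrite h3 /= -addrA [X in _ + X]addrC.
by rewrite addr0 h1.
Qed.

Lemma digits_eq r x : lo r <= x < lo r + p (cyl r) -> digits (size r) x = r.
Proof.
elim: r => // b r IH /= /andP[h1 h2].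
have pt := p_ge0 (cyl (true :: r)); have pf := p_ge0 (cyl (false :: r)).
have cs := cyl_split r; rewrite /= in pt pf cs.
have hr : lo r <= x < lo r + p (cyl r).
  by rewrite cs; case: b h1 h2 => h1 h2; apply/andP; split; lra.
rewrite (IH hr); congr cons; rewrite /=; case: b h1 h2 => h1 h2 //.
by apply/negbTE; rewrite -ltNge; lra.
Qed.

Lemma lo_bounds r : 0 <= lo r /\ lo r + p (cyl r) <= 1.
Proof.
elim: r => [|b r [h1 h2]] /=; first by rewrite add0r pT.
have pt := p_ge0 (cyl (true :: r)); have pf := p_ge0 (cyl (false :: r)).
have cs := cyl_split r; rewrite /= in pt pf cs.
by case: b; lra.
Qed.

Definition decode (x : R) : config V := fun v => head false (digits (choice.pickle v).+1 x).

Lemma bit_decode x i : 0 <= x < 1 -> bit i (decode x) = head false (digits i.+1 x).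
Proof.
move=> x01; rewrite /bit; case e: (pickle_inv i) => [v|].
  by have := @pickle_invK V i; rewrite e /= /decode => ->.
(* If [i] codes no vertex, the cylinder with bit false is the whole previous cylinder, and [x] lies
   below the right end of its interval. *)
rewrite /=; apply/esym/negbTE; rewrite -ltNge.
have /andP[_] := digits_itv i x01; congr (_ < _ + _); congr p.
by apply/seteqP; split => [w cw|w [] //]; split => //=; rewrite /bit size_digits e.
Qed.

Lemma cyl_decode r x : 0 <= x < 1 -> cyl r (decode x) <-> digits (size r) x = r.
Proof.
move=> x01; elim: r => [|b r IH] //=.
have e : bit (size r) (decode x) = (lo (true :: digits (size r) x) <= x) by rewrite bit_decode.
split=> [[/IH er eb]|[hb er]].
  by rewrite -[in RHS]eb e er.
by split; [exact/IH | rewrite /= e -hb].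
Qed.

Lemma measurable_digits n r : measurable [set x : R | digits n x = r].
Proof.
elim: n r => [|n IH] r.
  case: r => [|b r]; first by rewrite (_ : [set _ | _] = setT) //; apply/seteqP; split.
  by rewrite (_ : [set _ | _] = set0) //; apply/seteqP; split.
case: r => [|b r]; first by rewrite (_ : [set _ | _] = set0) //; apply/seteqP; split.
rewrite (_ : [set x | _] = [set x | digits n x = r] `&`
   (if b then `[lo (true :: r), +oo[ else ~` `[lo (true :: r), +oo[)).
  apply: measurableI => //; case: b; [|apply: measurableC]; exact: measurable_itv.
apply/seteqP; split => x /=.
  move=> [<- e]; rewrite -e; split => //.
  by case: leP => h /=; rewrite in_itv /= andbT // leNgt h.
move=> [e]; rewrite e; case: b => /=; rewrite in_itv /= andbT => h; first by rewrite h.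
by move/negP/negbTE: h => ->.
Qed.

Lemma measurable_decode : measurable_fun setT decode.
Proof.
apply: (@measurability _ _ _ (config V) _ _ (@cylinders V)) => //.
move=> _ [_ [v [b ->]] <-]; rewrite setTI.
rewrite (_ : _ @^-1` _ = \bigcup_(r in [set: seq bool])
   (if head false r == b then [set x : R | digits (choice.pickle v).+1 x = r] else set0)).
  apply: countable_bigcupT_measurable; first exact: countableP.
  by move=> r; case: ifP => _ //; exact: measurable_digits.
apply/seteqP; split => x /=.
  by move=> h; exists (digits (choice.pickle v).+1 x) => //; rewrite -/(decode x v) h eqxx.
by move=> [r _]; case: eqP => // hb /= e; rewrite -hb -e.
Qed.

(** Lebesgue measure on [0, 1[ is pushed forward by [decode], under which the preimage of a cylinder
    is an interval of length [p]. An event determined by finitely many sites is split bit by bit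
    until every cylinder lies inside it or misses it. *)
Lemma extension_exists : exists mu : probability (config V) R,
  forall s (A : set (config V)), determined s A -> mu A = (p A)%:E.
Proof.
have m01 : measurable (`[0, 1[ : set R) by exact: measurable_itv.
have restr1 : mrestr (@lebesgue_measure R) m01 setT = 1%E.
  by rewrite /mrestr setTI lebesgue_measure_itv /= lte_fin ltr01 oppr0 addr0.
have [mu muE] := (pushforward_measure (mrestr (@lebesgue_measure R) m01) measurable_decode).2 restr1.
exists mu => s A dA.
have mA := determined_measurable dA.
have bitv (v : V) (w : V -> bool) : bit (choice.pickle v) w = w v by rewrite /bit pickleK_inv.
have mbit n b : measurable ([set w | bit n w = b] : set (config V)).
  rewrite /bit; case: (pickle_inv n) => [v|]; first exact: measurable_coord.
  case: b; first by rewrite (_ : [set _ | _] = set0) //; apply/seteqP; split.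
  by rewrite (_ : [set _ | _] = setT) //; apply/seteqP; split.
have mcyl r : measurable (cyl r : set (config V)).
  by elim: r => [|b r IH] /=; [exact: measurableT | exact: measurableI].
have mucyl r : mu (cyl r) = (p (cyl r))%:E.
  rewrite muE /= /mrestr.
  rewrite (_ : _ `&` _ = `[lo r, lo r + p (cyl r)[%classic); last first.
    have [l0 l1] := lo_bounds r.
    apply/seteqP; split => x /=.
      move=> [cx]; rewrite !in_itv /= => x01; move/(cyl_decode _ x01): cx => e.
      by have := digits_itv (size r) x01; rewrite e.
    rewrite !in_itv /= => h; have x01 : 0 <= x < 1.
      by case/andP: h => h1 h2; rewrite (le_trans l0 h1) (lt_le_trans h2 l1).
    by split => //; apply/(cyl_decode _ x01); exact: digits_eq.
  rewrite lebesgue_measure_itv /= lte_fin ltrDl.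
  case: ltP => [_|h]; first by rewrite -EFinB addrC addKr.
  by congr EFin; apply/eqP; rewrite eq_le h p_ge0.
pose n := (\max_(v <- s) choice.pickle v).+1.
have dn w w' : (forall i, (i < n)%N -> bit i w = bit i w') -> A w -> A w'.
  move=> h; apply: dA => v vs; rewrite -(bitv v w) -(bitv v w'); apply: h.
  by rewrite ltnS (big_rem v) //= leq_maxl.
have cyl_agree r w w' : cyl r w -> cyl r w' -> forall i, (i < size r)%N -> bit i w = bit i w'.
  elim: r => // b r IH [h1 h2] [h1' h2'] i; rewrite ltnS leq_eqVlt => /orP[/eqP ->|]; last exact: IH.
  by rewrite h2 h2'.
have main j r : (size r + j = n)%N -> mu (A `&` cyl r) = (p (A `&` cyl r))%:E.
  elim: j r => [|j IH] r hr.
    rewrite addn0 in hr.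
    case: (pselect (exists w, A w /\ cyl r w)) => [[w [Aw cw]]|none].
      rewrite (_ : A `&` cyl r = cyl r) //; apply/seteqP; split => [? []//|w' cw'].
      by split => //; apply: dn Aw => i; rewrite -hr; exact: cyl_agree.
    rewrite (_ : A `&` cyl r = set0) ?measure0 ?p_set0 //.
    by apply/seteqP; split => // w ?; apply: none; exists w.
  have st := p_split (A `&` cyl r) (size r).
  have h b : mu (A `&` cyl r `&` [set w | bit (size r) w = b]) =
      (p (A `&` cyl r `&` [set w | bit (size r) w = b]))%:E.
    by rewrite -setIA; apply: (IH (b :: r)); rewrite /= addSnnS.
  rewrite st EFinD -!h -measureU.
  - rewrite -setIUr (_ : _ `|` _ = setT) ?setIT //.
    by apply/seteqP; split => // w _ /=; case: (bit _ w); [left|right].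
  - by apply: measurableI => //; exact: measurableI.
  - by apply: measurableI => //; exact: measurableI.
  rewrite setIACA setIid (_ : [set w | bit _ w = true] `&` _ = set0) ?setI0 //.
  by apply/seteqP; split => // w /= [->].
by have := main n [::] (add0n n); rewrite /= setIT.
Qed.

End Extension.

From mathcomp Require Import boolp classical_sets measurable_realfun.

(** * From ratios of masses to the hard-core property *)

Section Gibbs.
Local Open Scope classical_set_scope.
Variables (R : realType) (V : countType) (e : rel V) (nbr : V -> seq V) (lam : R).
Hypothesis nbrP : forall u v, e u v || e v u -> v \in nbr u.
Hypothesis lam_gt0 : 0 < lam.
Variable p : set (V -> bool) -> R.
Hypothesis p_ge0 : forall A, 0 <= p A.
Hypothesis pT : p setT = 1.
Hypothesis pU : forall A B, A `&` B = set0 -> p (A `|` B) = p A + p B.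
Implicit Types (W : {fset V}) (w : V -> bool).

Definition patch W (w1 : {ffun W -> bool}) w : V -> bool :=
  fun v => if insub v is Some x then w1 x else w v.

(** Only the edges meeting [W] are tested, so this depends on finitely many sites, in contrast to
    [feasible]. *)
Definition locally_feasible W (w1 : {ffun W -> bool}) w : Prop :=
  forall u v, u \in W -> e u v || e v u -> ~~ (patch w1 w u && patch w1 w v).

Hypothesis p_edge : forall u v, e u v -> p [set w | w u && w v] = 0.

(** The Gibbs property without normalising constants. It is linear in [p], so it passes from the
    tori to the limit. *)
Hypothesis p_dlr : forall W (w1 w1' : {ffun W -> bool}) (s : seq V) (A : set (V -> bool)),
  determined s A ->
  (forall w w', (forall v, v \notin W -> w v = w' v) -> A w -> A w') ->
  (forall w, A w -> locally_feasible w1 w /\ locally_feasible w1' w) ->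
  p (agree w1 `&` A) * weight lam w1' = p (agree w1' `&` A) * weight lam w1.

Lemma p_mono A B : A `<=` B -> p A <= p B.
Proof.
move=> AB; have -> : B = A `|` (B `\` A) by rewrite setDUK.
by rewrite pU ?lerDl // setDIK.
Qed.

Lemma p_partition (I : finType) (phi : (V -> bool) -> I) (A : set (V -> bool)) :
  p A = \sum_i p (A `&` [set w | phi w = i]).
Proof.
have main (s : seq I) : uniq s ->
    p (A `&` [set w | phi w \in s]) = \sum_(i <- s) p (A `&` [set w | phi w = i]).
  elim: s => [_|i s IH /= /andP[nis us]].
    rewrite big_nil (_ : _ `&` _ = set0) ?(p_set0 pU) //.
    by apply/seteqP; split => // w [].
  rewrite big_cons -IH // -pU.
    congr p; apply/seteqP; split => w /=.
      by move=> [Aw]; rewrite inE => /predU1P[h|h]; [left|right].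
    by move=> [[Aw h]|[Aw h]]; split => //; rewrite inE ?h ?eqxx ?orbT.
  apply/seteqP; split => // w /= [[_ h1] [_ h]].
  by move: nis; rewrite -h1 h.
rewrite -main ?index_enum_uniq // (_ : [set w | _] = setT) ?setIT //.
by apply/seteqP; split => // w _ /=; rewrite mem_index_enum.
Qed.

Definition inside W w : {ffun W -> bool} := [ffun v => w (val v)].

Lemma agreeE W (w1 : {ffun W -> bool}) : agree w1 = [set w | inside W w = w1].
Proof.
apply/seteqP; split => w /=.
  by move=> h; apply/ffunP => v; rewrite ffunE; exact: h.
by move=> <- v; rewrite ffunE.
Qed.

Lemma determined_agree W (w1 : {ffun W -> bool}) : determined (enum_fset W) (agree w1).
Proof. by move=> w w' h aw v; rewrite -aw; apply/esym/h; exact: fsvalP. Qed.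

Lemma patch_agree W (w1 : {ffun W -> bool}) w : agree w1 w -> patch w1 w = w.
Proof.
move=> h; apply/funext => v; rewrite /patch; case: insubP => // x _ <-.
by rewrite h.
Qed.

Definition local_spec W (w1 : {ffun W -> bool}) w : R :=
  if `[< locally_feasible w1 w >]
  then weight lam w1 / \sum_(w1' : {ffun W -> bool} | `[< locally_feasible w1' w >]) weight lam w1'
  else 0.

Lemma weight_gt0 W (w1 : {ffun W -> bool}) : 0 < weight lam w1.
Proof. by apply: prodr_gt0 => v _; rewrite exprn_gt0. Qed.

Definition rim W : seq V := [seq v <- flatten [seq nbr u | u <- enum_fset W] | v \notin W].

Lemma locally_feasible_rim W (w1 : {ffun W -> bool}) w w' : {in rim W, w =1 w'} ->
  locally_feasible w1 w -> locally_feasible w1 w'.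
Proof.
move=> ww' h u v uW euv; have := h u v uW euv.
have pe x : x \in W \/ x \in rim W -> patch w1 w x = patch w1 w' x.
  rewrite /patch; case: insubP => // xW [h1|]; first by move: xW; rewrite h1.
  exact: ww'.
rewrite (pe u); last by left.
rewrite (pe v) //; case: (boolP (v \in W)) => vW; [by left|right].
rewrite mem_filter vW; apply/flattenP; exists (nbr u); first by apply: map_f.
exact: nbrP.
Qed.

Lemma local_spec_rim W (w1 : {ffun W -> bool}) w w' : {in rim W, w =1 w'} ->
  local_spec w1 w = local_spec w1 w'.
Proof.
move=> ww'.
have e1 (x : {ffun W -> bool}) : `[< locally_feasible x w >] = `[< locally_feasible x w' >].
  apply/asboolP/asboolP; apply: locally_feasible_rim => // v vr.
  by rewrite ww'.
by rewrite /local_spec e1; under eq_bigl do rewrite e1.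
Qed.

Lemma infeasible_null W (w1 : {ffun W -> bool}) w0 A :
  (forall w, A w -> {in rim W, w0 =1 w}) -> ~ locally_feasible w1 w0 -> p (agree w1 `&` A) = 0.
Proof.
move=> hA nf; apply/eqP; rewrite eq_le p_ge0 andbT.
have [u [v [uW [euv h]]]] : exists u v, u \in W /\ (e u v || e v u /\ patch w1 w0 u && patch w1 w0 v).
  apply: contrapT => n; apply: nf => u v uW euv; apply/negP => h; apply: n.
  by exists u, v.
have sub : agree w1 `&` A `<=` [set w | w u && w v].
  move=> w [aw Aw] /=; rewrite -(patch_agree aw).
  have pe x : x \in W \/ x \in rim W -> patch w1 w x = patch w1 w0 x.
    rewrite /patch; case: insubP => // xW [h1|]; first by move: xW; rewrite h1.
    by move=> xr; rewrite (hA w Aw).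
  rewrite (pe u); last by left.
  rewrite (pe v) //; case: (boolP (v \in W)) => vW; [by left|right].
  rewrite mem_filter vW; apply/flattenP; exists (nbr u); first by apply: map_f.
  exact: nbrP.
apply: le_trans (p_mono sub) _; case/orP: euv => euv; first by rewrite p_edge.
rewrite (_ : [set w | _] = [set w | w v && w u]) ?p_edge //.
by apply/seteqP; split => x /=; rewrite andbC.
Qed.

Lemma p_local_spec W (w1 : {ffun W -> bool}) (s : seq V) w0 A :
  determined s A -> (forall w w', (forall v, v \notin W -> w v = w' v) -> A w -> A w') ->
  (forall w, A w -> {in rim W, w0 =1 w}) ->
  p (agree w1 `&` A) = local_spec w1 w0 * p A.
Proof.
move=> dA iA hA; rewrite /local_spec; case: asboolP => lf; last first.
  by rewrite mul0r; exact: infeasible_null hA lf.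
set Z := \sum_(_ | _) _.
have Z0 : 0 < Z.
  rewrite /Z (bigD1 w1) /=; last by apply/asboolP.
  by rewrite ltr_pwDl ?weight_gt0 // sumr_ge0 // => x _; rewrite ltW // weight_gt0.
have Zn : Z != 0 by rewrite gt_eqF.
apply: (mulIf Zn); rewrite [RHS]mulrAC divfK //.
rewrite (p_partition (inside W) A) mulr_sumr mulr_sumr.
rewrite [RHS](bigID (fun x => `[< locally_feasible x w0 >])) /= [X in _ + X]big1 ?addr0.
  apply: eq_bigr => x /asboolP lx.
  have hx w : A w -> locally_feasible w1 w /\ locally_feasible x w.
    by move=> Aw; split; apply: locally_feasible_rim (hA w Aw) _.
  have -> : A `&` [set w | inside W w = x] = agree x `&` A by rewrite agreeE setIC.
  by rewrite (p_dlr dA iA hx) mulrC.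
move=> x /asboolP lx.
have -> : A `&` [set w | inside W w = x] = agree x `&` A by rewrite agreeE setIC.
by rewrite (infeasible_null hA lx) mulr0.
Qed.

Section Measure.
Variable mu : probability (config V) R.
Hypothesis mu_p : forall s (A : set (config V)), determined s A -> mu A = (p A)%:E.

Definition extend W (w2 : config (outside W)) : V -> bool :=
  fun v => if insub v is Some y then w2 y else false.

Lemma extend_restr W w v : v \notin W -> extend (restr W w) v = w v.
Proof. by move=> vW; rewrite /extend insubT. Qed.

Lemma glueE W (w1 : {ffun W -> bool}) (w2 : config (outside W)) :
  glue_config w1 w2 = patch w1 (extend w2).
Proof. by []. Qed.

Lemma patch_extend W (w1 : {ffun W -> bool}) w : patch w1 (extend (restr W w)) = patch w1 w.
Proof.
by apply/funext => v; rewrite /patch; case: insubP => // vW; rewrite extend_restr.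
Qed.

Lemma local_spec_restr W (w1 : {ffun W -> bool}) w :
  local_spec w1 (extend (restr W w)) = local_spec w1 w.
Proof.
apply: local_spec_rim => v; rewrite mem_filter => /andP[vW _]; exact: extend_restr.
Qed.

Lemma measurable_restr W : measurable_fun setT (restr W : config V -> config (outside W)).
Proof.
apply: (@measurability _ _ _ (config (outside W)) _ _ (@cylinders (outside W))) => //.
move=> _ [_ [v [b ->]] <-]; rewrite setTI.
exact: (measurable_coord (val v) b).
Qed.

Lemma measurable_restr_preimage W (A : set (config (outside W))) : measurable A ->
  measurable (restr W @^-1` A : set (config V)).
Proof. by move=> mA; rewrite -[X in measurable X]setTI; exact: measurable_restr. Qed.

Lemma measurable_local_spec W (w1 : {ffun W -> bool}) :
  measurable_fun setT (fun w2 : config (outside W) => local_spec w1 (extend w2)).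
Proof.
move=> _ Y mY; rewrite setTI.
apply: (@determined_measurable _ (pmap insub (rim W))) => w w' ww' /=.
suff -> : local_spec w1 (extend w) = local_spec w1 (extend w') by [].
apply: local_spec_rim => v vr; rewrite /extend; case: insubP => // y vW yv.
by apply: ww'; rewrite mem_pmap_sub yv.
Qed.

Definition rim_pattern W w : (size (rim W)).-tuple bool := map_tuple w (in_tuple (rim W)).

Definition rim_set W (t : (size (rim W)).-tuple bool) : set (config V) := [set w | rim_pattern W w = t].

Lemma rim_patternP W w w' : {in rim W, w =1 w'} <-> rim_pattern W w = rim_pattern W w'.
Proof.
split=> [h|/(congr1 val) /= h]; first by apply/val_inj/eq_in_map.
exact/eq_in_map.
Qed.

Lemma determined_rim_set W (t : (size (rim W)).-tuple bool) : determined (rim W) (rim_set t).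
Proof. by move=> w w' /rim_patternP h; rewrite /rim_set /= h. Qed.

Lemma determined_restr W (s : seq (outside W)) (A : set (config (outside W))) :
  determined s A -> determined (map val s) (restr W @^-1` A : set (config V)).
Proof.
move=> dA w w' h; apply: dA => v vs; apply: h; exact: map_f.
Qed.

(** Both sides are finite measures in [A]. By [p_local_spec] they agree on the events determined by
    finitely many sites, a generating class closed under intersection. *)
Lemma cond_rim W (w1 : {ffun W -> bool}) w0 (A : set (config (outside W))) : measurable A ->
  mu (agree w1 `&` (restr W @^-1` A `&` rim_set (rim_pattern W w0))) =
  ((local_spec w1 w0)%:E * mu (restr W @^-1` A `&` rim_set (rim_pattern W w0)))%E.
Proof.
set D := rim_set _ => mA.
have mD : measurable D by apply: (@determined_measurable _ (rim W)); exact: determined_rim_set.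
have magree : measurable (agree w1 : set (config V)) by apply: determined_measurable; exact: determined_agree.
have mD1 : measurable (agree w1 `&` D) by exact: measurableI.
have [m1 m1E] := (pushforward_measure (mrestr mu mD1) (@measurable_restr W)).1.
have [m2 m2E] := (pushforward_measure (mrestr mu mD) (@measurable_restr W)).1.
have c0 : 0 <= local_spec w1 w0.
  rewrite /local_spec; case: ifP => // _; rewrite divr_ge0 ?(ltW (weight_gt0 _)) ?sumr_ge0 // => x _.
  by rewrite ltW // weight_gt0.
pose m3 := mscale (NngNum c0) m2.
have m1A (B : set (config (outside W))) : m1 B = mu (agree w1 `&` (restr W @^-1` B `&` D)).
  by rewrite m1E /= /mrestr setICA.
have m3A (B : set (config (outside W))) : m3 B = ((local_spec w1 w0)%:E * mu (restr W @^-1` B `&` D))%E.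
  by rewrite /m3 /= /mscale /= m2E.
rewrite -m1A -m3A.
pose G : set (set (config (outside W))) := [set B | exists s, determined s B].
apply: (@measure_unique _ R (config (outside W)) G (fun=> setT)) => //.
- apply/seteqP; split.
    apply: smallest_sub; first exact: smallest_sigma_algebra.
    move=> B [v [b ->]]; apply: sub_sigma_algebra; exists [:: v] => w w' h /= <-.
    by apply/esym/h; rewrite inE.
  apply: smallest_sub; first exact: sigma_algebra_measurable.
  by move=> B [s dB]; exact: (determined_measurable dB).
- move=> A1 A2 [s1 d1] [s2 d2]; exists (s1 ++ s2); exact: determinedI.
- by move=> _; exists [::].
- by rewrite bigcup_const.
- move=> B [s dB].
  have dD : determined (rim W) D by apply: determined_rim_set.
  have dR := determinedI (determined_restr dB) dD.
  rewrite [RHS]m3A [LHS]m1A (mu_p dR) (mu_p (determinedI (@determined_agree W w1) dR)) -EFinM; congr EFin.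
  apply: p_local_spec dR _ _.
    move=> w w' h [Bw Dw]; split.
      suff e' : restr W w = restr W w' by rewrite /= -e'.
      by apply/funext => v; apply: h; exact: (valP v).
    rewrite /D /rim_set /= -Dw; apply/esym/rim_patternP => v; rewrite mem_filter => /andP[vW _].
    exact: h.
  by move=> w [_ Dw]; apply/rim_patternP.
by move=> k; rewrite m1A; apply: le_lt_trans (probability_le1 _ _) _; rewrite ?ltry //;
  apply: measurableI => //; apply: measurableI => //; exact: measurable_restr_preimage.
Qed.

(** The version of the conditional probability is [local_spec], constant on each of the finitely
    many rim events. It coincides with [specification] on feasible configurations, which have full
    measure because there are countably many edges, each null. *)
Lemma hard_core_of_dlr : hard_core e lam mu.
Proof.
move=> W w1; exists (fun w2 : config (outside W) => local_spec w1 (extend w2)).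
  split; first exact: measurable_local_spec.
  move=> A mA; have mPA := measurable_restr_preimage mA.
  under eq_integral do rewrite local_spec_restr.
  have magree : measurable (agree w1 : set (config V)) by apply: determined_measurable; exact: determined_agree.
  have mrim (t : (size (rim W)).-tuple bool) : measurable (rim_set t) by apply: (@determined_measurable _ (rim W)); exact: determined_rim_set.
  pose F (t : (size (rim W)).-tuple bool) := restr W @^-1` A `&` rim_set t.
  have mF t : measurable (F t) by exact: measurableI.
  pose I := index_enum ((size (rim W)).-tuple bool).
  have Iu : uniq I by exact: index_enum_uniq.
  have cover : restr W @^-1` A = \big[setU/set0]_(t <- I) F t.
    apply/seteqP; split => w.
      move=> Aw; rewrite -bigcup_seq; exists (rim_pattern W w) => //=.
      exact: mem_index_enum.
    by rewrite -bigcup_seq => -[t _ []].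
  have tF : trivIset [set` I] F.
    by apply/trivIsetP => t t' _ _ tt'; apply/seteqP; split => // w [[_ h1] [_ h2]]; move: tt'; rewrite -h1 -h2 eqxx.
  have mu_sum (B : set (config V)) : measurable B ->
      mu (B `&` restr W @^-1` A) = (\sum_(t <- I) mu (B `&` F t))%E.
    move=> mB; rewrite cover.
    elim: I Iu tF {cover} => [_ _|t I' IH /= /andP[nt u'] tF]; first by rewrite !big_nil setI0 measure0.
    have tI' : trivIset [set` I'] F by apply: sub_trivIset tF => x /= h; rewrite inE h orbT.
    rewrite !big_cons setIUr measureU.
    - by congr (_ + _)%E; exact: IH.
    - exact: measurableI.
    - by apply: measurableI => //; apply: bigsetU_measurable.
    - apply/seteqP; split => // w [[_ Fw] [_]]; rewrite -bigcup_seq => -[t' /= t'I F'w].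
      by move: F'w Fw => [_ h1] [_ h2]; move: nt; rewrite -h2 h1 t'I.
  rewrite (mu_sum _ magree) cover ge0_integral_bigsetU //; first last.
  - move=> w _; rewrite lee_fin /local_spec; case: ifP => // _.
    rewrite divr_ge0 ?(ltW (weight_gt0 _)) ?sumr_ge0 // => x _.
    by rewrite ltW // weight_gt0.
  - apply/measurable_EFinP; apply: measurable_funTS.
    have := measurableT_comp (measurable_local_spec w1) (@measurable_restr W).
    by congr (measurable_fun _ _); apply/funext => w /=; exact: local_spec_restr.
  apply: eq_bigr => t _.
  case: (pselect (exists w0, rim_pattern W w0 = t)) => [[w0 <-]|none].
    rewrite cond_rim // -(integral_cst mu (mF _)).
    apply: eq_integral => w; rewrite inE => -[_ wt] /=; congr EFin.
    by apply: local_spec_rim; apply/rim_patternP.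
  have -> : F t = set0 by apply/seteqP; split => // w [_ h]; apply: none; exists w.
  by rewrite setI0 measure0 integral_set0.
pose bad_edge n : set (config V) :=
  if (choice.unpickle n : option (V * V)%type) is Some uv then
    (if e uv.1 uv.2 then [set w | w uv.1 && w uv.2] else set0) else set0.
have neg : mu.-negligible (\bigcup_n bad_edge n).
  apply: negligible_bigcup => n; rewrite /bad_edge.
  case: choice.unpickle => [[u v]|] /=; last exact: negligible_set0.
  case: ifP => euv; last exact: negligible_set0.
  have d : determined [:: u; v] ([set w | w u && w v] : set (config V)).
    by move=> w w' h /=; rewrite !h // !inE eqxx ?orbT.
  apply/negligibleP; first exact: (determined_measurable d).
  by apply: (eq_trans (mu_p d)); rewrite p_edge.
apply: negligibleS neg => w /= ne; apply: contrapT => nb; apply: ne.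
have feas : feasible e w.
  move=> u v euv; apply/negP => h; apply: nb; exists (choice.pickle (u, v)) => //.
  by rewrite /bad_edge choice.pickleK /= euv.
have fe (x : {ffun W -> bool}) : `[< feasible e (glue_config x (restr W w)) >] = `[< locally_feasible x w >].
  rewrite glueE patch_extend; apply/asboolP/asboolP => h.
    by move=> u v _ /orP[euv|euv]; [exact: h | rewrite andbC; exact: h].
  move=> u v euv; case: (boolP (u \in W)) => uW; first by apply: h => //; rewrite euv.
  case: (boolP (v \in W)) => vW; first by rewrite andbC; apply: h => //; rewrite euv orbT.
  by rewrite /patch !insubF ?(negPf uW) ?(negPf vW) //; exact: feas.
rewrite local_spec_restr /specification /local_spec fe; case: ifP => // _.
rewrite [RHS]mulrC /partition_function; congr (_ * _^-1).
by apply: eq_bigl => x; rewrite fe.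
Qed.

End Measure.

Theorem hard_core_exists : exists mu : probability (config V) R,
  hard_core e lam mu /\ forall s (A : set (config V)), determined s A -> mu A = (p A)%:E.
Proof.
have [mu h] := extension_exists p_ge0 pT pU.
by exists mu; split => //; exact: hard_core_of_dlr.
Qed.

End Gibbs.

From mathcomp Require Import fintype finset.

(** * From the torus to the lattice *)

Section Lattice.
Variable n : nat.
Local Notation V := 'rV[int]_n.
Implicit Types (u v : V) (i : 'I_n).

Definition unit_row i : V := delta_mx 0 i.

Lemma lattice_adjP u v : reflect (exists i, v = u + unit_row i \/ u = v + unit_row i) (lattice_adj u v).
Proof.
apply: (iffP eqP) => [h|[i h]].
  have [i ui] : exists i, u 0 i != v 0 i.
    apply: contrapT => none; move: h; rewrite big1 // => i _.
    apply/eqP; rewrite normr_eq0 subr_eq0; apply/negPn/negP => ne; apply: none; by exists i.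
  move: h; rewrite (bigD1 i) //= => h.
  have s0 : 0 <= \sum_(j < n | j != i) `|u 0 j - v 0 j| by apply: sumr_ge0.
  have a1 : 1 <= `|u 0 i - v 0 i| by rewrite -gtz0_ge1 normr_gt0 subr_eq0.
  have [ai /eqP] : `|u 0 i - v 0 i| = 1 /\ \sum_(j < n | j != i) `|u 0 j - v 0 j| = 0.
    by move: (`|_|) (\sum_(j < n | _) _) h s0 a1 => a b; lia.
  rewrite psumr_eq0 // => /allP hj.
  have uj j : j != i -> u 0 j = v 0 j.
    move=> ji; have := hj j (mem_index_enum _); rewrite ji /= normr_eq0 subr_eq0.
    by move/eqP.
  exists i; have [d1|d1] : u 0 i = v 0 i + 1 \/ v 0 i = u 0 i + 1.
    by move: (u 0 i) (v 0 i) ai => a b; lia.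
    right; apply/rowP => j; rewrite !mxE eqxx /=; case: (eqVneq j i) => [->|/uj ->] //.
    by rewrite addr0.
  left; apply/rowP => j; rewrite !mxE eqxx /=; case: (eqVneq j i) => [->|/uj ->] //.
  by rewrite addr0.
have e (x : V) : \sum_(j < n) `|x 0 j - (x + unit_row i) 0 j| = 1.
  rewrite (bigD1 i) //= big1 => [|j /negPf ji]; last by rewrite !mxE eqxx ji /= addr0 subrr normr0.
  by rewrite !mxE !eqxx /= opprD addrA subrr sub0r normrN normr1 addr0.
case: h => ->; first exact: e.
by rewrite -[RHS](e v); apply: eq_bigr => j _; rewrite distrC.
Qed.

Definition lattice_nbr u : seq V :=
  [seq u + unit_row i | i <- enum 'I_n] ++ [seq u - unit_row i | i <- enum 'I_n].

Lemma lattice_nbrP u v : lattice_adj u v || lattice_adj v u -> v \in lattice_nbr u.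
Proof.
rewrite mem_cat => /orP[] /lattice_adjP[i [] ->]; apply/orP.
- by left; apply/mapP; exists i; rewrite ?mem_enum.
- by right; apply/mapP; exists i; rewrite ?mem_enum // addrK.
- by right; apply/mapP; exists i; rewrite ?mem_enum // addrK.
- by left; apply/mapP; exists i; rewrite ?mem_enum.
Qed.

Section Projection.
Variable q : nat.
Local Notation torus := (torus n q).

Definition proj v : torus := [ffun i => (v 0 i)%:~R].

Definition pull (s : {set torus}) v : bool := proj v \in s.

Lemma proj_shift u i : proj (u + unit_row i) = shift i (proj u).
Proof.
apply/ffunP => j; rewrite !ffunE !mxE eqxx /=; case: (eqVneq j i) => [->|_].
  by rewrite intrD.
by rewrite addr0.
Qed.

Lemma intr_residue_eq0 (a : int) : `|a| < q.+2%:Z -> a%:~R = 0 :> 'I_q.+2 -> a = 0.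
Proof.
have nat0 m : (m < q.+2)%N -> m%:R = 0 :> 'I_q.+2 -> m = 0%N.
  by move=> mq /(congr1 val); rewrite val_natZ /= modn_small.
case: a => m /=.
  by rewrite ger0_norm // ltz_nat => /nat0 h; rewrite -pmulrn => /h ->.
rewrite NegzE normrN ger0_norm // ltz_nat => /nat0 h; rewrite intrN -pmulrn.
by move/eqP; rewrite oppr_eq0 => /eqP/h.
Qed.

Definition bounded (m : nat) v : Prop := forall i, `|v 0 i| <= m%:Z.

Lemma proj_inj m u v : bounded m u -> bounded m v -> (2 * m < q.+2)%N -> proj u = proj v -> u = v.
Proof.
move=> bu bv mq /ffunP e; apply/rowP => i; have := e i; rewrite !ffunE => /eqP.
rewrite -subr_eq0 -intrB => /eqP/intr_residue_eq0 h; apply/eqP; rewrite -subr_eq0 h //.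
have := bu i; have := bv i; lia.
Qed.

(** Each edge of the torus lies in a cell, for instance in the one based at its lower end. *)
Lemma torus_indepP k (qk : q.+2 = (2 ^ k.+1)%N) (s : {set torus}) :
  reflect (forall (v : torus) i, ~ (v \in s /\ shift i v \in s)) (torus_indep s).
Proof.
apply: (iffP forallP) => [h v i [vs svs]|h x].
  have /cube_indepP/(_ (parities v) i) := h v; rewrite !inE.
  have e1 : corner v (parities v) = v by apply/ffunP => j; rewrite !ffunE /endpoint eqxx.
  have e2 : corner v (flip i (parities v)) = shift i v.
    apply/ffunP => j; rewrite !ffunE /endpoint; case: (eqVneq j i) => [->|_].
      by case: (odd _).
    by rewrite eqxx.
  by rewrite e1 e2 svs => /(_ vs).
apply/cube_indepP => z i; rewrite !inE => zs; apply/negP => fzs.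
case: (boolP (odd (val (x i)) == z i)) => zi.
  apply: (h (corner x z) i); split=> //; move: fzs; congr (_ \in s).
  apply/ffunP => j; rewrite !ffunE; case: (eqVneq j i) => [->|//].
  rewrite /endpoint zi (eqP zi).
  by case: (z i).
apply: (h (corner x (flip i z)) i); split=> //; move: zs; congr (_ \in s).
apply/ffunP => j; rewrite !ffunE; case: (eqVneq j i) => [->|//].
rewrite /endpoint (negPf zi) eqxx.
by move: zi; case: (odd _); case: (z i).
Qed.

End Projection.
End Lattice.

(** * Resampling a finite window of the torus *)

Section Replace.
Variables (R : realType) (n q k : nat) (lam : R).
Hypothesis qk : q.+2 = (2 ^ k.+1)%N.
Local Notation V := 'rV[int]_n.
Local Notation torus := (torus n q).
Local Notation e := (@lattice_adj n).
Variables (W : {fset V}).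
Implicit Types (x y : {ffun W -> bool}) (s : {set torus}) (v : V).

Definition window : {set torus} := [set proj q (val v) | v : W].
Definition occupied x : {set torus} := [set proj q (val v) | v : W & x v].
Definition replace x s : {set torus} := (s :\: window) :|: occupied x.

Hypothesis W_inj : {in W &, injective (@proj n q)}.
Hypothesis nbr_inj : forall u v, u \in W -> v \in lattice_nbr u -> proj q v \in window -> v \in W.

Lemma occupied_window x : occupied x \subset window.
Proof. by apply/subsetP => t /imsetP[v _ ->]; apply: imset_f. Qed.

Lemma mem_occupied x (v : W) : (proj q (val v) \in occupied x) = x v.
Proof.
apply/imsetP/idP => [[u]|xv]; last by exists v; rewrite ?inE.
by rewrite inE => xu /W_inj e'; rewrite (val_inj (e' (valP v) (valP u))).
Qed.

Lemma mem_replace x (v : W) s : (proj q (val v) \in replace x s) = x v.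
Proof. by rewrite !inE imset_f //= mem_occupied. Qed.

Lemma mem_replace_out x s t : t \notin window -> (t \in replace x s) = (t \in s).
Proof.
move=> tW; rewrite !inE tW /=; case: (boolP (t \in occupied x)) => [|_]; last by rewrite orbF.
by move/(subsetP (occupied_window x)); rewrite (negPf tW).
Qed.

Lemma agree_replace x s : agree x (pull (replace x s)).
Proof. by move=> v; rewrite /pull mem_replace. Qed.

Lemma agree_cap x s : agree x (pull s) -> s :&: window = occupied x.
Proof.
move=> h; apply/setP => t; rewrite inE; apply/andP/idP => [[ts /imsetP[v _ tv]]|].
  by rewrite tv mem_occupied -h /pull -tv.
move=> to; split; last exact: (subsetP (occupied_window x)).
have /imsetP[v _ tv] := subsetP (occupied_window x) t to.
by move: to; rewrite tv mem_occupied -h.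
Qed.

Lemma replaceK x y s : agree x (pull s) -> replace x (replace y s) = s.
Proof.
move=> /agree_cap h; apply/setP => t; case: (boolP (t \in window)) => tW; last first.
  by rewrite !mem_replace_out.
rewrite !inE tW /= -h inE tW andbT.
by [].
Qed.

Lemma card_replace x y s : agree x (pull s) ->
  lam ^+ #|replace y s| * weight lam x = lam ^+ #|s| * weight lam y.
Proof.
have wE z : weight lam z = lam ^+ #|occupied z|.
  rewrite /weight card_in_imset.
    rewrite prodrXr; congr (_ ^+ _); rewrite -sum1_card [RHS]big_mkcond /=.
    by apply: eq_bigr => v _; rewrite inE; case: (z v).
  by move=> u v _ _ /W_inj h; apply: val_inj; apply: h; exact: valP.
move=> /agree_cap h; rewrite !wE -!exprD; congr (_ ^+ _).
rewrite /replace cardsU (_ : _ :&: occupied y = set0) ?cards0 ?subn0.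
  by rewrite -(cardsID window s) h addnC addnA addnAC.
apply/setP => t; rewrite !inE; apply/negP => /andP[/andP[tW _] /(subsetP (occupied_window y))].
by rewrite (negPf tW).
Qed.

Lemma pull_patch x s v : (v \in W \/ proj q v \notin window) -> pull (replace x s) v = patch x (pull s) v.
Proof.
rewrite /patch; case: insubP => [y yW <-|vW] /=; first by rewrite /pull mem_replace.
by case=> [h|h]; [move: vW; rewrite h | rewrite /pull mem_replace_out].
Qed.

Lemma torus_indep_replace x s : locally_feasible e x (pull s) ->
  torus_indep s -> torus_indep (replace x s).
Proof.
move=> lf /(torus_indepP qk) hs; apply/(torus_indepP qk) => t i [t1 t2].
have key u v : u \in W -> e u v || e v u -> ~ (proj q u \in replace x s /\ proj q v \in replace x s).
  move=> uW euv [h1 h2]; have := lf u v uW euv.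
  have pv : v \in W \/ proj q v \notin window.
    case: (boolP (proj q v \in window)) => h; last by right.
    left; apply: nbr_inj uW _ h; exact: lattice_nbrP.
  by rewrite -(pull_patch x s (or_introl uW)) -(pull_patch x s pv) /pull h1 h2.
case: (boolP (t \in window)) => [/imsetP[u _ tu]|tW].
  apply: (key (val u) (val u + unit_row i) (valP u)); last by rewrite proj_shift -tu.
  by apply/orP; left; apply/lattice_adjP; exists i; left.
case: (boolP (shift i t \in window)) => [/imsetP[u _ tu]|tW'].
  have tE : t = proj q (val u - unit_row i).
    by apply: (@shift_inj _ _ i); rewrite -proj_shift subrK.
  apply: (key (val u) (val u - unit_row i) (valP u)); last by rewrite -tE -tu.
  by apply/orP; right; apply/lattice_adjP; exists i; left; rewrite subrK.
by apply: (hs t i); rewrite -(mem_replace_out x s tW) -(mem_replace_out x s tW').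
Qed.

Lemma locally_feasible_replace x y s : locally_feasible e x (pull s) ->
  locally_feasible e x (pull (replace y s)).
Proof.
move=> lf u v uW euv; have := lf u v uW euv.
have pe z : z \in W \/ proj q z \notin window -> patch x (pull (replace y s)) z = patch x (pull s) z.
  rewrite /patch; case: insubP => // zW [h|h]; first by move: zW; rewrite h.
  by rewrite /pull mem_replace_out.
rewrite (pe u (or_introl uW)) (pe v) //.
case: (boolP (proj q v \in window)) => h; last by right.
left; apply: nbr_inj uW _ h; exact: lattice_nbrP.
Qed.

Lemma hc_weight_replace x y s : agree x (pull s) ->
  locally_feasible e x (pull s) -> locally_feasible e y (pull s) ->
  hc_weight lam (replace y s) * weight lam x = hc_weight lam s * weight lam y.
Proof.
move=> ax lx ly; rewrite /hc_weight -!mulrA card_replace //; congr (_%:R * _).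
suff -> : torus_indep (replace y s) = torus_indep s by [].
apply/idP/idP; last exact: torus_indep_replace.
move=> h; rewrite -(replaceK y ax); apply: torus_indep_replace h.
exact: locally_feasible_replace.
Qed.

Lemma mass_replace x y (P : pred {set torus}) :
  (forall s, P s -> locally_feasible e x (pull s) /\ locally_feasible e y (pull s)) ->
  (forall z s, P s -> P (replace z s)) ->
  hc_mass lam (fun s => `[< agree x (pull s) >] && P s) * weight lam y =
  hc_mass lam (fun s => `[< agree y (pull s) >] && P s) * weight lam x.
Proof.
move=> lP rP; rewrite /hc_mass !mulr_suml.
rewrite (reindex_onto (replace x) (replace y)) /=; last first.
  by move=> s /andP[/asboolP ax _]; exact: replaceK.
apply: eq_big => s.
  apply/idP/idP => [/andP[/andP[_ Ps] /eqP e']|/andP[/asboolP ay Ps]].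
    by rewrite -e' rP // andbT; apply/asboolP; exact: agree_replace.
  by rewrite rP // replaceK // eqxx !andbT; apply/asboolP; exact: agree_replace.
move=> /andP[/andP[_ Ps] /eqP e'].
have Ps' : P s by rewrite -e'; exact: rP.
have ay : agree y (pull s) by rewrite -e'; exact: agree_replace.
have [lx ly] := lP s Ps'.
exact: hc_weight_replace.
Qed.

End Replace.

Definition side (k : nat) : nat := (2 ^ k.+2).-2.

Lemma sideE k : (side k).+2 = (2 ^ k.+2)%N.
Proof. by have h : (0 < 2 ^ k)%N := expn_gt0 2 k; rewrite /side !expnS; lia. Qed.

Lemma bounded_seq n (l : seq 'rV[int]_n) : exists m, forall v, v \in l -> bounded m v.
Proof.
elim: l => [|v l [m h]]; first by exists 0%N.
exists (m + \sum_i `|v 0%R i|)%N => u; rewrite inE => /orP[/eqP ->|/h hu] i; last first.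
  by apply: le_trans (hu i) _; rewrite lez_nat leq_addr.
by rewrite (bigD1 i) //= -abszE lez_nat; lia.
Qed.

(** * Torus measures restricted to a phase of the far block *)

Section TorusGibbs.
Variables (R : realType) (n : nat) (lam : R).
Hypothesis lam_gt0 : 0 < lam.
Hypothesis n_gt0 : (0 < n)%N.
Variable K : R.
Local Notation V := 'rV[int]_n.
Local Notation e := (@lattice_adj n).
Implicit Types (u v : V) (A : set (V -> bool)) (y z : cube n) (m k : nat) (b : bool).

Lemma coarse_even_eq q (s s' : {set torus n q}) x :
  (forall y z, (corner (translate x y) z \in s) = (corner (translate x y) z \in s')) ->
  coarse_even K s x = coarse_even K s' x.
Proof.
move=> h; rewrite /coarse_even; congr (_ < _%:R); apply: eq_card => y; rewrite !inE.
rewrite /even_cell /bad_cell; suff -> : pattern (translate x y) s = pattern (translate x y) s' by [].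
by apply/setP => z; rewrite !inE h.
Qed.

(** The lift to the lattice of a corner in the origin block: the cell spans y j to y j + 1, and
    [z j] selects an end by its parity, as in [endpoint]. *)
Definition origin_site y z : V := \row_j (if y j == z j then y j : nat else (y j).+1)%:Z.

Definition local_pattern (w : V -> bool) y : {set cube n} := [set z | w (origin_site y z)].

Definition origin_even (w : V -> bool) : bool :=
  2 ^+ n / 2 < #|[set y | ~~ bad_cube K (local_pattern w y) && few K (@odd_part n) (local_pattern w y)]|%:R :> R.

Lemma odd_step q b : odd (val (step q b)) = b.
Proof. by case: b. Qed.

Lemma proj_origin_site q y z : proj q (origin_site y z) = corner (translate (plane_site n q (0, 0)%N) y) z.
Proof.
apply/ffunP => j; rewrite !ffunE mxE /plane_coord /=.
have -> : (if val j == 0 then 0 else if val j == 1 then 0 else 0)%N = 0%N by case: ifP => // _; case: ifP.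
rewrite muln0 add0r /endpoint odd_step.
by case: eqP => _; case: (y j) => /=; rewrite ?add0r -?pmulrn /= ?mulr0n ?mulr1n ?mulr2n.
Qed.

Lemma origin_evenE q (s : {set torus n q}) : origin_even (pull s) = coarse_even K s (plane_site n q (0, 0)%N).
Proof.
rewrite /origin_even /coarse_even; congr (_ < _%:R); apply: eq_card => y; rewrite !inE.
rewrite /even_cell /bad_cell.
suff -> : local_pattern (pull s) y = pattern (translate (plane_site n q (0, 0)%N) y) s by [].
by apply/setP => z; rewrite !inE /pull proj_origin_site.
Qed.

Definition origin_sites : seq V := [seq origin_site p.1 p.2 | p <- enum {: cube n * cube n}].

Lemma determined_origin_even : determined origin_sites (fun w => origin_even w).
Proof.
move=> w w' h /=; rewrite /origin_even.
suff e' y : local_pattern w y = local_pattern w' y.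
  by move=> h1; congr (is_true (_ < _%:R)): h1; apply: eq_card => y; rewrite !inE e'.
apply/setP => z; rewrite !inE; apply: h.
by apply/mapP; exists (y, z); rewrite ?mem_enum.
Qed.

Definition far_site k : torus n (side k) := plane_site n (side k) (2 ^ k, 0)%N.

(** The first coordinates of the far block are 2 * 2^k + j with j <= 2, modulo 4 * 2^k, out of reach
    of a window of radius [m]. *)
Lemma far_corner m k v y z : bounded m v -> (m + 2 < 2 ^ k)%N ->
  corner (translate (far_site k) y) z <> proj (side k) v.
Proof.
move=> bv mk /ffunP/(_ (Ordinal n_gt0)); rewrite !ffunE /=.
set i := Ordinal n_gt0; rewrite (_ : plane_coord _ i = 2 ^ k)%N //.
have [j j2 ->] : exists2 j : nat, (j <= 2)%N &
    endpoint ((2 * 2 ^ k)%:R + step (side k) (y i)) (z i) = (2 * 2 ^ k + j)%:R :> 'I_(side k).+2.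
  rewrite (_ : step _ _ = (nat_of_bool (y i))%:R); last by case: (y i).
  rewrite /endpoint; case: ifP => _.
    by exists (y i) => //; [case: (y i) | rewrite natrD].
  by exists (y i).+1; [case: (y i) | move: (2 * 2 ^ k)%N => a; rewrite addnS mulrSr natrD].
move=> /eqP; rewrite eq_sym -subr_eq0 pmulrn -intrB => /eqP/intr_residue_eq0 h.
have := bv i; move: h; rewrite sideE !expnS; move: mk; move: (2 ^ k)%N (v 0 i) => r a; lia.
Qed.

Definition cond_mass k b A : R :=
  hc_mass lam (fun s : {set torus n (side k)} => (coarse_even K s (far_site k) == b) && `[< A (pull s) >]).

Lemma cond_mass_dlr m k b (W : {fset V}) (w1 w1' : {ffun W -> bool}) (l : seq V) A :
  (m + 2 < 2 ^ k)%N ->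
  (forall u, u \in W -> bounded m u /\ forall v, v \in lattice_nbr u -> bounded m v) ->
  (forall v, v \in l -> bounded m v) ->
  determined l A ->
  (forall w w', (forall v, v \notin W -> w v = w' v) -> A w -> A w') ->
  (forall w, A w -> locally_feasible e w1 w /\ locally_feasible e w1' w) ->
  cond_mass k b (fun w => agree w1 w /\ A w) * weight lam w1' =
  cond_mass k b (fun w => agree w1' w /\ A w) * weight lam w1.
Proof.
move=> mk bW bl dA iA fA.
have mq : (2 * m < (side k).+2)%N by rewrite sideE !expnS; lia.
pose P (s : {set torus n (side k)}) := (coarse_even K s (far_site k) == b) && `[< A (pull s) >].
have winP v : bounded m v -> proj (side k) v \in window (side k) W -> v \in W.
  move=> bv /imsetP[u _ h]; rewrite (proj_inj bv (bW _ (valP u)).1 mq h); exact: valP.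
have W_inj : {in W &, injective (@proj n (side k))}.
  by move=> u v uW vW; apply: proj_inj mq; [exact: (bW u uW).1 | exact: (bW v vW).1].
have nbr_inj u v : u \in W -> v \in lattice_nbr u -> proj (side k) v \in window (side k) W -> v \in W.
  by move=> uW vu; apply: winP; exact: (bW u uW).2.
have qk := sideE k.
have fP s : P s -> locally_feasible e w1 (pull s) /\ locally_feasible e w1' (pull s).
  by move=> /andP[_ /asboolP]; exact: fA.
have rP (z : {ffun W -> bool}) s : P s -> P (replace z s).
  move=> /andP[/eqP h1 /asboolP h2]; apply/andP; split.
    apply/eqP; rewrite -h1; apply: coarse_even_eq => y y'; apply: mem_replace_out.
    apply/negP => /imsetP[u _ h]; exact: far_corner (bW _ (valP u)).1 mk h.
  apply/asboolP.
  (* This intermediate configuration agrees with [pull s] off [W], and with the replaced one on all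
     sites that determine [A]. *)
  have h3 : A (fun v => if v \in W then pull (replace z s) v else pull s v).
    by apply: iA h2 => v /negPf ->.
  apply: dA h3 => v vl; case: (boolP (v \in W)) => // vW.
  rewrite /pull mem_replace_out //; apply/negP => /(winP _ (bl v vl)).
  by rewrite (negPf vW).
have := mass_replace lam qk W_inj nbr_inj fP rP.
have E (w : {ffun W -> bool}) : hc_mass lam (fun s => `[< agree w (pull s) >] && P s) =
    cond_mass k b (fun w' => agree w w' /\ A w').
  apply: eq_bigl => s; rewrite /P asbool_and andbCA andbA; congr (_ && _).
by rewrite !E.
Qed.

Lemma cond_mass_edge k b u v : e u v -> cond_mass k b (fun w => w u && w v) = 0.
Proof.
move=> euv; rewrite /cond_mass /hc_mass big1 // => s /andP[_ /asboolP h].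
rewrite /hc_weight; case: (boolP (torus_indep s)) => [hs|_]; last by rewrite mul0r.
have {}hs := elimT (torus_indepP (sideE k) s) hs; exfalso.
case/andP: h; rewrite /pull; case/lattice_adjP: euv => i [->|->]; rewrite proj_shift => h1 h2.
  by apply: (hs (proj (side k) u) i).
by apply: (hs (proj (side k) v) i).
Qed.

Lemma cond_mass_ge0 k b A : 0 <= cond_mass k b A.
Proof. by apply: sumr_ge0 => s _; exact: hc_weight_ge0. Qed.

Lemma cond_massU k b A B : (forall w, A w -> ~ B w) ->
  cond_mass k b (fun w => A w \/ B w) = cond_mass k b A + cond_mass k b B.
Proof.
move=> AB; rewrite /cond_mass /hc_mass (bigID (fun s => `[< A (pull s) >])) /=; congr (_ + _).
  apply: eq_bigl => s; rewrite asbool_or; case: asboolP => //=; rewrite ?andbT ?andbF //.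
apply: eq_bigl => s; rewrite asbool_or; case: asboolP => /= [/AB h|_]; rewrite ?andbT ?andbF //=.
by rewrite (asboolF h) andbF.
Qed.

End TorusGibbs.

From mathcomp Require Import boolp classical_sets.
Import numFieldNormedType.Exports.

(** One ultrafilter serves all indices, here all sets of configurations. Inequalities with three
    terms cover positivity, total mass, additivity and the ratio identities of [p_dlr]. *)
Lemma ultralimit (R : realType) (I : Type) (P : nat -> I -> R) : (forall k i, 0 <= P k i <= 1) ->
  exists p : I -> R, forall (i1 i2 i3 : I) (a b c d : R),
    (exists k0, forall k, (k0 <= k)%N -> a * P k i1 + b * P k i2 + c * P k i3 <= d) ->
    a * p i1 + b * p i2 + c * p i3 <= d.
Proof.
move=> P01; have [F [UF leF]] := ultraFilterLemma (@eventually_filter).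
have cvgP i : exists l : R, ((fun k => P k i) @ F --> l)%classic.
  have FF : ((fun k => P k i) @ F)%classic `[0, 1]%classic.
    by rewrite /fmap /= (_ : (_ @^-1` _)%classic = setT)%classic; [exact: filterT | apply/seteqP; split => // k _ /=; rewrite in_itv /= P01].
  have [l [_ cl]] := segment_compact _ FF.
  exists l => U Ul; have [//|nU] := in_ultra_setVsetC ((fun k => P k i) @^-1` U)%classic UF.
  by have [x []] := cl (~` U)%classic U nU Ul.
have [p pP] := choice cvgP.
exists p => i1 i2 i3 a b c d [k0 hk].
have c1 : ((fun k => a * P k i1 + b * P k i2 + c * P k i3) @ F --> a * p i1 + b * p i2 + c * p i3)%classic.
  by apply: cvgD; [apply: cvgD|]; apply: cvgMl_tmp; exact: pP.
apply: ler_cvg_to c1 (cvg_cst d) _.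
by apply: leF; exists k0.
Qed.

From mathcomp Require Import boolp classical_sets.
(** * Coexistence of two phases *)

Section Coexistence.
Local Open Scope classical_set_scope.
Variables (R : realType) (n : nat) (lam : R).
Hypothesis lam_gt0 : 0 < lam.
Local Notation N := (n%:R : R).
Hypothesis L_ge : (20 * 100) <= ln N.
Hypothesis th_large : ln N ^+ 6 <= act lam ^+ 3 * N.
Hypothesis M_large : N ^+ 3 <= 2 ^+ n.
Local Notation V := 'rV[int]_n.
Local Notation e := (@lattice_adj n).
Local Notation K := (K0 n lam).
Implicit Types (b : bool) (A : set (V -> bool)).

Local Notation mass k b A := (cond_mass lam K k b A).

Lemma cond_mass_total k b : 49 / 100 * hc_Z n (side k) lam <= mass k b (fun _ : V -> bool => True).
Proof.
have [h1 h2] := balanced (sideE k) lam_gt0 L_ge th_large M_large (far_site n k).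
case: b; [apply: le_trans h1 _ | apply: le_trans h2 _]; apply: hc_mass_le => // s h.
  by rewrite h; apply/asboolP.
by rewrite (negPf h); apply/asboolP.
Qed.

Lemma hc_Z_gt0 k : 0 < hc_Z n (side k) lam.
Proof.
rewrite lt_neqAle sumr_ge0 ?andbT => [|s _]; last exact: hc_weight_ge0.
have := hc_Z_lower (sideE k) (ltnW (n_gt1 L_ge)) lam_gt0; case: eqP => // <-.
by rewrite expr0n /= leNgt exprn_gt0 // ltr_pwDl ?ltr01 // ltW.
Qed.

Lemma cond_mass_total_gt0 k b : 0 < mass k b (fun _ : V -> bool => True).
Proof. by apply: lt_le_trans (cond_mass_total k b); rewrite mulr_gt0 ?hc_Z_gt0 // divr_gt0 // ltr0n. Qed.

(** The bound 1/40 of [peierls] is less than a tenth of the 49/100 of [cond_mass_total]. *)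
Lemma cond_mass_disagree k b :
  mass k b (fun w : V -> bool => origin_even K w != b) <=
  1 / 10 * mass k b (fun _ : V -> bool => True).
Proof.
apply: le_trans (_ : 1 / 40 * hc_Z n (side k) lam <= _).
  apply: le_trans (peierls (sideE k) lam_gt0 L_ge th_large M_large).
  apply: hc_mass_le => // s /andP[/eqP h /asboolP].
  by rewrite origin_evenE -h.
have := cond_mass_total k b; have := hc_Z_gt0 k.
by move: (hc_Z _ _ _) (mass _ _ _) => a c; lra.
Qed.

Lemma conditioned_hard_core b : exists mu : probability (config V) R,
  hard_core e lam mu /\ (mu [set w | origin_even K w != b] <= (1 / 10)%:E)%E.
Proof.
pose P k A := mass k b A / mass k b (fun _ : V -> bool => True).
have P01 k A : 0 <= P k A <= 1.
  have t0 := cond_mass_total_gt0 k b.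
  rewrite divr_ge0 ?cond_mass_ge0 //= ler_pdivrMr // mul1r.
  by apply: hc_mass_le => // s /andP[-> _]; apply/asboolP.
have [p pI] := ultralimit P01.
have pE A1 A2 A3 (x y z t : R) :
    (exists k0, forall k, (k0 <= k)%N -> x * P k A1 + y * P k A2 + z * P k A3 = t) ->
    x * p A1 + y * p A2 + z * p A3 = t.
  move=> [k0 h]; apply/le_anti/andP; split.
    by apply: pI; exists k0 => k /h ->.
  have : - x * p A1 + - y * p A2 + - z * p A3 <= - t.
    by apply: pI; exists k0 => k /h; lra.
  lra.
have p0 A : 0 <= p A.
  have : - 1 * p A + 0 * p A + 0 * p A <= 0.
    by apply: pI; exists 0%N => k _; have /andP[] := P01 k A; lra.
  lra.
have pT : p setT = 1.
  have : 1 * p setT + 0 * p setT + 0 * p setT = 1.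
    apply: pE; exists 0%N => k _; rewrite !mul0r !addr0 mul1r.
    by apply: divff; rewrite gt_eqF // cond_mass_total_gt0.
  lra.
have pU A B : A `&` B = set0 -> p (A `|` B) = p A + p B.
  move=> AB; have : 1 * p (A `|` B) + - 1 * p A + - 1 * p B = 0.
    apply: pE; exists 0%N => k _; rewrite /P.
    have -> : mass k b (A `|` B) = mass k b A + mass k b B.
      by apply: cond_massU => w Aw Bw; rewrite -[False]/(set0 w) -AB.
    lra.
  lra.
have pe u v : e u v -> p [set w | w u && w v] = 0.
  move=> euv; have : 1 * p [set w | w u && w v] + 0 * p setT + 0 * p setT = 0.
    apply: pE; exists 0%N => k _; rewrite /P.
    have -> : mass k b [set w | w u && w v] = 0 by exact: cond_mass_edge.
    lra.
  lra.
have pd (W : {fset V}) (w1 w1' : {ffun W -> bool}) (s : seq V) (A : set (V -> bool)) :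
    determined s A -> (forall w w', (forall v, v \notin W -> w v = w' v) -> A w -> A w') ->
    (forall w, A w -> locally_feasible e w1 w /\ locally_feasible e w1' w) ->
    p (agree w1 `&` A) * weight lam w1' = p (agree w1' `&` A) * weight lam w1.
  move=> dA iA fA.
  have [m hm] := bounded_seq (enum_fset W ++ s ++ flatten [seq lattice_nbr u | u <- enum_fset W]).
  have : weight lam w1' * p (agree w1 `&` A) + - weight lam w1 * p (agree w1' `&` A) + 0 * p setT = 0.
    apply: pE; exists (m + 3)%N => k mk.
    have mk2 : (m + 2 < 2 ^ k)%N by apply: leq_trans (ltn_expl k _) => //; lia.
    have bW u : u \in W -> bounded m u /\ forall v, v \in lattice_nbr u -> bounded m v.
      move=> uW; split=> [|v vu]; apply: hm; rewrite !mem_cat; first by rewrite uW.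
      apply/orP; right; apply/orP; right; apply/flattenP.
      by exists (lattice_nbr u) => //; apply: map_f.
    have bs v : v \in s -> bounded m v by move=> vs; apply: hm; rewrite !mem_cat vs orbT.
    have h := cond_mass_dlr lam_gt0 (ltnW (n_gt1 L_ge)) K b mk2 bW bs dA iA fA.
    rewrite /P mul0r addr0 mulNr mulrA mulrA -mulrBl ![weight _ _ * _]mulrC.
    by rewrite (eqP (_ : _ - _ == 0)) ?mul0r // subr_eq0; apply/eqP; exact: h.
  lra.
have [mu [hmu muE]] := hard_core_exists (@lattice_nbrP n) lam_gt0 p0 pT pU pe pd.
exists mu; split=> //.
have d : determined (origin_sites n) [set w : V -> bool | origin_even K w != b].
  move=> w w' ww' /=; suff -> : origin_even K w = origin_even K w' by [].
  by apply/idP/idP; apply: determined_origin_even => v /ww'.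
rewrite (muE _ _ d) lee_fin.
have : 1 * p [set w : V -> bool | origin_even K w != b] + 0 * p setT + 0 * p setT <= 1 / 10.
  apply: pI; exists 0%N => k _; rewrite !mul0r !addr0 mul1r ler_pdivrMr ?cond_mass_total_gt0 //.
  exact: cond_mass_disagree.
lra.
Qed.

(** A unique measure would give probability at most 1/10 to each of two complementary events. *)
Theorem not_unique_hard_core : ~ unique_hard_core e lam.
Proof.
move=> [mu [_ uniq]].
have [mt [ht et]] := conditioned_hard_core true; have [mf [hf ef]] := conditioned_hard_core false.
have m b : measurable ([set w | origin_even K w != b] : set (config V)).
  apply: (@determined_measurable _ (origin_sites n)) => w w' ww' /=.
  suff -> : origin_even K w = origin_even K w' by [].
  by apply/idP/idP; apply: determined_origin_even => v /ww'.
rewrite (uniq _ ht _ (m true)) in et; rewrite (uniq _ hf _ (m false)) in ef.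
have : (mu setT <= (2 / 10)%:E)%E.
  rewrite (_ : setT = [set w | origin_even K w != true] `|` [set w | origin_even K w != false]).
    apply: le_trans (measureU2 _ (m true) (m false)) _.
    by apply: le_trans (leeD et ef) _; rewrite -EFinD lee_fin; lra.
  by apply/seteqP; split => // w _ /=; case: (origin_even K w); [right|left].
by rewrite probability_setT lee_fin; lra.
Qed.

End Coexistence.

Lemma cube_le_expn2 m : (10 <= m)%N -> (m ^ 3 <= 2 ^ m)%N.
Proof.
elim: m => // m IH; rewrite leq_eqVlt => /predU1P[[<-] //|m10].
have := IH m10; rewrite [(2 ^ _.+1)%N]expnS; move: (2 ^ m)%N m10 => a m10; rewrite !expnS expn0; nia.
Qed.

(** Used for activities above 1, where [act] equals 1. Twelve factors expR (l / 12) >= l / 12 give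
    (l^2 / 144)^6, and l >= 144. *)
Lemma ln_pow6_le (R : realType) (x : R) : 0 < x -> (2 * 100) <= ln x -> ln x ^+ 6 <= x.
Proof.
move=> x0 L; rewrite -[leRHS]lnK ?posrE //; set l := ln x in L *.
have -> : expR l = expR (l / 12) ^+ 12 by rewrite -expRM_natl; congr expR; lra.
apply: le_trans (_ : (l / 12) ^+ 12 <= _); last first.
  rewrite lerXn2r ?nnegrE ?expR_ge0 //; first lra.
  by apply: le_trans (expR_ge1Dx _); lra.
rewrite -[12%N]/(2 * 6)%N exprM lerXn2r ?nnegrE ?sqr_ge0 //; first lra.
by rewrite expr2; nra.
Qed.

Theorem theorem1p3 (R : realType) :
  exists (d0 : nat) (C : R), forall d : nat, (d0 <= d)%N ->
    (lambda_c R d <= (C * d%:R `^ (- 3^-1) * ln d%:R ^+ 2)%:E)%E.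
Proof.
(* This [d0] ensures ln d >= 2000. Then C = 1 suffices, the constants being absorbed by the surplus
   powers of ln d. *)
exists (Num.truncn (expR (20 * 100 : R))).+1, 1 => d dd0.
have dE : expR (20 * 100) <= d%:R :> R.
  apply: ltW; apply: lt_le_trans (truncnS_gt _) _; by rewrite ler_nat.
have d_gt0 : 0 < d%:R :> R by apply: lt_le_trans (expR_gt0 _) dE.
have L : 20 * 100 <= ln (d%:R : R) by rewrite -[leLHS]expRK ler_ln ?posrE ?expR_gt0.
have d10 : (10 <= d)%N.
  rewrite -(ler_nat R); apply: le_trans dE; apply: le_trans (expR_ge1Dx _); lra.
have M : d%:R ^+ 3 <= 2 ^+ d :> R.
  by rewrite -natrX -[X in _ <= X ^+ _]/(2%:R) -natrX ler_nat cube_le_expn2.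
apply: ge_ereal_sup => _ [lam [lam0 uniq] <-]; rewrite lee_fin mul1r leNgt; apply/negP => big.
apply: (not_unique_hard_core lam0 L _ M uniq).
rewrite /act; case: (leP lam 1) => _; last first.
  by rewrite expr1n mul1r ln_pow6_le //; lra.
have -> : ln d%:R ^+ 6 = (d%:R `^ (- 3^-1) * ln d%:R ^+ 2) ^+ 3 * d%:R :> R.
  rewrite exprMn -exprM -(powR_mulrn 3 (powR_ge0 _ _)) -powRrM mulNr mulVf // powR_inv1 ?(ltW d_gt0) //.
  by rewrite mulrAC mulVf ?mul1r // gt_eqF.
rewrite ler_pM2r // lerXn2r ?nnegrE ?(ltW lam0) ?(ltW big) //.
by rewrite mulr_ge0 ?powR_ge0 // sqr_ge0.
Qed.
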